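(* Let $M\in\{1,2\}$ and let $F:\mathbb R^2\to\mathbb R^2$, $G=(G_1,\dots,G_M):\mathbb R^2\to\mathbb M_{2\times M}$ satisfy: (1) $F,G$ are of class $\mathcal C^{1,1}$ with all partial derivatives Lipschitz with constant $L$; (2) $F(0)=0$; (3) $\mathrm{rank}[G_i(0),DF(0)G_i(0)]=2$ for $i=1,\dots,M$; (4) $DG(0)=0$. Let $T$ be the minimum time function to reach the origin for $\dot x=F(x)+G(x)u$, $u\in[-1,1]^M$. Then there exists $\mathcal T>0$ depending only on $G(0)$, $DF(0)$ and $L$ such that $T\in SBV_{\mathrm{loc}}(\mathrm{int}(\mathcal R_{\mathcal T}))$.
   Context: $\mathcal R_t=\{x: T(x)\le t\}$. $SBV_{\mathrm{loc}}(\Omega)$ denotes the functions of locally bounded variation on $\Omega$ whose distributional derivative has vanishing Cantor part. *)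

(* Defs.v *)
Set Warnings "-notation-overridden,-ambiguous-paths,-notation-incompatible-prefix".
From HB Require Import structures.
From mathcomp Require Import all_boot all_algebra.
From mathcomp Require Import all_classical all_reals all_analysis.
Import GRing.Theory Num.Theory numFieldTopology.Exports numFieldNormedType.Exports.

Set Implicit Arguments.
Unset Strict Implicit.
Unset Printing Implicit Defensive.

Local Open Scope ring_scope.
Local Open Scope classical_set_scope.

(* Points of R^2 are pairs (x.1, x.2) : R * R, with the product topology
   (= Euclidean topology) and the product (= Borel) sigma-algebra.          *)

Section Defs.
Variable R : realType.

Definition leb2 := ((@lebesgue_measure R) \x (@lebesgue_measure R))%E.

Definition vcomp (k : 'I_2) (v : R * R) : R := if k == ord0 then v.1 else v.2.

Definition dpart (j : 'I_2) (f : R * R -> R) (x : R * R) : R :=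
  if j == ord0 then (fun t => f (t, x.2))^`() x.1
  else (fun t => f (x.1, t))^`() x.2.

Definition has_dpart (j : 'I_2) (f : R * R -> R) (x : R * R) : Prop :=
  if j == ord0 then derivable (fun t => f (t, x.2)) x.1 1
  else derivable (fun t => f (x.1, t)) x.2 1.

Definition edist (x y : R * R) : R :=
  Num.sqrt ((x.1 - y.1) ^+ 2 + (x.2 - y.2) ^+ 2).

Definition C11 (L : R) (f : R * R -> R) : Prop :=
  (forall j x, has_dpart j f x) /\
  (forall j x y, `|dpart j f x - dpart j f y| <= L * edist x y).

Definition C11_vec (L : R) (f : R * R -> R * R) : Prop :=
  forall k, C11 L (vcomp k \o f).

Section Control.
Variable M : nat.
Variable F : R * R -> R * R.
Variable G : 'I_M -> R * R -> R * R.   (* G i = i-th column G_i *)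

Definition dyn (k : 'I_2) (x : R * R) (u : 'I_M -> R) : R :=
  vcomp k (F x) + \sum_(i < M) u i * vcomp k (G i x).

Definition admissible (u : R -> 'I_M -> R) : Prop :=
  (forall i, measurable_fun setT (fun t => u t i)) /\
  (forall t i, -1 <= u t i <= 1).

Definition trajectory (x0 : R * R) (u : R -> 'I_M -> R) (x : R -> R * R)
    (t : R) : Prop :=
  forall s, 0 <= s <= t -> forall k,
    (@lebesgue_measure R).-integrable `[0, s]
        (EFin \o (fun r => dyn k (x r) (u r))) /\
    vcomp k (x s) = vcomp k x0 +
        Rintegral (@lebesgue_measure R) `[0, s] (fun r => dyn k (x r) (u r)).

Definition reach_time (x0 : R * R) (t : R) : Prop :=
  0 <= t /\ exists u x, admissible u /\ trajectory x0 u x t /\ x t = (0, 0).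

(* minimum time function (+oo when the origin cannot be reached) *)
Definition min_time (x0 : R * R) : \bar R :=
  ereal_inf [set t%:E | t in reach_time x0].

Definition reach_set (t : R) : set (R * R) :=
  [set x | (min_time x <= t%:E)%E].
End Control.

Definition eball (x : R * R) (r : R) : set (R * R) :=
  [set y | (y.1 - x.1) ^+ 2 + (y.2 - x.2) ^+ 2 < r ^+ 2].

Definition approx_limit (u : R * R -> R) (x : R * R) (z : R) : Prop :=
  forall e : R, 0 < e -> exists2 d : R, 0 < d & forall r : R, 0 < r < d ->
    (\int[leb2]_(y in eball x r) (`|u y - z|)%:E <= e%:E * leb2 (eball x r))%E.

Definition approx_disc_set (u : R * R -> R) (V : set (R * R)) : set (R * R) :=
  [set x | V x /\ ~ (exists z, approx_limit u x z)].

Definition test_fun (V : set (R * R)) (phi : R * R -> R) : Prop :=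
  (forall j x, has_dpart j phi x) /\ (forall j, continuous (dpart j phi)) /\
  exists K, [/\ compact K, K `<=` V & forall x, ~ K x -> phi x = 0].

(* u in SBV(V) (V open):  u in L^1(V); the distributional gradient Du =
   (D_0 u, D_1 u) is a finite R^2-valued Borel measure on V, each D_j u being
   written as the difference  mp j - mn j  of two finite measures carried by V;
   and the Cantor part D^c u = D^s u restricted to V \ S_u vanishes, where
   D^s u is the singular part of Du w.r.t. Lebesgue measure (Lebesgue
   decomposition  mp j = ap + sp,  mn j = an + sn,  ap, an << leb2,
   sp, sn carried by a Lebesgue-null set, D^s_j u = sp - sn). *)
Definition SBV (u : R * R -> R) (V : set (R * R)) : Prop :=
  measurable_fun V u /\ leb2.-integrable V (EFin \o u) /\
  exists mp mn : 'I_2 -> {finite_measure set (R * R)%type -> \bar R},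
    (forall j, mp j (~` V) = 0%E /\ mn j (~` V) = 0%E) /\
    (forall j phi, test_fun V phi ->
       (\int[leb2]_(x in V) (u x * dpart j phi x)%:E =
         - (\int[mp j]_x (phi x)%:E - \int[mn j]_x (phi x)%:E))%E) /\
    (forall j, exists ap sp an sn : {finite_measure set (R * R)%type -> \bar R},
       [/\ (forall A, measurable A -> mp j A = (ap A + sp A)%E) /\
           (forall A, measurable A -> mn j A = (an A + sn A)%E),
           ap `<< leb2, an `<< leb2,
           (exists N, [/\ measurable N, leb2 N = 0%E,
                          sp (~` N) = 0%E & sn (~` N) = 0%E]) &
           (forall B, measurable B -> B `<=` V `\` approx_disc_set u V ->
              sp B = sn B)]).

Definition SBV_loc (u : R * R -> R) (Omega : set (R * R)) : Prop :=
  forall V : set (R * R), open V -> compact (closure V) ->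
    closure V `<=` Omega -> SBV u V.

End Defs.

(* Main.v *)
Require Import Defs.
Set Warnings "-notation-overridden,-ambiguous-paths,-notation-incompatible-prefix,-redundant-canonical-projection".
From HB Require Import structures.
From mathcomp Require Import all_boot all_order all_algebra.
From mathcomp Require Import all_classical all_reals all_analysis.
From mathcomp Require Import measurable_realfun.
From mathcomp Require Import ring lra.
Import Order.TTheory GRing.Theory Num.Theory numFieldTopology.Exports numFieldNormedType.Exports.
Set Implicit Arguments.
Unset Strict Implicit.
Unset Printing Implicit Defensive.
Local Open Scope ring_scope.
Local Open Scope classical_set_scope.

(**
The minimum time function T turns out to be a Sobolev function: near the origin it is continuous and
has an integrable weak gradient, so its distributional derivative has no singular part at all.

In the coordinates x = a G_i(0) + b DF(0) G_i(0) the dynamics is a perturbed double integrator, and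
an explicit control combined with a contraction argument gives T(z) <= C (|a| + sqrt |b|), hence
T is Hoelder of exponent 1/2.

If two of the vectors G_i(0) are independent, constant controls already give T(z) <= C |z|, and T is
Lipschitz.  If they are all parallel, take any control u steering z to the origin in time t, and let D
be the double integral of its defect from an extremal constant control e = (+-1, ..., +-1).  Pushing u
a little towards e moves the endpoint in the b-direction at rate D, so a neighbour z' of z is
steered to the origin in time t + C |z' - z| / sqrt D.  On the other hand D bounds the distance from
z to the trajectory Gamma of the constant control e through the origin, because the drift vanishes
at 0.  Therefore |T(z') - T(z)| <= C |z' - z| (1 + dist(z, Gamma)^(-1/2)) for the union Gamma of
the two curves given by e and -e.  No existence or structure of optimal controls is needed.

The curves are almost tangent to G_i(0), so on coordinate lines transversal to it the weight is
bounded by a sum of two functions c |s - s0|^(-1/2), which are integrable.  Difference quotients of T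
along coordinate lines are thus dominated by an integrable weight, and they converge almost
everywhere because T is locally Lipschitz off Gamma; dominated convergence produces the weak gradient.
*)

(** * Interval integrals and planar differential equations *)

(** The obstacle is that T need not be Lipschitz near the two curves; the exponent 1/2 that keeps
    the weight integrable arises as a quotient. To repair a b-error of size delta the control is
    pushed by a fraction delta / D, which shifts the a-coordinate by about (delta / D) Q, with Q the
    single integral of the defect. Since Q^2 <= 8 M D, the shift is of order delta / sqrt D, and an
    error in a alone costs time linearly. The sign of the b-error decides between e and -e, so both
    defects must be bounded below, and this is why both curves occur.

    When |z' - z| exceeds a multiple of the distance to the curves the push is no longer available,
    but there the Hoelder bound is already as strong as the weighted one. Integrability of the
    weight is a planar statement, so slicing along one coordinate axis not parallel to the G_i(0)
    serves both partial derivatives. All constants are fixed from L, DF(0) and G(0) before the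
    system is chosen. *)

Section Bootstrap.
Variable R : realType.

Lemma ler_forall_geom (x y B : R) : (forall n : nat, x <= y + B / 2 ^+ n) -> x <= y.
Proof.
move=> H; rewrite leNgt; apply/negP => yx.
have B0 : 0 < B.
  by have := H 0%N; rewrite expr0 divr1; lra.
have [n nB] : exists n : nat, B / (x - y) < n%:R.
  exists (Num.bound (B / (x - y))).
  by apply: le_lt_trans (archi_boundP _); rewrite ?divr_ge0 //; lra.
have n2 : n%:R <= 2 ^+ n :> R.
  by rewrite -natrX ler_nat ltnW // ltn_expl.
have := H n.
have p2 : 0 < 2 ^+ n :> R by rewrite exprn_gt0.
rewrite -lerBlDl ler_pdivlMr //.
move: nB; rewrite ltr_pdivrMr ?subr_gt0 // => nB.
have : n%:R * (x - y) <= 2 ^+ n * (x - y) by rewrite ler_wpM2r // subr_ge0 ltW.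
by lra.
Qed.

(** Iterating C |-> C/2 + d from the a priori bound B converges to the fixed point 2 d. This
    replaces the exponential of Gronwall arguments on intervals short enough for the factor 1/2. *)
Lemma bootstrap (T : Type) (P : T -> Prop) (phi : T -> R) (B d : R) :
  0 <= d ->
  (forall s, P s -> phi s <= B) ->
  (forall C, 0 <= C -> (forall s, P s -> phi s <= C) ->
     forall s, P s -> phi s <= C / 2 + d) ->
  forall s, P s -> phi s <= 2 * d.
Proof.
move=> d0 HB H s Ps.
pose B' := `|B|.
have B'0 : 0 <= B' by rewrite normr_ge0.
have HB' r : P r -> phi r <= B'.
  by move=> Pr; rewrite (le_trans (HB _ Pr)) // ler_norm.
apply: (@ler_forall_geom _ _ B') => n.
elim: n s Ps => [|n IHn] s Ps.
  by rewrite expr0 divr1 (le_trans (HB' _ Ps)) // lerDr mulr_ge0.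
have := H (2 * d + B' / 2 ^+ n) _ IHn s Ps.
rewrite exprS invfM mulrA => /(_ _) H1.
apply: le_trans (H1 _) _.
  by rewrite addr_ge0 ?mulr_ge0 // divr_ge0 // exprn_ge0.
by rewrite mulrDl [2 * d / 2]mulrC mulKf // [X in _ <= _ + X]mulrAC; lra.
Qed.

(** Cut [0, t] into 2^n equal pieces: the quadratic errors add up to C t^2 / 2^n. This plays the
    role of comparing derivatives for functions known only through their increments; used in both
    directions it yields equalities of integrals. *)
Lemma quad_increment (phi H : R -> R) (C t : R) : 0 <= t ->
  (forall s1 s2, 0 <= s1 -> s1 <= s2 -> s2 <= t ->
     phi s2 - phi s1 <= H s2 - H s1 + C * (s2 - s1) ^+ 2) ->
  phi t - phi 0 <= H t - H 0.
Proof.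
move=> t0 Hq.
suff Hn (n : nat) : phi t - phi 0 <= H t - H 0 + C * t ^+ 2 / 2 ^+ n.
  exact: ler_forall_geom Hn.
have E2 : 2 ^+ n = (2 ^ n)%:R :> R by rewrite natrX.
pose N := (2 ^ n)%N.
have N0 : (0 < N)%N by rewrite expn_gt0.
have N0' : 0 < N%:R :> R by rewrite ltr0n.
pose h := t / N%:R.
have h0 : 0 <= h by rewrite divr_ge0.
have Hk (k : nat) : (k <= N)%N ->
   phi (k%:R * h) - phi 0 <= H (k%:R * h) - H 0 + k%:R * (C * h ^+ 2).
  elim: k => [|k IHk] kN; first by rewrite !mul0r !subrr addr0.
  have {}IHk := IHk (ltnW kN).
  have hh : k.+1%:R * h = k%:R * h + h by rewrite -natr1 mulrDl mul1r.
  have h1 : k%:R * h <= k.+1%:R * h by rewrite hh lerDl.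
  have h2 : k.+1%:R * h <= t.
    by rewrite /h mulrA mulrAC ler_piMl // ler_pdivrMr // mul1r ler_nat.
  have h3 : 0 <= k%:R * h by rewrite mulr_ge0.
  have := Hq _ _ h3 h1 h2.
  have -> : k.+1%:R * h - k%:R * h = h by rewrite hh addrAC subrr add0r.
  have -> : k.+1%:R * (C * h ^+ 2) = k%:R * (C * h ^+ 2) + C * h ^+ 2.
    by rewrite -natr1 mulrDl mul1r.
  lra.
have := Hk N (leqnn N).
have -> : N%:R * h = t by rewrite /h mulrC divfK // gt_eqF.
move=> HN; apply: le_trans HN _; rewrite lerD2l E2 -/N /h.
rewrite expr_div_n le_eqVlt; apply/orP; left; apply/eqP.
by field; rewrite gt_eqF.
Qed.

End Bootstrap.

Section IntervalIntegrals.
Variable R : realType.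
Notation mu := (@lebesgue_measure R).
Implicit Types (f g : R -> R) (a b c t k B K s : R).

Definition IG a b f := mu.-integrable `[a, b] (EFin \o f).
Definition II a b f := \int[mu]_(x in `[a, b]) f x.

Lemma IGS a b a' b' f : a <= a' -> b' <= b -> IG a b f -> IG a' b' f.
Proof.
move=> aa bb; apply: integrableS => //.
by apply: subset_itv; rewrite bnd_simp.
Qed.

Lemma IG_measurable a b f : IG a b f -> measurable_fun `[a, b] f.
Proof. by move=> /integrableP [/measurable_EFinP]. Qed.

Lemma IG_bm a b f B : measurable_fun `[a, b] f ->
  (forall x, a <= x <= b -> `|f x| <= B) -> IG a b f.
Proof.
move=> mf bf; apply: measurable_bounded_integrable => //.
  by have := @lebesgue_measure_itv R (Interval (BLeft a) (BRight b)) => /= ->; case: ifP => // _; rewrite -EFinD ltry.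
exists B; split => //; first exact: num_real.
move=> M BM x; rewrite /= in_itv /= => xab.
exact: le_trans (bf _ xab) (ltW BM).
Qed.

Lemma IG_cst a b (k : R) : IG a b (fun=> k).
Proof. by apply: (@IG_bm _ _ _ `|k|) => //. Qed.

Lemma IGD a b f g : IG a b f -> IG a b g -> IG a b (fun x => f x + g x).
Proof.
by move=> If Ig; apply: eq_integrable (integrableD _ If Ig).
Qed.

Lemma IGB a b f g : IG a b f -> IG a b g -> IG a b (fun x => f x - g x).
Proof.
by move=> If Ig; apply: eq_integrable (integrableB _ If Ig).
Qed.

Lemma IGZ a b f k : IG a b f -> IG a b (fun x => k * f x).
Proof.
by move=> If; apply: eq_integrable (integrableZl _ k If).
Qed.

Lemma IG_abs a b f : IG a b f -> IG a b (fun x => `|f x|).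
Proof.
by move=> If; apply: eq_integrable (integrable_abse If).
Qed.

Lemma IG_sum (I : finType) a b (F : I -> R -> R) :
  (forall i, IG a b (F i)) -> IG a b (fun x => \sum_i F i x).
Proof.
move=> IF.
have H : mu.-integrable `[a, b] (fun x => \sum_i (EFin \o F i) x)%E.
  by apply: integrable_sum => // i _; exact: IF.
by apply: eq_integrable H => // x _ /=; rewrite sumEFin.
Qed.

Lemma IIE a b f g : (forall x, a <= x <= b -> f x = g x) -> II a b f = II a b g.
Proof.
move=> fg; apply: eq_Rintegral => x; rewrite inE /= in_itv /= => xab.
exact: fg.
Qed.

Lemma II_cst a b k : a <= b -> II a b (fun=> k) = k * (b - a).
Proof.
move=> ab; rewrite /II Rintegral_cst //.
have := @lebesgue_measure_itv R (Interval (BLeft a) (BRight b)) => /= ->.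
rewrite lte_fin; case: ltP => // ba; rewrite /= mulr0; have -> : b = a by apply/eqP; rewrite eq_le ab ba.
by rewrite subrr mulr0.
Qed.

Lemma IID a b f g : IG a b f -> IG a b g ->
  II a b (fun x => f x + g x) = II a b f + II a b g.
Proof. by move=> If Ig; rewrite /II RintegralD. Qed.

Lemma IIB a b f g : IG a b f -> IG a b g ->
  II a b (fun x => f x - g x) = II a b f - II a b g.
Proof. by move=> If Ig; rewrite /II RintegralB. Qed.

Lemma IIZ a b f k : IG a b f -> II a b (fun x => k * f x) = k * II a b f.
Proof. by move=> If; rewrite /II RintegralZl. Qed.

Lemma II_le a b f g : IG a b f -> IG a b g ->
  (forall x, a <= x <= b -> f x <= g x) -> II a b f <= II a b g.
Proof.
move=> If Ig fg; apply: le_Rintegral => // x; rewrite /= in_itv /=; exact: fg.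
Qed.

Lemma II_ge0 a b f : (forall x, a <= x <= b -> 0 <= f x) -> 0 <= II a b f.
Proof.
move=> f0; apply: Rintegral_ge0 => x; rewrite /= in_itv /=; exact: f0.
Qed.

Lemma II_abs a b f g : IG a b f -> IG a b g ->
  (forall x, a <= x <= b -> `|f x| <= g x) -> `|II a b f| <= II a b g.
Proof.
move=> If Ig fg.
apply: le_trans (le_normr_Rintegral _ If) _ => //.
by apply: II_le => //; exact: IG_abs.
Qed.

Lemma II_abs_cst a b f B : a <= b -> IG a b f ->
  (forall x, a <= x <= b -> `|f x| <= B) -> `|II a b f| <= B * (b - a).
Proof.
move=> ab If fB; rewrite -II_cst //; apply: II_abs => //; exact: IG_cst.
Qed.

Lemma II_chasles a b c f : a <= b -> b <= c -> IG a c f ->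
  II a c f = II a b f + II b c f.
Proof.
move=> ab bc If.
have := @Rintegral_itvB R f (BLeft a) (BRight c) b If.
rewrite !bnd_simp => /(_ ab bc) E.
rewrite /II -(@Rintegral_itv_obnd_cbnd _ b); first by rewrite -E addrC subrK.
by apply: integrableS If => //; apply: subset_itv; rewrite bnd_simp.
Qed.

Lemma II_point a f : II a a f = 0.
Proof. by rewrite /II set_itv1 Rintegral_set1. Qed.

Definition lip_on a b (K : R) f :=
  forall x y, a <= x <= b -> a <= y <= b -> `|f x - f y| <= K * `|x - y|.

Lemma lip_on_continuous a b K f : lip_on a b K f -> {within `[a, b], continuous f}.
Proof.
move=> lf; apply/subspace_continuousP => x; rewrite /= in_itv /= => xab.
apply/cvgrPdist_le => e e0.
have K0 : 0 < `|K| + 1 by rewrite ltr_wpDl.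
have eK : 0 < e / (`|K| + 1) by rewrite divr_gt0.
near=> y.
have yab : a <= y <= b.
  suff : `[a, b]%classic y by rewrite /= in_itv.
  by near: y; exact: withinT.
apply: le_trans (lf _ _ xab yab) _.
have xy : `|x - y| <= e / (`|K| + 1).
  near: y; apply: cvg_within.
  by have /cvgrPdist_le := @cvg_id _ (nbhs x); apply.
apply: le_trans (_ : `|x - y| * (`|K| + 1) <= _); last by rewrite -ler_pdivlMr.
rewrite mulrC ler_wpM2l // (le_trans (ler_norm K)) // lerDl //.
Unshelve. all: by end_near. Qed.

Lemma lip_on_measurable a b K f : lip_on a b K f -> measurable_fun `[a, b] f.
Proof.
move=> lf; apply: subspace_continuous_measurable_fun => //.
exact: lip_on_continuous lf.
Qed.

Lemma IG_lip a b K f : lip_on a b K f -> IG a b f.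
Proof.
move=> lf; have [ab|ba] := leP a b; last first.
  by rewrite /IG set_itv_ge ?bnd_simp -?ltNge //; exact: integrable_set0.
apply: (@IG_bm _ _ _ (`|f a| + `|K| * (b - a))).
  exact: lip_on_measurable lf.
move=> x /andP[ax xb].
have := lf x a; rewrite ax xb lexx ab => /(_ isT isT) H.
rewrite -[f x](subrK (f a)) addrC (le_trans (ler_normD _ _)) // lerD2l.
apply: le_trans H _.
have xa : `|x - a| <= b - a by rewrite ger0_norm; lra.
apply: le_trans (_ : `|K| * `|x - a| <= _); first by rewrite ler_wpM2r // ler_norm.
by rewrite ler_wpM2l.
Qed.

Lemma lip_onW a b a' b' K f : a <= a' -> b' <= b -> lip_on a b K f ->
  lip_on a' b' K f.
Proof. by move=> aa bb lf x y xI yI; apply: lf; lra. Qed.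

Lemma II_lip a b f B s1 s2 : a <= s1 -> s1 <= s2 -> s2 <= b -> IG a b f ->
  (forall x, a <= x <= b -> `|f x| <= B) ->
  `|II a s2 f - II a s1 f| <= B * (s2 - s1).
Proof.
move=> as1 s12 s2b If fB.
rewrite (II_chasles as1 s12); last exact: IGS If.
rewrite addrAC subrr add0r; apply: II_abs_cst => //; first exact: IGS If.
by move=> x xs; apply: fB; lra.
Qed.

Lemma II_lip_on a b f B : IG a b f ->
  (forall x, a <= x <= b -> `|f x| <= B) -> lip_on a b B (fun s => II a s f).
Proof.
move=> If fB x y /andP[ax xb] /andP[ay yb].
have [xy|yx] := leP x y.
  have -> : `|x - y| = y - x by rewrite distrC ger0_norm ?subr_ge0.
  by rewrite distrC; exact: II_lip xy yb If fB.
have -> : `|x - y| = x - y by rewrite ger0_norm ?subr_ge0 ?ltW.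
by apply: II_lip ay (ltW yx) xb If fB.
Qed.

Lemma II_id t : 0 <= t -> II 0 t id = t ^+ 2 / 2.
Proof.
move=> t0.
have Iid s : IG 0 s id by apply: (@IG_lip _ _ 1) => x y _ _; rewrite mul1r.
have H s1 s2 : 0 <= s1 -> s1 <= s2 -> s2 <= t ->
    s1 * (s2 - s1) <= II 0 s2 id - II 0 s1 id <= s2 * (s2 - s1).
  move=> h1 h2 h3; rewrite (II_chasles h1 h2) // addrAC subrr add0r.
  have I12 : IG s1 s2 id by apply: (IGS (a := 0) (b := s2)).
  rewrite -!II_cst //; apply/andP; split.
    by apply: II_le => //; [exact: IG_cst|move=> x /andP[]].
  by apply: II_le => //; [exact: IG_cst|move=> x /andP[]].
apply/eqP; rewrite eq_le; apply/andP; split.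
  have := @quad_increment R (fun s => II 0 s id) (fun s => s ^+ 2 / 2) (1/2) t t0.
  rewrite II_point subr0 expr0n mul0r subr0; apply.
  by move=> s1 s2 h1 h2 h3; have /andP[_] := H _ _ h1 h2 h3; lra.
have := @quad_increment R (fun s => s ^+ 2 / 2) (fun s => II 0 s id) (1/2) t t0.
rewrite II_point subr0 expr0n mul0r subr0; apply.
by move=> s1 s2 h1 h2 h3; have /andP[+ _] := H _ _ h1 h2 h3; lra.
Qed.

(* Fubini on the triangle, in the form of an integration by parts. *)
Lemma II_tail t f B : 0 <= t -> IG 0 t f ->
  (forall x, 0 <= x <= t -> `|f x| <= B) ->
  II 0 t (fun s => (t - s) * f s) = II 0 t (fun s => II 0 s f).
Proof.
move=> t0 If fB.
have B0 : 0 <= B by have := fB 0; rewrite lexx t0 => /(_ isT); apply: le_trans.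
pose Q s := II 0 s f.
have Qlip : lip_on 0 t B Q by exact: II_lip_on.
have IQ s : s <= t -> IG 0 s Q by move=> st; apply: IG_lip (lip_onW _ _ Qlip).
have Isf s : s <= t -> IG 0 s (fun r => r * f r).
  move=> st; apply: (@IG_bm _ _ _ (t * B)).
    apply: measurable_funM => //.
    by apply: IG_measurable; exact: IGS If.
  move=> x /andP[x0 xs]; rewrite normrM ger0_norm // ler_pM // ?fB //.
    exact: le_trans xs st.
  by rewrite x0 (le_trans xs).
have Iff s : s <= t -> IG 0 s f by move=> st; exact: IGS If.
(* The defect s Q(s) - int r f - int Q has increments of order (s2 - s1)^2, so it is constant. *)
suff H s1 s2 : 0 <= s1 -> s1 <= s2 -> s2 <= t ->
   `|(s2 * Q s2 - II 0 s2 (fun r => r * f r) - II 0 s2 Q) -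
    (s1 * Q s1 - II 0 s1 (fun r => r * f r) - II 0 s1 Q)| <= 2 * B * (s2 - s1) ^+ 2.
  have E : II 0 t (fun s => (t - s) * f s) = t * Q t - II 0 t (fun r => r * f r).
    rewrite -IIZ // -IIB //; [|exact: IGZ|exact: Isf].
    by apply: IIE => x _; rewrite mulrBl.
  rewrite E; apply/eqP; rewrite -subr_eq0 eq_le; apply/andP; split.
    have := @quad_increment R (fun s => s * Q s - II 0 s (fun r => r * f r) - II 0 s Q)
      (fun=> 0) (2 * B) t t0.
    rewrite /= mul0r !II_point !subr0; apply.
    by move=> s1 s2 h1 h2 h3; have := H s1 s2 h1 h2 h3; rewrite ler_norml => /andP[]; lra.
  have := @quad_increment R (fun s => - (s * Q s - II 0 s (fun r => r * f r) - II 0 s Q))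
      (fun=> 0) (2 * B) t t0.
  rewrite /= mul0r !II_point !subr0 oppr0 subr0 -(oppr_le0 (_ - _)); apply.
  by move=> s1 s2 h1 h2 h3; have := H s1 s2 h1 h2 h3; rewrite ler_norml => /andP[]; lra.
move=> h1 h2 h3.
have s12I : IG s1 s2 f by apply: IGS If.
have s12r : IG s1 s2 (fun r => r * f r) by apply: (IGS (a := 0) (b := t)) (Isf _ _).
have s12Q : IG s1 s2 Q by apply: (IGS (a := 0) (b := t)) (IQ _ _).
rewrite (II_chasles h1 h2 (Isf _ h3)) (II_chasles h1 h2 (IQ _ h3)).
have EQ : Q s2 = Q s1 + II s1 s2 f by apply: II_chasles => //; exact: Iff.
have -> : (s2 * Q s2 - (II 0 s1 (fun r => r * f r) + II s1 s2 (fun r => r * f r)) -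
    (II 0 s1 Q + II s1 s2 Q)) - (s1 * Q s1 - II 0 s1 (fun r => r * f r) - II 0 s1 Q) =
   (s2 * II s1 s2 f - II s1 s2 (fun r => r * f r)) - (II s1 s2 Q - (s2 - s1) * Q s1).
  by rewrite EQ; ring.
have E1 : s2 * II s1 s2 f - II s1 s2 (fun r => r * f r) = II s1 s2 (fun r => (s2 - r) * f r).
  rewrite -IIZ // -IIB //; last exact: IGZ.
  by apply: IIE => x _; rewrite mulrBl.
have E2 : II s1 s2 Q - (s2 - s1) * Q s1 = II s1 s2 (fun r => Q r - Q s1).
  by rewrite IIB //; [rewrite II_cst // [(s2 - s1) * _]mulrC|exact: IG_cst].
rewrite E1 E2.
have H1 : `|II s1 s2 (fun r => (s2 - r) * f r)| <= (s2 - s1) * B * (s2 - s1).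
  apply: II_abs_cst => //.
    have := IGB (IGZ s2 s12I) s12r.
    by apply: eq_integrable => // x _ /=; rewrite mulrBl.
  move=> x /andP[x1 x2]; rewrite normrM ler_pM // ?fB //; last lra.
  by rewrite ger0_norm; lra.
have H2 : `|II s1 s2 (fun r => Q r - Q s1)| <= B * (s2 - s1) * (s2 - s1).
  apply: II_abs_cst => //; first exact: IGB s12Q (IG_cst _ _ _).
  move=> x /andP[x1 x2]; apply: le_trans (Qlip _ _ _ _) _; try lra.
  by rewrite ler_wpM2l // ger0_norm; lra.
apply: le_trans (ler_normB _ _) _; lra.
Qed.

End IntervalIntegrals.

(** * Planar Caratheodory equations: existence *)

Section PlanarODE.
Variable R : realType.
Implicit Types (z : R * R) (x y : R -> R * R) (h : 'I_2 -> R -> R * R -> R) (t s : R).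

Definition nrm z : R := `|z.1| + `|z.2|.

Lemma nrm_ge0 z : 0 <= nrm z.
Proof. by rewrite addr_ge0. Qed.

Lemma nrmD z z' : nrm (z + z') <= nrm z + nrm z'.
Proof.
rewrite /nrm /=; have := ler_normD z.1 z'.1; have := ler_normD z.2 z'.2.
by move=> /= h1 h2; lra.
Qed.

Lemma nrmN z : nrm (- z) = nrm z.
Proof. by rewrite /nrm /= !normrN. Qed.

Lemma nrmB z z' : nrm (z - z') = nrm (z' - z).
Proof. by rewrite -nrmN opprB. Qed.

Lemma nrm_triangle z' z z'' : nrm (z - z'') <= nrm (z - z') + nrm (z' - z'').
Proof. by rewrite (le_trans _ (nrmD _ _)) // addrA subrK. Qed.

Lemma vcomp_nrm k z : `|vcomp k z| <= nrm z.
Proof. by rewrite /vcomp /nrm; case: ifP => _; [rewrite lerDl|rewrite lerDr]. Qed.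

Lemma vcompB k z z' : vcomp k (z - z') = vcomp k z - vcomp k z'.
Proof. by rewrite /vcomp; case: ifP. Qed.

Lemma vcomp0 z : vcomp ord0 z = z.1.
Proof. by []. Qed.

Lemma vcomp1 z : vcomp (lift ord0 ord0) z = z.2.
Proof. by []. Qed.

Lemma I2_case (P : 'I_2 -> Prop) : P ord0 -> P (lift ord0 ord0) -> forall k, P k.
Proof.
move=> P0 P1 k; case: (unliftP ord0 k) => [j ->|-> //].
by rewrite (ord1 j).
Qed.

Lemma nrm_vcomp z : nrm z = `|vcomp ord0 z| + `|vcomp (lift ord0 ord0) z|.
Proof. by []. Qed.

Lemma nrm_le_comp z e : (forall k, `|vcomp k z| <= e) -> nrm z <= 2 * e.
Proof.
move=> H; rewrite nrm_vcomp; have := H ord0; have := H (lift ord0 ord0).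
by lra.
Qed.

(** [trajectory f g z u x t] unfolds to [sol (field f g u) z x t]; a general field h also covers the
    reversed field used for negative times. *)
Definition sol h z x t := forall s, 0 <= s <= t -> forall k,
  IG 0 s (fun r => h k r (x r)) /\
  vcomp k (x s) = vcomp k z + II 0 s (fun r => h k r (x r)).

Lemma solW h z x t t' : t' <= t -> sol h z x t -> sol h z x t'.
Proof. by move=> tt H s /andP[s0 st]; apply: H; rewrite s0 (le_trans st). Qed.

Lemma sol0 h z x t : 0 <= t -> sol h z x t -> x 0 = z.
Proof.
move=> t0 H; have H0 k := H 0 _ k.
have E k : vcomp k (x 0) = vcomp k z.
  by have [|_ ->] := H0 _ k; rewrite ?lexx // II_point addr0.
by move: (E ord0) (E (lift ord0 ord0)); rewrite !vcomp0 !vcomp1; case: (x 0) z {H H0 E} => [? ?] [? ?] /= -> ->.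
Qed.

Lemma sol_increment h z x t s1 s2 : sol h z x t -> 0 <= s1 -> s1 <= s2 -> s2 <= t ->
  forall k, IG s1 s2 (fun r => h k r (x r)) /\
    vcomp k (x s2) - vcomp k (x s1) = II s1 s2 (fun r => h k r (x r)).
Proof.
move=> H h1 h2 h3 k.
have [I2 E2] := H s2 ltac:(lra) k.
have [I1 E1] := H s1 ltac:(lra) k.
split; first exact: IGS I2.
by rewrite E1 E2 (II_chasles h1 h2 I2); lra.
Qed.

Definition lip_path x t := exists K, forall k, lip_on 0 t K (fun s => vcomp k (x s)).

(** Caratheodory conditions on the unit ball of [nrm]. Controls are merely measurable in time, so
    measurability is asked along Lipschitz paths, the class preserved by Picard iteration. *)
Record good_field (La : R) h : Prop := GoodField {
  gf_ge1 : 1 <= La;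
  gf_meas : forall k x t, lip_path x t -> (forall s, 0 <= s <= t -> nrm (x s) <= 1) ->
    measurable_fun `[0, t] (fun r => h k r (x r));
  gf_lip : forall k r z z', nrm z <= 1 -> nrm z' <= 1 ->
    `|h k r z - h k r z'| <= La * nrm (z - z');
  gf_0 : forall k r, `|h k r 0| <= La }.

Lemma gf_bound La h k r z : good_field La h -> nrm z <= 1 -> `|h k r z| <= 2 * La.
Proof.
move=> [L1 _ hl h0] z1.
have n0 : nrm (0 : R * R) <= 1 by rewrite /nrm /= normr0 addr0.
have := hl k r z 0 z1 n0; rewrite subr0 => H1.
have := h0 k r => H2.
have := ler_normD (h k r z - h k r 0) (h k r 0); rewrite subrK => H3.
have : La * nrm z <= La by rewrite ler_piMr //; lra.
by lra.
Qed.

Lemma gf_IG La h k x t : good_field La h -> lip_path x t ->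
  (forall s, 0 <= s <= t -> nrm (x s) <= 1) -> IG 0 t (fun r => h k r (x r)).
Proof.
move=> gh lx x1; apply: (@IG_bm _ _ _ _ (2 * La)); first exact: gf_meas gh _ _ _ lx x1.
by move=> s st; apply: (gf_bound _ _ gh); exact: x1.
Qed.

(** The sequences a_n - 2C/2^n and a_n + 2C/2^n are monotone in opposite directions, and the limit
    is the supremum of the first. The explicit rate lets limits be taken through
    [ler_forall_geom]. *)
Lemma geom_cauchy_limit (a : nat -> R) (C : R) :
  (forall n, `|a n.+1 - a n| <= C / 2 ^+ n) ->
  exists l, forall n, `|a n - l| <= 2 * C / 2 ^+ n.
Proof.
move=> H.
have C0 : 0 <= C by have := H 0%N; rewrite expr0 divr1; apply: le_trans.
have pos n : 0 < (2 ^+ n)^-1 :> R by rewrite invr_gt0 exprn_gt0.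
have half n : (2 ^+ n.+1)^-1 = (2 ^+ n)^-1 / 2 :> R by rewrite exprS invfM mulrC.
pose g n := a n - 2 * C / 2 ^+ n.
have gS n : g n <= g n.+1.
  rewrite /g half; have := H n; rewrite ler_norml => /andP[+ _].
  by have := pos n; nra.
have gmono n m : (n <= m)%N -> g n <= g m.
  move=> nm; rewrite -(subnK nm); elim: (m - n)%N => [//|k IHk].
  by rewrite addSn (le_trans IHk).
pose G n := a n + 2 * C / 2 ^+ n.
have GS n : G n.+1 <= G n.
  rewrite /G half; have := H n; rewrite ler_norml => /andP[_ +].
  by have := pos n; nra.
have Gmono n m : (n <= m)%N -> G m <= G n.
  move=> nm; rewrite -(subnK nm); elim: (m - n)%N => [//|k IHk].
  by rewrite addSn (le_trans _ IHk).
have gG n m : g n <= G m.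
  apply: (@le_trans _ _ (g (maxn n m))); first by rewrite gmono // leq_maxl.
  apply: (@le_trans _ _ (G (maxn n m))); last by rewrite Gmono // leq_maxr.
  by rewrite /g /G; have := pos (maxn n m); nra.
pose S := [set g n | n in [set: nat]].
have S0 : S !=set0 by exists (g 0%N); exists 0%N.
have ubS m : ubound S (G m) by move=> _ [n _ <-]; exact: gG.
have supS : has_sup S by split => //; exists (G 0%N).
exists (sup S) => n; rewrite ler_norml; apply/andP; split.
  have := ge_sup S0 (ubS n); rewrite /G; lra.
have : g n <= sup S by apply: ub_le_sup; [case: supS|exists n].
by rewrite /g; lra.
Qed.

(** Inside the unit ball each component has speed at most 2 La, so [nrm] grows at rate at most 4 La
    and the iterates never leave the ball; La t <= 1/4 then makes the integral operator contract by
    1/2. *)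
Lemma picard La h z t : good_field La h -> 0 <= t -> nrm z + 4 * La * t <= 1 ->
  exists x, sol h z x t /\ forall s, 0 <= s <= t -> nrm (x s) <= 1.
Proof.
move=> gh t0 small.
have L1 := gf_ge1 gh.
pose step x : R -> R * R := fun s => (z.1 + II 0 s (fun r => h ord0 r (x r)),
                       z.2 + II 0 s (fun r => h (lift ord0 ord0) r (x r))).
have stepE x k s : vcomp k (step x s) = vcomp k z + II 0 s (fun r => h k r (x r)).
  by move: k; apply: I2_case.
pose ok x := (forall k, lip_on 0 t (2 * La) (fun s => vcomp k (x s))) /\
             (forall s, 0 <= s <= t -> nrm (x s) <= 1).
have okIG x k s : ok x -> s <= t -> IG 0 s (fun r => h k r (x r)).
  move=> [l1 n1] st; apply: (IGS (a := 0) (b := t)) => //.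
  by apply: (gf_IG _ gh) => //; exists (2 * La).
have okstep x : ok x -> ok (step x).
  move=> okx; have [l1 n1] := okx.
  have bnd k r : 0 <= r <= t -> `|h k r (x r)| <= 2 * La.
    by move=> rt; apply: (gf_bound _ _ gh); exact: n1.
  split=> [k r1 r2 r1t r2t|s /andP[s0 st]].
    rewrite !stepE opprD addrACA subrr add0r.
    by apply: (II_lip_on (okIG x k t okx (lexx _)) (bnd k)).
  have H k : `|II 0 s (fun r => h k r (x r))| <= 2 * La * s.
    rewrite -[X in _ * X]subr0; apply: II_abs_cst => //; first exact: okIG.
    by move=> r /andP[r0 rs]; apply: bnd; rewrite r0 (le_trans rs).
  have H0 := H ord0; have H1 := H (lift ord0 ord0).
  have : La * s <= La * t by rewrite ler_pM2l //; lra.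
  have := ler_normD z.1 (II 0 s (fun r => h ord0 r (x r))).
  have := ler_normD z.2 (II 0 s (fun r => h (lift ord0 ord0) r (x r))).
  by move: small; rewrite /step /nrm /=; lra.
have Lt : La * t <= 1 / 4 by have := nrm_ge0 z; lra.
have stepD x y C : ok x -> ok y -> (forall s, 0 <= s <= t -> nrm (x s - y s) <= C) ->
   forall s, 0 <= s <= t -> nrm (step x s - step y s) <= C / 2.
  move=> okx oky HC s /andP[s0 st].
  have C0 : 0 <= C by apply: le_trans (nrm_ge0 _) (HC 0 _); rewrite lexx.
  have H k : `|vcomp k (step x s - step y s)| <= La * C * s.
    rewrite vcompB !stepE opprD addrACA subrr add0r -IIB; [|exact: okIG..].
    rewrite -[X in _ * X]subr0; apply: II_abs_cst => //.
      by apply: IGB; exact: okIG.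
    move=> r /andP[r0 rs]; have rt : 0 <= r <= t by rewrite r0 (le_trans rs).
    apply: le_trans (gf_lip gh _ _ (okx.2 _ rt) (oky.2 _ rt)) _.
    by rewrite ler_pM2l ?HC //; lra.
  apply: le_trans (nrm_le_comp H) _.
  have h1 : La * s <= La * t by rewrite ler_pM2l //; lra.
  have h2 : La * s * C <= 1 / 4 * C by rewrite ler_wpM2r //; lra.
  lra.
pose X n := iter n step (fun=> z).
have okX n : ok (X n).
  elim: n => [|n IHn]; last exact: okstep.
  split=> [k r1 r2 _ _|s _] /=; last by have := mulr_ge0 (le_trans ler01 L1) t0; lra.
  by rewrite subrr normr0 !mulr_ge0 //; lra.
have XD n s : 0 <= s <= t -> nrm (X n.+1 s - X n s) <= 2 / 2 ^+ n.
  elim: n s => [|n IHn] s st.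
    rewrite expr0 divr1 (le_trans (nrmD _ _)) // nrmN.
    have := (okX 0%N).2 _ st; have := (okX 1%N).2 _ st; lra.
  have -> : 2 / 2 ^+ n.+1 = 2 / 2 ^+ n / 2 :> R by rewrite exprS invfM mulrA mulrAC.
  exact: (stepD _ _ _ (okX n.+1) (okX n) IHn).
have lims s k : exists l, 0 <= s <= t -> forall n, `|vcomp k (X n s) - l| <= 2 * 2 / 2 ^+ n.
  have [st|] := boolP (0 <= s <= t); last by exists 0.
  have [|l Hl] := @geom_cauchy_limit (fun n => vcomp k (X n s)) 2.
    by move=> n; rewrite -vcompB (le_trans (vcomp_nrm _ _)) // XD.
  by exists l.
pose x s := (sval (cid (lims s ord0)), sval (cid (lims s (lift ord0 ord0)))).
have xP k s n : 0 <= s <= t -> `|vcomp k (X n s) - vcomp k (x s)| <= 4 / 2 ^+ n.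
  move=> st; have -> : 4 = 2 * 2 :> R by lra.
  move: k; apply: I2_case; rewrite /x /vcomp /=.
    by case: (cid (lims s ord0)) => l /= /(_ st n).
  by case: (cid (lims s (lift ord0 ord0))) => l /= /(_ st n).
have xN n s : 0 <= s <= t -> nrm (X n s - x s) <= 8 / 2 ^+ n.
  move=> st; have -> : 8 / 2 ^+ n = 2 * (4 / 2 ^+ n) :> R by lra.
  by apply: nrm_le_comp => k; rewrite vcompB xP.
have okx : ok x.
  split=> [k r1 r2 r1t r2t|s st].
    apply: (@ler_forall_geom _ _ _ 8) => n.
    have := xP k r1 n r1t; have := xP k r2 n r2t; have := (okX n).1 k _ _ r1t r2t.
    rewrite !ler_norml => /andP[? ?] /andP[? ?] /andP[? ?].
    by apply/andP; split; lra.
  apply: (@ler_forall_geom _ _ _ 8) => n.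
  have := (okX n).2 _ st; have := xN n _ st; have := nrm_triangle (X n s) 0 (x s).
  by rewrite !sub0r !nrmN; lra.
exists x; split; last exact: okx.2.
move=> s st k; have /andP[s0 st'] := st; split; first exact: okIG.
rewrite -stepE; apply/eqP; rewrite -subr_eq0 -normr_eq0 eq_le normr_ge0 andbT.
apply: (@ler_forall_geom _ _ _ 8) => n; rewrite add0r.
have h1 := xP k s n.+1 st.
have h2 := stepD _ _ _ (okX n) okx (xN n) s st.
have h3 := vcomp_nrm k (step (X n) s - step x s).
have pos : 0 < (2 ^+ n)^-1 :> R by rewrite invr_gt0 exprn_gt0.
have half : (2 ^+ n.+1)^-1 = (2 ^+ n)^-1 / 2 :> R by rewrite exprS invfM mulrC.
rewrite half in h1; rewrite vcompB in h3.
have h4 : `|vcomp k (step (X n) s) - vcomp k (step x s)| <= 8 / 2 ^+ n / 2 := le_trans h3 h2.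
move: h1 h4; rewrite -[X n.+1]/(step (X n)) !ler_norml => /andP[? ?] /andP[? ?].
by apply/andP; split; lra.
Qed.

End PlanarODE.

(** * Planar Caratheodory equations: comparison and confinement *)

Section Gronwall.
Variable R : realType.
Implicit Types (z : R * R) (x y : R -> R * R) (h : 'I_2 -> R -> R * R -> R) (t s : R).

(** x' is an approximate solution of the field h with defect e. As 4 La t <= 1, the Lipschitz term
    contributes at most half of the current bound and [bootstrap] absorbs it. *)
Lemma gronwall La h h' z z' x x' t e : good_field La h -> 0 <= t -> 4 * La * t <= 1 ->
  sol h z x t -> sol h' z' x' t ->
  (forall s, 0 <= s <= t -> nrm (x s) <= 1) ->
  (forall s, 0 <= s <= t -> nrm (x' s) <= 1) ->
  IG 0 t e ->
  (forall k s, 0 <= s <= t -> `|h k s (x' s) - h' k s (x' s)| <= e s) ->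
  nrm (x t - x' t) <= 2 * (nrm (z - z') + 2 * II 0 t e).
Proof.
move=> gh t0 Lt sx sx' x1 x1' Ie he.
have L1 := gf_ge1 gh.
have e0 s : 0 <= s <= t -> 0 <= e s by move=> /(he ord0); apply: le_trans.
have IIe s : 0 <= s -> s <= t -> 0 <= II 0 s e <= II 0 t e.
  move=> s0 st; rewrite (II_chasles s0 st Ie).
  have : 0 <= II 0 s e by apply: II_ge0 => r rs; apply: e0; lra.
  have : 0 <= II s t e by apply: II_ge0 => r rs; apply: e0; lra.
  by lra.
have Iet := IIe t t0 (lexx _).
have H : forall s, 0 <= s <= t -> nrm (x s - x' s) <= 2 * (nrm (z - z') + 2 * II 0 t e).
  apply: (@bootstrap _ _ _ _ 2).
  - by have := nrm_ge0 (z - z'); lra.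
  - move=> s st; apply: le_trans (nrmD _ _) _; rewrite nrmN.
    by have := x1 _ st; have := x1' _ st; lra.
  - move=> C C0 HC s /andP[s0 st].
    have comp k : `|vcomp k (x s - x' s)| <= `|vcomp k (z - z')| + (La * C * s + II 0 s e).
      have [I1 E1] := sx s ltac:(lra) k; have [I2 E2] := sx' s ltac:(lra) k.
      rewrite !vcompB E1 E2 opprD addrACA -IIB //.
      apply: le_trans (ler_normD _ _) _; rewrite lerD2l.
      have -> : La * C * s + II 0 s e = II 0 s (fun r => La * C + e r).
        by rewrite IID ?II_cst ?subr0 //; [exact: IG_cst|exact: IGS Ie].
      apply: II_abs; first exact: IGB.
        by apply: IGD; [exact: IG_cst|exact: IGS Ie].
      move=> r /andP[r0 rs]; have rt : 0 <= r <= t by lra.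
      have -> : h k r (x r) - h' k r (x' r) =
        (h k r (x r) - h k r (x' r)) + (h k r (x' r) - h' k r (x' r)) by ring.
      apply: le_trans (ler_normD _ _) _; apply: lerD; last exact: he.
      apply: le_trans (gf_lip gh _ _ (x1 _ rt) (x1' _ rt)) _.
      by rewrite ler_pM2l ?HC //; lra.
    have c0 := comp ord0; have c1 := comp (lift ord0 ord0).
    have h1 : La * s <= La * t by rewrite ler_pM2l //; lra.
    have h2 : La * s * C <= 1 / 4 * C by rewrite ler_wpM2r //; lra.
    have := IIe s s0 st.
    by rewrite !nrm_vcomp; lra.
by apply: H; rewrite t0 lexx.
Qed.

Lemma sol_continuous h z x t s e : sol h z x t -> 0 <= s <= t -> 0 < e ->
  exists2 d, 0 < d & forall r, 0 <= r <= t -> `|s - r| < d -> nrm (x s - x r) < e.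
Proof.
move=> sx st e0; have /andP[s0 st'] := st.
have t0 : 0 <= t by lra.
have C k : exists2 d, 0 < d & forall r, 0 <= r <= t -> `|s - r| < d ->
    `|vcomp k (x s) - vcomp k (x r)| < e / 2.
  have [It _] := sx t ltac:(by rewrite t0 lexx) k.
  have /subspace_continuousP/(_ s) := parameterized_integral_continuous t0 It.
  rewrite /= in_itv /= => /(_ st) /cvgrPdist_lt /(_ (e / 2)).
  rewrite divr_gt0 // => /(_ isT) [d /= d0 Hd]; exists d => // r rt sr.
  have := Hd r sr; rewrite in_itv /= => /(_ rt).
  have [_ ->] := sx s st k; have [_ ->] := sx r rt k.
  by rewrite opprD addrACA subrr add0r.
have [d1 d10 H1] := C ord0; have [d2 d20 H2] := C (lift ord0 ord0).
exists (Num.min d1 d2); first by rewrite lt_min d10 d20.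
move=> r rt; rewrite lt_min => /andP[sr1 sr2].
rewrite nrm_vcomp !vcompB.
by have := H1 _ rt sr1; have := H2 _ rt sr2; lra.
Qed.

Lemma sol_backward_bound La h z x t s : good_field La h -> sol h z x t ->
  0 <= s -> s <= t -> (forall r, s <= r <= t -> nrm (x r) <= 1) ->
  nrm (x s - x t) <= 4 * La * (t - s).
Proof.
move=> gh sx s0 st x1.
have -> : 4 * La * (t - s) = 2 * (2 * La * (t - s)) by lra.
rewrite nrmB; apply: nrm_le_comp => k; rewrite vcompB.
have [I1 ->] := sol_increment sx s0 st (lexx _) k.
apply: II_abs_cst => // r rt; apply: (gf_bound _ _ gh); exact: x1.
Qed.

(** The field is controlled only in the unit ball, so a steering trajectory must first be shown to
    stay there. After the last time s1 with norm at least 1 the path can be followed back from its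
    endpoint at speed at most 4 La, and continuity at s1 contradicts the strict inequality. *)
Lemma sol_confined La h z x t : good_field La h -> sol h z x t -> 0 <= t ->
  nrm (x t) + 4 * La * t < 1 ->
  forall s, 0 <= s <= t -> nrm (x s) <= 1 /\ nrm (x s) <= nrm (x t) + 4 * La * (t - s).
Proof.
move=> gh sx t0 small.
have L1 := gf_ge1 gh.
suff H s : 0 <= s <= t -> nrm (x s) < 1.
  move=> s st; split; first by rewrite ltW // H.
  have /andP[s0 st'] := st.
  have := sol_backward_bound gh sx s0 st' (fun r rt => ltW (H r ltac:(lra))).
  by have := nrm_triangle (x t) (x s) 0; rewrite !subr0; lra.
move=> st; rewrite ltNge; apply/negP => big.
pose S := [set r | 0 <= r <= t /\ 1 <= nrm (x r)].
have Ss : S s by split.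
have ubS : ubound S t by move=> r [/andP[_ +] _].
have S0 : S !=set0 by exists s.
have supS : has_sup S by split => //; exists t.
pose s1 := sup S.
have s1t : s1 <= t by apply: ge_sup.
have s1s : s <= s1 by apply: ub_le_sup => //; exists t.
have s1I : 0 <= s1 <= t by lra.
have big1 : 1 <= nrm (x s1).
  rewrite leNgt; apply/negP => lt1.
  have gap : 0 < 1 - nrm (x s1) by lra.
  have [d d0 Hd] := sol_continuous sx s1I gap.
  have [r [rI r1] rs1] := @sup_adherent _ S d d0 supS.
  have rs1' : r <= s1 by apply: ub_le_sup => //; exists t.
  have := Hd r rI; rewrite ger0_norm ?subr_ge0 // => Hd'.
  have {Hd'} := Hd' ltac:(rewrite /s1; lra).
  by rewrite nrmB; have := nrm_triangle (x s1) (x r) 0; rewrite !subr0; lra.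
have small1 r : s1 < r -> r <= t -> nrm (x r) < 1.
  move=> s1r rt; rewrite ltNge; apply/negP => r1.
  have : r <= s1 by apply: ub_le_sup; [exists t|split => //; lra].
  by lra.
have s1lt : s1 < t.
  rewrite lt_neqAle s1t andbT; apply/eqP => E.
  have Lt0 : 0 <= La * t by rewrite mulr_ge0 //; lra.
  by rewrite E in big1; lra.
pose g := 1 - (nrm (x t) + 4 * La * t).
have g0 : 0 < g by rewrite /g; lra.
have [d d0 Hd] := sol_continuous sx s1I g0.
pose r := Num.min t (s1 + d / 2).
have s1r : s1 < r by rewrite lt_min s1lt /=; lra.
have rt : r <= t by rewrite ge_min lexx.
have rd : r <= s1 + d / 2 by rewrite ge_min lexx orbT.
have := Hd r ltac:(lra); rewrite distrC ger0_norm; last by lra.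
move=> /(_ ltac:(lra)) H1.
have r0 : 0 <= r by lra.
have H2 := sol_backward_bound gh sx r0 rt (fun r' rt' => ltW (small1 r' ltac:(lra) ltac:(lra))).
have := nrm_triangle (x r) (x s1) 0; have := nrm_triangle (x t) (x r) 0; rewrite !subr0.
have : La * (t - r) <= La * t by rewrite ler_pM2l; lra.
by move: H1; rewrite /g; lra.
Qed.

End Gronwall.

(** * Systems in normal form near the origin *)

Section Contraction.
Variable R : realType.

(** The condition on Phi 0 makes the ball of radius rho invariant, since Phi c lies within rho / 2
    of Phi 0. *)
Lemma planar_contraction (Phi : R * R -> R * R) (rho : R) :
  (forall c c', nrm c <= rho -> nrm c' <= rho -> nrm (Phi c - Phi c') <= nrm (c - c') / 2) ->
  nrm (Phi 0) <= rho / 2 -> exists2 c, nrm c <= rho & Phi c = c.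
Proof.
move=> ctr H0.
have n0 : nrm (0 : R * R) = 0 by rewrite /nrm /= normr0 addr0.
have rho0 : 0 <= rho by have := nrm_ge0 (Phi 0); lra.
have inv c : nrm c <= rho -> nrm (Phi c) <= rho.
  move=> cr; have := ctr c 0 cr; rewrite n0 subr0 => /(_ rho0).
  by have := nrmD (Phi c - Phi 0) (Phi 0); rewrite subrK; lra.
pose X n := iter n Phi 0.
have Xr n : nrm (X n) <= rho by elim: n => [|n IHn] /=; [rewrite n0|exact: inv].
have XD n : nrm (X n.+1 - X n) <= rho / 2 ^+ n.
  elim: n => [|n IHn]; first by rewrite expr0 divr1 subr0; lra.
  apply: le_trans (ctr _ _ (Xr n.+1) (Xr n)) _.
  by rewrite exprS invfM [X in _ <= _ * X]mulrC mulrA ler_wpM2r.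
have lims k : exists l, forall n, `|vcomp k (X n) - l| <= 2 * rho / 2 ^+ n.
  by apply: geom_cauchy_limit => n; rewrite -vcompB (le_trans (vcomp_nrm _ _)).
have [l1 H1] := lims ord0; have [l2 H2] := lims (lift ord0 ord0).
pose c := (l1, l2).
have Xc n : nrm (X n - c) <= 4 * rho / 2 ^+ n.
  by rewrite nrm_vcomp !vcompB; have := H1 n; have := H2 n; rewrite !vcomp0 !vcomp1 /=; lra.
have cr : nrm c <= rho.
  apply: (@ler_forall_geom _ _ _ (4 * rho)) => n.
  have := nrm_triangle (X n) 0 c; rewrite !sub0r !nrmN.
  by have := Xr n; have := Xc n; lra.
exists c => //.
suff : nrm (Phi c - c) <= 0.
  move=> le0; have : nrm (Phi c - c) = 0 by apply/eqP; rewrite eq_le le0 nrm_ge0.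
  rewrite /nrm => /eqP; rewrite paddr_eq0 // !normr_eq0 => /andP[/eqP e1 /eqP e2].
  apply/eqP; rewrite -subr_eq0; apply/eqP.
  by case: (Phi c - c) e1 e2 => ? ? /= -> ->.
apply: (@ler_forall_geom _ _ _ (4 * rho)) => n; rewrite add0r.
have := nrm_triangle (X n.+1) (Phi c) c.
have := ctr _ _ cr (Xr n); rewrite (nrmB c).
have := Xc n; have := Xc n.+1.
rewrite exprS invfM [X in _ <= _ * X -> _]mulrC mulrA.
by rewrite -[X n.+1]/(Phi (X n)); lra.
Qed.

End Contraction.

Section NormalisedSystem.
Variables (R : realType) (M : nat).
Implicit Types (z : R * R) (x y : R -> R * R) (t s : R) (u v : R -> 'I_M -> R).

Definition box (w : 'I_M -> R) := forall i, -1 <= w i <= 1.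

(** Bounds uniform over the control box, enough for existence, comparison and confinement. They are
    kept apart from [planar_sys], which fails for the full system when the inputs span the plane. *)
Record basic_sys (La : R) (f : R * R -> R * R) (g : 'I_M -> R * R -> R * R) : Prop := BasicSys {
  bs_ge1 : 1 <= La;
  bs_lip : forall k z z' w, nrm z <= 1 -> nrm z' <= 1 -> box w ->
    `|dyn f g k z w - dyn f g k z' w| <= La * nrm (z - z');
  bs_0 : forall k w, box w -> `|dyn f g k 0 w| <= La }.

Definition field f g u : 'I_2 -> R -> R * R -> R :=
  fun k r z => @dyn R M f g k z (u r).

Lemma dyn0 f g k z : @dyn R M f g k z (fun=> 0) = vcomp k (f z).
Proof. by rewrite /dyn big1 ?addr0 // => i _; rewrite mul0r. Qed.

Lemma dynD1 f g k z i : @dyn R M f g k z (fun j => (j == i)%:R) = vcomp k (f z) + vcomp k (g i z).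
Proof.
rewrite /dyn (bigD1 i) //= eqxx mul1r big1 ?addr0 // => j ji.
by rewrite (negbTE ji) mul0r.
Qed.

Lemma basic_good La f g u : basic_sys La f g -> admissible u ->
  good_field La (field f g u).
Proof.
move=> [L1 lip b0] [mu ub]; split => //.
- move=> k x t [K lx] x1; rewrite /field /dyn.
  have comp_meas (phi : R * R -> R) C : (forall z z', nrm z <= 1 -> nrm z' <= 1 ->
      `|phi z - phi z'| <= C * nrm (z - z')) -> 0 <= C ->
      measurable_fun `[0, t] (fun r => phi (x r)).
    move=> lphi C0; apply: (@lip_on_measurable _ _ _ (C * (2 * K))) => r r' rt rt'.
    apply: le_trans (lphi _ _ (x1 _ rt) (x1 _ rt')) _.
    rewrite -mulrA ler_wpM2l // -mulrA; apply: nrm_le_comp => j.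
    by rewrite vcompB; exact: lx.
  apply: measurable_funD.
    apply: (comp_meas (fun z => vcomp k (f z)) La); last lra.
    by move=> z z' z1 z1'; rewrite -!(dyn0 f g); apply: lip => // i; lra.
  apply: measurable_sum => i.
  apply: measurable_funM; first by apply: measurable_funTS; exact: mu.
  apply: (comp_meas (fun z => vcomp k (g i z)) (2 * La)); last lra.
  move=> z z' z1 z1'.
  (* The control 0 isolates f and the i-th unit vector isolates f + g i, so [bs_lip] gives g i the
     Lipschitz constant 2 La. *)
  have b1 : box (fun j => (j == i)%:R) by move=> j; case: eqP => _ /=; lra.
  have bz : box (fun=> 0) by move=> j; lra.
  have := lip k z z' _ z1 z1' b1; have := lip k z z' _ z1 z1' bz.
  rewrite !dynD1 !dyn0 !ler_norml => /andP[? ?] /andP[? ?].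
  by apply/andP; split; lra.
- by move=> k r z z' z1 z1'; apply: lip => // i; exact: ub.
- by move=> k r; apply: b0 => i; exact: ub.
Qed.

(** Perturbed double integrator a' = sum ka_i u_i, b' = a, in increment form so that two
    trajectories can be subtracted. A change of control enters b' only with the factor [nrm z ^+ 2],
    because the inputs are parallel at the origin and DG(0) = 0; the later estimates rest on this
    quadratic smallness. *)
Record planar_sys (La : R) (ka : 'I_M -> R) f g : Prop := PlanarSys {
  ps_basic : basic_sys La f g;
  ps_ka : \sum_i `|ka i| <= La;
  ps_eq0 : forall k, dyn f g k 0 (fun=> 0) = 0;
  ps_1 : forall z z' w w', nrm z <= 1 -> nrm z' <= 1 -> box w -> box w' ->
    `|dyn f g ord0 z' w' - dyn f g ord0 z w - \sum_i ka i * (w' i - w i)| <=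
     La * nrm (z' - z) + La * nrm z ^+ 2 * \sum_i `|w' i - w i|;
  ps_2 : forall z z' w w', nrm z <= 1 -> nrm z' <= 1 -> box w -> box w' ->
    `|dyn f g (lift ord0 ord0) z' w' - dyn f g (lift ord0 ord0) z w - (z'.1 - z.1)| <=
     La * `|z'.2 - z.2| + La * (nrm z + nrm z') * nrm (z' - z)
     + La * nrm z ^+ 2 * \sum_i `|w' i - w i| }.

Lemma admissible_IG u a b i : admissible u -> IG a b (fun s => u s i).
Proof.
move=> [mu ub]; apply: (@IG_bm _ _ _ _ 1); first exact: measurable_funTS (mu i).
by move=> s _; rewrite ler_norml; exact: ub.
Qed.

Lemma ka_le La ka f g i : planar_sys La ka f g -> `|ka i| <= La.
Proof.
move=> ps; apply: le_trans (ps_ka ps); rewrite (bigD1 i) //= lerDl.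
exact: sumr_ge0.
Qed.

Lemma snd_diff z z' : (z' - z).1 = z'.1 - z.1 /\
  nrm (z' - z) = `|z'.1 - z.1| + `|z'.2 - z.2|.
Proof. by []. Qed.

Section Compare.
Variables (La : R) (ka : 'I_M -> R) (f : R * R -> R * R) (g : 'I_M -> R * R -> R * R).
Hypothesis ps : planar_sys La ka f g.
Variables (z : R * R) (u u' : R -> 'I_M -> R) (x x' : R -> R * R) (t r : R).
Hypotheses (t0 : 0 <= t) (Lt : 4 * La * t <= 1) (r1 : r <= 1).
Hypotheses (au : admissible u) (au' : admissible u').
Hypotheses (tx : trajectory f g z u x t) (tx' : trajectory f g z u' x' t).
Hypotheses (xr : forall s, 0 <= s <= t -> nrm (x s) <= r)
           (xr' : forall s, 0 <= s <= t -> nrm (x' s) <= r).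

Definition ctrl_gap s := \sum_i `|u' s i - u s i|.
Definition ctrl_push s := \sum_i ka i * (u' s i - u s i).
Notation p := ctrl_gap.
Notation q := ctrl_push.
Notation De := (fun s => x' s - x s).

Let La1 : 1 <= La.
Proof. exact: bs_ge1 (ps_basic ps). Qed.
Let rge0 : 0 <= r.
Proof. by apply: le_trans (nrm_ge0 _) (xr (s := 0) _); rewrite lexx. Qed.
Let x1 s : 0 <= s <= t -> nrm (x s) <= 1.
Proof. by move=> st; exact: le_trans (xr st) r1. Qed.
Let x1' s : 0 <= s <= t -> nrm (x' s) <= 1.
Proof. by move=> st; exact: le_trans (xr' st) r1. Qed.

Lemma gap_IG a b : IG a b p.
Proof. by apply: IG_sum => i; apply/IG_abs/IGB; exact: admissible_IG. Qed.

Lemma push_IG a b : IG a b q.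
Proof. by apply: IG_sum => i; apply/IGZ/IGB; exact: admissible_IG. Qed.

Lemma gap_ge0 s : 0 <= p s.
Proof. by apply: sumr_ge0. Qed.

Lemma push_le s : `|q s| <= La * p s.
Proof.
apply: le_trans (ler_norm_sum _ _ _) _; rewrite /p mulr_sumr.
by apply: ler_sum => i _; rewrite normrM ler_wpM2r // (ka_le i ps).
Qed.

Lemma gap_bound s : `|p s| <= 2 * M%:R.
Proof.
rewrite ger0_norm ?gap_ge0 //.
rewrite /p (le_trans (_ : _ <= \sum_(i < M) 2)) //; last by rewrite sumr_const card_ord mulr_natr.
apply: ler_sum => i _; have := au.2 s i; have := au'.2 s i.
by move=> h1 h2; rewrite ler_norml; lra.
Qed.

Lemma gap_lip : lip_on 0 t (2 * M%:R) (fun s => II 0 s p).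
Proof. by apply: II_lip_on; [exact: gap_IG|move=> s _; exact: gap_bound]. Qed.

Lemma II_gap_mono s s' : 0 <= s -> s <= s' -> II 0 s p <= II 0 s' p.
Proof.
move=> s0 ss; rewrite (II_chasles s0 ss (gap_IG _ _)) lerDl.
by apply: II_ge0 => *; exact: gap_ge0.
Qed.

Lemma II_gap_ge0 s : 0 <= II 0 s p.
Proof. by apply: II_ge0 => *; exact: gap_ge0. Qed.

Lemma IG_gap s : s <= t -> IG 0 s (fun s => II 0 s p).
Proof. by move=> st; apply: IG_lip (lip_onW _ _ gap_lip). Qed.

(** At equal states the fields of u and u' differ by at most 2 La p, and [gronwall] multiplies the
    integral by 4. *)
Lemma compare_nrm s : 0 <= s <= t -> nrm (De s) <= 8 * La * II 0 s p.
Proof.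
have L1 := La1; have r0 := rge0.
move=> /andP[s0 st].
have gu := basic_good (ps_basic ps) au.
have Ls : 4 * La * s <= 1.
  by apply: le_trans Lt; rewrite ler_wpM2l //; lra.
have := @gronwall R La (field f g u) (field f g u') z z x x' s (fun r => 2 * La * p r) gu s0 Ls.
rewrite subrr nrmB IIZ ?IG_gap; last exact: gap_IG.
have -> : nrm (0 : R * R) = 0 by rewrite /nrm /= normr0 addr0.
move=> H; apply: le_trans (H _ _ _ _ _ _) _.
- exact: solW tx.
- exact: solW tx'.
- by move=> s' s't; apply: x1; lra.
- by move=> s' s't; apply: x1'; lra.
- by apply: IGZ; exact: gap_IG.
- move=> k s' s't; have s'T : 0 <= s' <= t by lra.
  have b1 := au.2 s'; have b2 := au'.2 s'.
  rewrite /field distrC; have xx := x1' s'T.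
  have n2 : nrm (x' s') ^+ 2 <= 1 by rewrite expr_le1 ?nrm_ge0.
  have g0 := gap_ge0 s'.
  have hn : La * nrm (x' s') ^+ 2 * p s' <= La * p s'.
    by rewrite ler_wpM2r // ler_piMr //; lra.
  have pl := push_le s'; have lp : 0 <= La * p s' by rewrite mulr_ge0 //; lra.
  have nz : nrm (x' s' - x' s') = 0 by rewrite subrr /nrm /= normr0 addr0.
  move: k; apply: I2_case.
    have := ps_1 ps xx xx b1 b2; rewrite nz mulr0 add0r -/(q s') -/(p s').
    by move: pl; rewrite !ler_norml => /andP[? ?] /andP[? ?]; apply/andP; split; lra.
  have := ps_2 ps xx xx b1 b2; rewrite nz !subrr normr0 !mulr0 !add0r -/(p s') subr0.
  by move=> h; apply: le_trans h _; lra.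
- by lra.
Qed.

Let incr k s : 0 <= s <= t -> vcomp k (De s) =
  II 0 s (fun r => dyn f g k (x' r) (u' r) - dyn f g k (x r) (u r)) /\
  IG 0 s (fun r => dyn f g k (x' r) (u' r) - dyn f g k (x r) (u r)).
Proof.
move=> st; have [I1 E1] := tx st k; have [I2 E2] := tx' st k.
split; last exact: IGB.
by rewrite vcompB E1 E2 IIB // opprD addrACA subrr add0r.
Qed.

Let De_le a s : 0 <= a -> a <= s -> s <= t -> nrm (De a) <= 8 * La * II 0 s p.
Proof.
have L1 := La1; have r0 := rge0.
move=> a0 as_ st; apply: le_trans (compare_nrm (s := a) _) _; first lra.
by rewrite ler_wpM2l ?II_gap_mono //; lra.
Qed.

Lemma compare_fst s : 0 <= s <= t ->
  `|(De s).1 - II 0 s q| <= (8 * La ^+ 2 * s + La * r ^+ 2) * II 0 s p.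
Proof.
have L1 := La1; have r0 := rge0.
move=> st; have /andP[s0 st'] := st.
have [E I1] := incr ord0 st; rewrite -[(De s).1]/(vcomp ord0 (De s)) E -IIB //; last exact: push_IG.
have -> : (8 * La ^+ 2 * s + La * r ^+ 2) * II 0 s p =
   II 0 s (fun a => La * (8 * La * II 0 s p) + La * r ^+ 2 * p a).
  have Ip := gap_IG 0 s; rewrite IID; [|exact: IG_cst|exact: IGZ].
  by rewrite II_cst // IIZ // subr0; ring.
apply: II_abs; first by apply: IGB => //; exact: push_IG.
  by apply: IGD; [exact: IG_cst|apply: IGZ; exact: gap_IG].
move=> a /andP[a0 as_]; have aT : 0 <= a <= t by lra.
apply: le_trans (ps_1 ps (x1 aT) (x1' aT) (au.2 a) (au'.2 a)) _.
apply: lerD; first by rewrite ler_pM2l ?De_le //; lra.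
rewrite ler_wpM2r ?gap_ge0 // ler_wpM2l //; first lra.
by rewrite ler_sqr ?nnegrE ?nrm_ge0 // xr.
Qed.

(** Gains a factor of order s + r^2 over [compare_nrm]. In [compare_snd_final] the error term of
    [ps_2] in the second coordinate would otherwise be as large as the main term. *)
Lemma compare_snd s : 0 <= s <= t ->
  `|(De s).2| <= (32 * La ^+ 2 * s + La * r ^+ 2) * II 0 s p.
Proof.
have L1 := La1; have r0 := rge0.
move=> st; have /andP[s0 st'] := st.
have [E I1] := incr (lift ord0 ord0) st; rewrite -[(De s).2]/(vcomp (lift ord0 ord0) (De s)) E.
have -> : (32 * La ^+ 2 * s + La * r ^+ 2) * II 0 s p =
   II 0 s (fun a => 4 * La * (8 * La * II 0 s p) + La * r ^+ 2 * p a).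
  have Ip := gap_IG 0 s; rewrite IID; [|exact: IG_cst|exact: IGZ].
  by rewrite II_cst // IIZ // subr0; ring.
apply: II_abs => //.
  by apply: IGD; [exact: IG_cst|apply: IGZ; exact: gap_IG].
move=> a /andP[a0 as_]; have aT : 0 <= a <= t by lra.
have H1 := ps_2 ps (x1 aT) (x1' aT) (au.2 a) (au'.2 a).
have H2 : La * nrm (x a) ^+ 2 * p a <= La * r ^+ 2 * p a.
  rewrite ler_wpM2r ?gap_ge0 // ler_wpM2l //; first lra.
  by rewrite ler_sqr ?nnegrE ?nrm_ge0 // xr.
have H3 := De_le a0 as_ st'.
have [c1 c2] := snd_diff (x a) (x' a).
have := nrm_ge0 (De a); have := x1 aT; have := x1' aT.
have H4 : La * (nrm (x a) + nrm (x' a)) * nrm (De a) <= 2 * La * nrm (De a).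
  by rewrite ler_wpM2r ?nrm_ge0 // mulrC ler_wpM2r ?lerD //; have := x1 aT; have := x1' aT; lra.
have H5 : 4 * La * nrm (De a) <= 4 * La * (8 * La * II 0 s p) by rewrite ler_wpM2l //; lra.
move=> _ _ D0.
have H6 : La * `|(x' a).2 - (x a).2| + `|(x' a).1 - (x a).1| <= La * nrm (De a).
  have e0 := normr_ge0 ((x' a).1 - (x a).1).
  have : `|(x' a).1 - (x a).1| <= La * `|(x' a).1 - (x a).1| by rewrite ler_peMl.
  by rewrite c2 mulrDr; lra.
have H7 : 0 <= La * nrm (De a) by rewrite mulr_ge0 //; lra.
have := ler_normD (dyn f g (lift ord0 ord0) (x' a) (u' a) - dyn f g (lift ord0 ord0) (x a) (u a) -
  ((x' a).1 - (x a).1)) ((x' a).1 - (x a).1); rewrite subrK.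
by move: H1; rewrite -/(p a); lra.
Qed.

(** To leading order b(t) moves by the double integral of the push. The weight xi is a function
    because nrm (x s)^2 decays as s tends to t along a steering trajectory: a factor t - s turns the
    integral of the gap into a double integral by [II_tail], comparable with the main term. *)
Lemma compare_snd_final xi : (forall s, 0 <= s <= t -> nrm (x s) ^+ 2 <= xi s) ->
  IG 0 t (fun s => xi s * p s) ->
  `|(De t).2 - II 0 t (fun s => II 0 s q)| <=
    (40 * La ^+ 3 * t + 18 * La ^+ 2 * r) * II 0 t (fun s => II 0 s p)
    + La * II 0 t (fun s => xi s * p s).
Proof.
have L1 := La1; have r0 := rge0.
move=> Hxi Ixi.
have tt : 0 <= t <= t by rewrite t0 lexx.
have [E I1] := incr (lift ord0 ord0) tt; rewrite -[(De t).2]/(vcomp (lift ord0 ord0) (De t)) E.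
have Iq : IG 0 t (fun s => II 0 s q).
  apply: (@IG_lip _ _ _ (La * (2 * M%:R))); apply: II_lip_on; first exact: push_IG.
  move=> s _; apply: le_trans (push_le s) _; rewrite ler_wpM2l //; first lra.
  by apply: le_trans (ler_norm _) (gap_bound s).
have Ip := IG_gap (lexx t).
pose c1 := 8 * La ^+ 2 * t + La * r ^+ 2.
pose c2 := 32 * La ^+ 2 * t + La * r ^+ 2.
apply: (@le_trans _ _ (II 0 t (fun a => (c1 + La * c2 + 16 * La ^+ 2 * r) * II 0 a p
   + La * (xi a * p a)))); last first.
  rewrite IID; [|exact: IGZ|exact: IGZ].
  rewrite !IIZ // lerD2r ler_wpM2r //; first by apply: II_ge0 => s _; exact: II_gap_ge0.
  rewrite /c1 /c2.
  have h1 : r ^+ 2 <= r by rewrite expr2 ler_piMl.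
  have h2 : La * r ^+ 2 <= La ^+ 2 * r.
    by rewrite expr2 -mulrA; apply: ler_wpM2l; [lra|]; rewrite (le_trans h1) // ler_peMl.
  have h3 : La ^+ 2 * t <= La ^+ 3 * t.
    by rewrite ler_wpM2r // (exprSr La 2) ler_peMr // exprn_ge0 //; lra.
  have h4 : La ^+ 2 * r ^+ 2 <= La ^+ 2 * r by rewrite ler_wpM2l // exprn_ge0 //; lra.
  have -> : La * (32 * La ^+ 2 * t + La * r ^+ 2) = 32 * (La ^+ 3 * t) + La ^+ 2 * r ^+ 2 by ring.
  lra.
rewrite -IIB //; apply: II_abs; first exact: IGB.
  by apply: IGD; exact: IGZ.
move=> a /andP[a0 at_]; have aT : 0 <= a <= t by lra.
have H1 := ps_2 ps (x1 aT) (x1' aT) (au.2 a) (au'.2 a).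
have H2 : La * nrm (x a) ^+ 2 * p a <= La * (xi a * p a).
  by rewrite -mulrA ler_wpM2l ?ler_wpM2r ?gap_ge0 ?Hxi //; lra.
have H3 := compare_nrm aT; have H4 := compare_fst aT; have H5 := compare_snd aT.
have P0 := II_gap_ge0 a.
have H4' : `|(De a).1 - II 0 a q| <= c1 * II 0 a p.
  apply: le_trans H4 _; rewrite ler_wpM2r // lerD2r ler_wpM2l //.
  by rewrite mulr_ge0 // exprn_ge0 //; lra.
have H5' : La * `|(De a).2| <= La * c2 * II 0 a p.
  rewrite -mulrA ler_wpM2l //; first lra.
  apply: le_trans H5 _; rewrite ler_wpM2r // lerD2r ler_wpM2l //.
  by rewrite mulr_ge0 // exprn_ge0 //; lra.
have H6 : La * (nrm (x a) + nrm (x' a)) * nrm (De a) <= 16 * La ^+ 2 * r * II 0 a p.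
  have -> : 16 * La ^+ 2 * r * II 0 a p = (La * (2 * r)) * (8 * La * II 0 a p) by ring.
  rewrite ler_pM ?nrm_ge0 //; first by rewrite mulr_ge0 ?addr_ge0 ?nrm_ge0 //; lra.
  by rewrite ler_wpM2l //; [lra|have := xr aT; have := xr' aT; lra].
rewrite -[(De a).1]/((x' a).1 - (x a).1) in H4'.
rewrite -[(De a).2]/((x' a).2 - (x a).2) in H5'.
rewrite -/(p a) in H1.
have -> : dyn f g (lift ord0 ord0) (x' a) (u' a) - dyn f g (lift ord0 ord0) (x a) (u a) - II 0 a q
  = (dyn f g (lift ord0 ord0) (x' a) (u' a) - dyn f g (lift ord0 ord0) (x a) (u a) -
   ((x' a).1 - (x a).1)) + ((x' a).1 - (x a).1 - II 0 a q) by ring.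
apply: le_trans (ler_normD _ _) _.
lra.
Qed.

End Compare.
End NormalisedSystem.

(** * Translation invariance and concatenation of trajectories *)

Section Translation.
Variable R : realType.
Notation mu := (@lebesgue_measure R).

Definition shiftr (c : R) : measurableTypeR R -> measurableTypeR R := fun x => x + c.

Lemma measurable_shiftr c : measurable_fun setT (shiftr c).
Proof. by apply: measurable_funD. Qed.

Lemma lebesgue_measure_shift c (A : set R) : measurable A ->
  pushforward mu (shiftr c) A = mu A.
Proof.
move=> mA.
pose pm : {measure set (measurableTypeR R) -> \bar R} := pushforward mu (shiftr c).
apply/esym/(@lebesgue_measure_unique _ (pm (measurable_shiftr c))) => //= _ [[a b]] _ <-.
rewrite /pushforward.
have -> : shiftr c @^-1` `]a, b] = `](a - c), (b - c)]%classic.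
  by apply/seteqP; split => x /=; rewrite !in_itv /= /shiftr ltrBlDr lerBrDr.
by rewrite !lebesgue_measure_itv/= !lte_fin ltrD2r -!EFinB; congr (if _ then _%:E else _); ring.
Qed.

Lemma integral_shift c (D : set R) (f : R -> \bar R) : measurable D -> measurable_fun D f ->
  (\int[mu]_(x in D) f x = \int[mu]_(x in shiftr c @^-1` D) f (x + c)%R)%E.
Proof.
move=> mD mf.
have H (g : R -> \bar R) : measurable_fun D g -> (forall x, 0 <= g x)%E ->
   (\int[mu]_(x in D) g x = \int[mu]_(x in shiftr c @^-1` D) g (x + c)%R)%E.
  move=> mg g0.
  have := @ge0_integral_pushforward _ _ _ _ R (shiftr c) (measurable_shiftr c) mu D g mD mg
    (fun y _ => g0 y).
  move=> <-.
  pose pm : {measure set (measurableTypeR R) -> \bar R} := pushforward mu (shiftr c).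
  have := @eq_measure_integral _ (measurableTypeR R) R D (pm (measurable_shiftr c)) mu g.
  by apply => A mA _; exact/esym/lebesgue_measure_shift.
rewrite integralE [RHS]integralE; congr (_ - _)%E.
  by rewrite H; [apply: eq_integral => x _; rewrite !funeposE|exact: measurable_funepos|].
by rewrite H; [apply: eq_integral => x _; rewrite !funenegE|exact: measurable_funeneg|].
Qed.

Lemma measurable_preimage_shift c (D : set R) : measurable D -> measurable (shiftr c @^-1` D).
Proof. by move=> mD; rewrite -[X in measurable X]setTI; exact: measurable_shiftr. Qed.

Lemma preimage_shift_itv c a b : shiftr c @^-1` `[a, b] = `[a - c, b - c]%classic.
Proof. by apply/seteqP; split => x /=; rewrite !in_itv /= /shiftr lerBlDr lerBrDr. Qed.

Lemma IG_shift c a b (f : R -> R) : IG a b f -> IG (a - c) (b - c) (fun x => f (x + c)).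
Proof.
move=> If; have mf := IG_measurable If; move/integrableP : If => [mf' If].
apply/integrableP; split.
  apply/measurable_EFinP => _ B mB.
  have -> : `[a - c, b - c] `&` (fun x => f (x + c)) @^-1` B =
     shiftr c @^-1` (`[a, b] `&` f @^-1` B).
    by rewrite preimage_setI preimage_shift_itv.
  by apply: measurable_preimage_shift; exact: mf.
rewrite -preimage_shift_itv -(@integral_shift c `[a, b] (fun x => `|(f x)%:E|%E)) //.
by apply: measurableT_comp => //; exact/measurable_EFinP.
Qed.

Lemma II_shift c a b (f : R -> R) : IG a b f ->
  II (a - c) (b - c) (fun x => f (x + c)) = II a b f.
Proof.
move=> If; have mf := IG_measurable If.
rewrite /II /Rintegral -preimage_shift_itv -(@integral_shift c `[a, b] (fun x => (f x)%:E)) //.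
exact/measurable_EFinP.
Qed.

End Translation.

Section Concatenation.
Variables (R : realType) (M : nat).
Implicit Types (z : R * R) (x y : R -> R * R) (t s : R) (u v : R -> 'I_M -> R).
Variables (f : R * R -> R * R) (g : 'I_M -> R * R -> R * R).
Notation mu := (@lebesgue_measure R).

Lemma IG_glue (a b c : R) (h h1 h2 : R -> R) : a <= b -> b <= c ->
  IG a b h1 -> IG b c h2 ->
  (forall r, a <= r <= b -> h r = h1 r) -> (forall r, b < r <= c -> h r = h2 r) ->
  IG a c h /\ II a c h = II a b h1 + II b c h2.
Proof.
move=> ab bc I1 I2 e1 e2.
have E : `[a, c]%classic = `[a, b] `|` `]b, c] :> set R.
  by apply: itv_bndbnd_setU; rewrite bnd_simp.
have I2' : mu.-integrable `]b, c] (EFin \o h2).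
  by apply: integrableS I2 => //; apply: subset_itv; rewrite bnd_simp.
have J1 : mu.-integrable `[a, b] (EFin \o h).
  by apply: eq_integrable I1 => // r; rewrite inE /= in_itv /= => /e1 ->.
have J2 : mu.-integrable `]b, c] (EFin \o h).
  by apply: eq_integrable I2' => // r; rewrite inE /= in_itv /= => /e2 ->.
have disj : [disjoint `[a, b]%classic & `]b, c]%classic].
  apply/disj_setPS => r /= [] /=; rewrite !in_itv /= => /andP[_ rb] /andP[br _].
  by have := lt_le_trans br rb; rewrite ltxx.
have mh : measurable_fun (`[a, b] `|` `]b, c]) (EFin \o h).
  have [m1 _] := integrableP _ _ _ J1; have [m2 _] := integrableP _ _ _ J2.
  by rewrite measurable_funU.
have J : mu.-integrable (`[a, b] `|` `]b, c]) (EFin \o h).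
  apply/integrableP; split => //.
  rewrite ge0_integral_setU //; last exact: measurableT_comp.
  by apply: lte_add_pinfty; [case/integrableP: J1|case/integrableP: J2].
split; first by rewrite /IG E.
rewrite /II E Rintegral_setU //; congr (_ + _).
  by apply: eq_Rintegral => r; rewrite inE /= in_itv /= => /e1 ->.
rewrite -(@Rintegral_itv_obnd_cbnd _ b) //.
by apply: eq_Rintegral => r; rewrite inE /= in_itv /= => /e2 ->.
Qed.

Lemma reach_time_concat z u x t t' : admissible u -> trajectory f g z u x t -> 0 <= t ->
  reach_time f g (x t) t' -> reach_time f g z (t + t').
Proof.
move=> au tx t0 [t'0 [u' [x' [au' [tx' x'0]]]]]; split; first by rewrite addr_ge0.
pose U s i := if s <= t then u s i else u' (s - t) i.
pose X s := if s <= t then x s else x' (s - t).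
exists U, X; split; [|split].
- split=> [i|s i]; last by rewrite /U; case: ifP => _; [apply: au.2|apply: au'.2].
  apply: measurable_fun_ifT; first exact: measurable_fun_ler.
    exact: au.1.
  by apply: (@measurableT_comp _ _ _ _ _ _ (fun s => u' s i)); [exact: au'.1|exact: measurable_shiftr].
- have early s k : s <= t -> 0 <= s -> IG 0 s (fun r => dyn f g k (X r) (U r)) /\
      II 0 s (fun r => dyn f g k (X r) (U r)) = II 0 s (fun r => dyn f g k (x r) (u r)).
    move=> st s0; have [I1 _] := tx s ltac:(lra) k.
    have Eq r : 0 <= r <= s -> dyn f g k (x r) (u r) = dyn f g k (X r) (U r).
      move=> /andP[_ rs]; rewrite /X /dyn (le_trans rs st); congr (_ + _).
      by apply: eq_bigr => i _; rewrite /U (le_trans rs st).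
    split; last by apply: IIE => r /Eq.
    by apply: eq_integrable I1 => // r; rewrite inE /= in_itv /= => /Eq ->.
  move=> s /andP[s0 stt] k; have [st|ts] := leP s t.
    have [I1 E1] := early s k st s0; split=> //; rewrite {1}/X st.
    by have [_ ->] := tx s ltac:(lra) k; rewrite -/(II _ _ _) -[in RHS]/(II _ _ _) E1.
  have [I1 E1] := tx t ltac:(lra) k.
  have [I2 E2] := tx' (s - t) ltac:(lra) k.
  have := IG_shift (- t) I2; have := II_shift (- t) I2.
  rewrite !opprK add0r subrK => E3 I3.
  have [||J EJ] := @IG_glue 0 t s (fun r => dyn f g k (X r) (U r)) _ _ t0 (ltW ts) I1 I3.
  + move=> r /andP[_ rt]; rewrite /X /dyn rt; congr (_ + _).
    by apply: eq_bigr => i _; rewrite /U rt.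
  + move=> r /andP[tr _]; rewrite /X /dyn leNgt tr /=; congr (_ + _).
    by apply: eq_bigr => i _; rewrite /U leNgt tr.
  split => //; rewrite -/(II _ _ _) EJ E3 {1}/X leNgt ts /= E2 E1 -!/(II _ _ _).
  by rewrite addrA.
(* If t + t' <= t then t' = 0: the first branch is in force, and x t = x' 0 = 0. *)
- rewrite /X; case: leP => [tt|_]; last by rewrite addrC addKr in x'0 *.
  have t'E : t' = 0 by lra.
  by rewrite t'E addr0 -x'0 t'E; exact/esym/(@sol0 R (field f g u') _ _ _ t'0 tx').
Qed.

Lemma reach_time_zero : reach_time f g 0 0.
Proof.
split => //; exists (fun _ _ => 0), (fun=> 0); split; [|split] => //.
  by split=> [i|t i]; [exact: measurable_cst|lra].
move=> s s0 k; have -> : s = 0 by lra.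
split; first by exact: IG_cst.
by rewrite -/(II 0 0 _) II_point addr0.
Qed.

End Concatenation.

(** * Small-time controllability by affine controls *)

Section LocalControllability.
Variable R : realType.

Lemma II_sqr (t : R) : 0 <= t -> II 0 t (fun s => s ^+ 2) = t ^+ 3 / 3.
Proof.
move=> t0.
have I2 s : IG 0 s (fun s => s ^+ 2).
  apply: (@IG_lip _ _ _ (2 * s)) => x y /andP[x0 xs] /andP[y0 ys].
  rewrite subr_sqr mulrC normrM ler_wpM2r // ger0_norm ?addr_ge0 //; lra.
have H s1 s2 : 0 <= s1 -> s1 <= s2 -> s2 <= t ->
    s1 ^+ 2 * (s2 - s1) <= II 0 s2 (fun s => s ^+ 2) - II 0 s1 (fun s => s ^+ 2) <= s2 ^+ 2 * (s2 - s1).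
  move=> h1 h2 h3; rewrite (II_chasles h1 h2) // addrAC subrr add0r.
  have I12 : IG s1 s2 (fun s => s ^+ 2) by apply: (IGS (a := 0) (b := s2)).
  rewrite -!II_cst //; apply/andP; split.
    by apply: II_le => //; [exact: IG_cst|move=> x /andP[? ?]; rewrite ler_sqr ?nnegrE //; lra].
  by apply: II_le => //; [exact: IG_cst|move=> x /andP[? ?]; rewrite ler_sqr ?nnegrE //; lra].
have Q s1 s2 : 0 <= s1 -> s1 <= s2 -> s2 <= t ->
   s2 ^+ 3 / 3 - s1 ^+ 3 / 3 <= s1 ^+ 2 * (s2 - s1) + t * (s2 - s1) ^+ 2 /\
   s2 ^+ 2 * (s2 - s1) <= s2 ^+ 3 / 3 - s1 ^+ 3 / 3 + t * (s2 - s1) ^+ 2.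
  move=> h1 h2 h3.
  have e1 : s1 ^+ 2 * (s2 - s1) + t * (s2 - s1) ^+ 2 - (s2 ^+ 3 / 3 - s1 ^+ 3 / 3) =
    (t - (s2 + 2 * s1) / 3) * (s2 - s1) ^+ 2 by field.
  have e2 : s2 ^+ 3 / 3 - s1 ^+ 3 / 3 + t * (s2 - s1) ^+ 2 - s2 ^+ 2 * (s2 - s1) =
    (t - (2 * s2 + s1) / 3) * (s2 - s1) ^+ 2 by field.
  by split; rewrite -subr_ge0 ?e1 ?e2 mulr_ge0 ?sqr_ge0 //; lra.
apply/eqP; rewrite eq_le; apply/andP; split.
  have := @quad_increment R (fun s => II 0 s (fun s => s ^+ 2)) (fun s => s ^+ 3 / 3) t t t0.
  rewrite II_point subr0 expr0n mul0r subr0; apply.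
  by move=> s1 s2 h1 h2 h3; have /andP[_] := H _ _ h1 h2 h3; have [_] := Q _ _ h1 h2 h3; lra.
have := @quad_increment R (fun s => s ^+ 3 / 3) (fun s => II 0 s (fun s => s ^+ 2)) t t t0.
rewrite II_point subr0 expr0n mul0r subr0; apply.
by move=> s1 s2 h1 h2 h3; have /andP[+ _] := H _ _ h1 h2 h3; have [+ _] := Q _ _ h1 h2 h3; lra.
Qed.

Lemma II_affine (a b s : R) : 0 <= s -> II 0 s (fun r => a + b * r) = a * s + b * (s ^+ 2 / 2).
Proof.
move=> s0; have Iid : IG 0 s id by apply: (@IG_lip _ _ _ 1) => x y _ _; rewrite mul1r.
by rewrite IID; [rewrite II_cst // subr0 IIZ // II_id|exact: IG_cst|exact: IGZ].
Qed.

Lemma IIII_affine (a b t : R) : 0 <= t ->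
  II 0 t (fun s => II 0 s (fun r => a + b * r)) = a * (t ^+ 2 / 2) + b * (t ^+ 3 / 6).
Proof.
move=> t0.
have Iid : IG 0 t id by apply: (@IG_lip _ _ _ 1) => x y _ _; rewrite mul1r.
have I2 : IG 0 t (fun s => s ^+ 2).
  apply: (@IG_lip _ _ _ (2 * t)) => x y /andP[x0 xs] /andP[y0 ys].
  rewrite subr_sqr mulrC normrM ler_wpM2r // ger0_norm ?addr_ge0 //; lra.
rewrite (@IIE _ _ _ _ (fun s => a * s + b / 2 * s ^+ 2)); last first.
  by move=> x /andP[x0 _]; rewrite II_affine //; ring.
rewrite IID; [|exact: IGZ|exact: IGZ].
by rewrite !IIZ // II_id // II_sqr //; field.
Qed.

Lemma sol_forward_bound La h (z : R * R) x t s : good_field La h -> sol h z x t ->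
  (forall r, 0 <= r <= t -> nrm (x r) <= 1) -> 0 <= s <= t ->
  nrm (x s - z) <= 4 * La * s.
Proof.
move=> gh sx x1 st; have /andP[s0 st'] := st.
have -> : 4 * La * s = 2 * (2 * La * s) by lra.
apply: nrm_le_comp => k; rewrite vcompB.
have [I1 ->] := sx s st k; rewrite addrAC subrr add0r -[X in _ * X]subr0.
by apply: II_abs_cst => // r rt; apply: (gf_bound _ _ gh); apply: x1; lra.
Qed.

Lemma nrm0 : nrm (0 : R * R) = 0.
Proof. by rewrite /nrm /= normr0 addr0. Qed.

(** The affine function with integral c.1 t and double integral c.2 t^2 over [0, t]; its
    coefficients solve that two by two system. The scaling makes the size of the control independent
    of t. *)
Definition ramp (t : R) (c : R * R) (s : R) : R :=
  (6 * c.2 - 2 * c.1) + (6 * c.1 - 12 * c.2) / t * s.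

Lemma rampB t c c' s : ramp t c' s - ramp t c s = ramp t (c' - c) s.
Proof. by rewrite /ramp /=; ring. Qed.

Lemma ramp_bound t c s : 0 < t -> 0 <= s <= t -> `|ramp t c s| <= 6 * nrm c.
Proof.
move=> t0 /andP[s0 st].
pose sg := s / t.
have sg01 : 0 <= sg <= 1.
  by rewrite /sg divr_ge0 ?(ltW t0) //= ler_pdivrMr // mul1r.
(* An affine function is the convex combination of its two end values. *)
have -> : ramp t c s = (1 - sg) * (6 * c.2 - 2 * c.1) + sg * (4 * c.1 - 6 * c.2).
  by rewrite /ramp /sg; field; rewrite gt_eqF.
have h1 : `|6 * c.2 - 2 * c.1| <= 6 * nrm c.
  by rewrite /nrm ler_norml; have := ler_norm c.1; have := ler_norm c.2;
     have := ler_norm (- c.1); have := ler_norm (- c.2); rewrite !normrN => *; apply/andP; split;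
     have := normr_ge0 c.1; have := normr_ge0 c.2; lra.
have h2 : `|4 * c.1 - 6 * c.2| <= 6 * nrm c.
  by rewrite /nrm ler_norml; have := ler_norm c.1; have := ler_norm c.2;
     have := ler_norm (- c.1); have := ler_norm (- c.2); rewrite !normrN => *; apply/andP; split;
     have := normr_ge0 c.1; have := normr_ge0 c.2; lra.
apply: le_trans (ler_normD _ _) _; have sg0 : 0 <= sg by lra.
have sg1 : 0 <= 1 - sg by lra.
rewrite (normrM (1 - sg)) (normrM sg) (ger0_norm sg0) (ger0_norm sg1).
have := ler_wpM2l sg1 h1; have := ler_wpM2l sg0 h2; lra.
Qed.

Lemma II_ramp t c : 0 < t -> II 0 t (ramp t c) = c.1 * t.
Proof.
by move=> t0; rewrite /ramp II_affine ?ltW //; field; rewrite gt_eqF.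
Qed.

Lemma IIII_ramp t c : 0 < t -> II 0 t (fun s => II 0 s (ramp t c)) = c.2 * t ^+ 2.
Proof.
by move=> t0; rewrite /ramp IIII_affine ?ltW //; field; rewrite gt_eqF.
Qed.

(** Clipping makes every parameter admissible, so that a trajectory exists for each c; for nrm c <=
    1 / 10 it is inactive because 6 / 10 < 1. *)
Definition ramp_ctrl t c : R -> 'I_1 -> R := fun s _ =>
  Num.max (-1) (Num.min 1 (ramp t c s)).

Lemma ramp_ctrl_admissible t c : admissible (ramp_ctrl t c).
Proof.
split=> [i|s i].
  apply: measurable_maxr => //; apply: measurable_minr => //.
  by apply: measurable_funD => //; apply: measurable_funM.
by rewrite /ramp_ctrl le_max lexx /= ge_max ge_min lexx /= andbT; lra.
Qed.

Lemma ramp_ctrlE t c s i : 0 < t -> 0 <= s <= t -> nrm c <= 1 / 10 ->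
  ramp_ctrl t c s i = ramp t c s.
Proof.
move=> t0 st c1; have := ramp_bound c t0 st; rewrite ler_norml /ramp_ctrl => /andP[h1 h2].
rewrite min_r; last by lra.
by rewrite max_r //; lra.
Qed.

(** Over a time t of order rho the parameter c displaces the endpoint by (c.1 t, c.2 t^2) up to a
    relative error of order La^3 t, and the contraction principle corrects c until the endpoint is
    0. The factor 200 makes the uncontrolled endpoint small in the scaled variables; smallness of
    La^4 rho makes the correction contract. *)
Lemma stlc_pos (La : R) (f : R * R -> R * R) (g : 'I_1 -> R * R -> R * R) (z : R * R) (rho : R) :
  planar_sys La (fun=> 1) f g -> 0 < rho -> `|z.1| <= rho -> `|z.2| <= rho ^+ 2 ->
  La ^+ 4 * rho <= 1 / (60 * 100 * 100) -> reach_time f g z (200 * La * rho).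
Proof.
move=> ps rho0 z1 z2 small.
have L1 := bs_ge1 (ps_basic ps).
have L0 : 0 < La by lra.
have L0' := ltW L0.
set t := 200 * La * rho; have tE : t = 200 * La * rho by [].
clearbody t.
have t0 : 0 < t by rewrite tE !mulr_gt0.
have Lp n : 1 <= La ^+ n by rewrite exprn_ege1.
have Lrho n : (n <= 4)%N -> La ^+ n * rho <= 1 / (60 * 100 * 100).
  by move=> n4; apply: le_trans small; rewrite ler_pM2r // ler_weXn2l.
have Lt n : (n <= 3)%N -> La ^+ n * t <= 1 / (30 * 100).
  move=> n3; have -> : La ^+ n * t = 200 * (La ^+ n.+1 * rho) by rewrite exprS tE; ring.
  by have := Lrho n.+1 n3; lra.
have t1 := Lt 0%N isT; rewrite expr0 mul1r in t1.
have Lt1 := Lt 1%N isT; rewrite expr1 in Lt1.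
have Lt3 := Lt 3%N isT.
have rho1 := Lrho 0%N isT; rewrite expr0 mul1r in rho1.
have rho2 : rho ^+ 2 <= rho by rewrite expr2 ler_piMl //; lra.
have zr : nrm z <= 2 * rho by rewrite /nrm; lra.
have rt : 200 * rho <= t.
  by rewrite tE ler_pM2r // ler_peMr.
have tLt : t <= La * t by rewrite ler_peMl // ltW.
have nz0 := nrm_ge0 z.
pose r := 5 * La * t; have rE : r = 5 * La * t by [].
clearbody r.
have r1 : r <= 1 by rewrite rE; lra.
have gd c := basic_good (ps_basic ps) (ramp_ctrl_admissible t c).
have ex c : exists x, trajectory f g z (ramp_ctrl t c) x t /\
    forall s, 0 <= s <= t -> nrm (x s) <= 1.
  by apply: (picard (gd c)); clear -t0 zr rt tLt Lt1 t1; lra.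
pose X c := sval (cid (ex c)).
have XP c : trajectory f g z (ramp_ctrl t c) (X c) t /\
    forall s, 0 <= s <= t -> nrm (X c s) <= 1 by rewrite /X; case: cid.
have Xr c s : 0 <= s <= t -> nrm (X c s) <= r.
  move=> st; have /andP[s0 st'] := st.
  have := sol_forward_bound (gd c) (XP c).1 (XP c).2 st.
  have := nrmD (X c s - z) z; rewrite subrK.
  have : La * s <= La * t by rewrite ler_pM2l.
  by rewrite rE; clear -nz0 zr rt tLt rho0; lra.
(* A fixed point of Phi is a parameter whose endpoint vanishes. *)
pose Phi c := (c.1 - (X c t).1 / t, c.2 - (X c t).2 / t ^+ 2).
have tI : 0 <= t <= t by rewrite lexx ltW.
have ctr c c' : nrm c <= 1 / 10 -> nrm c' <= 1 / 10 -> nrm (Phi c - Phi c') <= nrm (c - c') / 2.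
  move=> c1 c1'.
  pose u := ramp_ctrl t c; pose u' := ramp_ctrl t c'.
  pose eta := nrm (c' - c).
  have eta0 : 0 <= eta by exact: nrm_ge0.
  have au := ramp_ctrl_admissible t c; have au' := ramp_ctrl_admissible t c'.
  have pE s : 0 <= s <= t -> ctrl_gap u u' s <= 6 * eta.
    move=> st; rewrite /ctrl_gap big_ord1 /u /u' !ramp_ctrlE // rampB.
    exact: ramp_bound.
  have qE s : 0 <= s <= t -> ctrl_push (fun=> 1) u u' s = ramp t (c' - c) s.
    by move=> st; rewrite /ctrl_push big_ord1 mul1r /u /u' !ramp_ctrlE // rampB.
  have pI s : 0 <= s <= t -> II 0 s (ctrl_gap u u') <= 6 * eta * s.
    move=> /andP[s0 st]; rewrite -[X in _ * X]subr0 -II_cst //; apply: II_le.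
    - exact: gap_IG.
    - exact: IG_cst.
    - by move=> a /andP[a0 as_]; apply: pE; rewrite a0 (le_trans as_).
  have Lt4 : 4 * La * t <= 1 by clear -Lt1; lra.
  have C1 := compare_fst ps (ltW t0) Lt4 r1 au au' (XP c).1 (XP c').1 (Xr c) (Xr c') tI.
  have C2 := @compare_snd_final _ _ _ _ _ _ ps z u u' (X c) (X c') t r (ltW t0) Lt4 r1 au au'
     (XP c).1 (XP c').1 (Xr c) (Xr c') (fun=> r ^+ 2).
  have {}C2 : `|(X c' t - X c t).2 - II 0 t (fun s => II 0 s (ctrl_push (fun=> 1) u u'))| <=
    (40 * La ^+ 3 * t + 18 * La ^+ 2 * r) * II 0 t (fun s => II 0 s (ctrl_gap u u')) +
    La * II 0 t (fun s => r ^+ 2 * ctrl_gap u u' s).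
    apply: C2; last by apply: IGZ; exact: gap_IG.
    by move=> s st; rewrite ler_sqr ?nnegrE ?nrm_ge0 ?Xr // (le_trans (nrm_ge0 _) (Xr c s st)).
  have Eq1 : II 0 t (ctrl_push (fun=> 1) u u') = (c'.1 - c.1) * t.
    by rewrite (IIE qE) II_ramp.
  have Eq2 : II 0 t (fun s => II 0 s (ctrl_push (fun=> 1) u u')) = (c'.2 - c.2) * t ^+ 2.
    have -> : (c'.2 - c.2) * t ^+ 2 = II 0 t (fun s => II 0 s (ramp t (c' - c))) by rewrite IIII_ramp.
    apply: IIE => s /andP[s0 st].
    by apply: IIE => a /andP[a0 as_]; apply: qE; rewrite a0 (le_trans as_).
  rewrite Eq1 in C1; rewrite Eq2 in C2; clear Eq1 Eq2.
  have P1 := pI t tI.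
  have P2 : II 0 t (fun s => II 0 s (ctrl_gap u u')) <= 6 * eta * t ^+ 2.
    rewrite expr2 mulrA -[X in _ * X]subr0 -II_cst ?(ltW t0) //; apply: II_le.
    - exact: (IG_gap (t := t)).
    - exact: IG_cst.
    - move=> a /andP[a0 at_]; apply: le_trans (pI a _) _; first by rewrite a0 at_.
      by rewrite ler_wpM2l // mulr_ge0.
  have P3 : II 0 t (fun s => r ^+ 2 * ctrl_gap u u' s) <= r ^+ 2 * (6 * eta * t).
    by rewrite IIZ; [rewrite ler_wpM2l ?sqr_ge0|exact: gap_IG].
  (* Every perturbation term is a multiple of m; the two Lipschitz constants add up to 6 (33 + 155)
     m, which is below 1/2. *)
  pose m := La ^+ 3 * t; have mE : m = La ^+ 3 * t by [].
  have m1 : m <= 1 / (30 * 100) by exact: Lt3.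
  clearbody m.
  have m0 : 0 <= m by rewrite mE mulr_ge0 ?exprn_ge0 ?(ltW t0).
  have L23 : La ^+ 2 * t <= m by rewrite mE ler_pM2r // ler_weXn2l.
  have t1' : t <= 1 by clear -t1; lra.
  have Lr2 : La * r ^+ 2 <= 25 * m.
    have -> : La * r ^+ 2 = 25 * m * t by rewrite rE mE; ring.
    by rewrite ler_piMr // mulr_ge0.
  have g0 : 0 <= II 0 t (ctrl_gap u u') by apply: II_ge0 => *; exact: gap_ge0.
  have D1 : `|(X c' t).1 - (X c t).1 - (c'.1 - c.1) * t| <= (33 * 6 * m) * eta * t.
    apply: le_trans C1 _.
    apply: le_trans (_ : 33 * m * (6 * eta * t) <= _); last by clear; lra.
    rewrite ler_pM //; last by clear -L23 Lr2; lra.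
    by rewrite addr_ge0 // mulr_ge0 ?sqr_ge0 ?mulr_ge0 ?sqr_ge0 ?(ltW t0).
  have D2 : `|(X c' t).2 - (X c t).2 - (c'.2 - c.2) * t ^+ 2| <= (155 * 6 * m) * eta * t ^+ 2.
    apply: le_trans C2 _.
    have A1 : (40 * La ^+ 3 * t + 18 * La ^+ 2 * r) * II 0 t (fun s => II 0 s (ctrl_gap u u')) <=
        130 * m * (6 * eta * t ^+ 2).
      have -> : 40 * La ^+ 3 * t + 18 * La ^+ 2 * r = 130 * m by rewrite rE mE; ring.
      by rewrite ler_wpM2l // mulr_ge0.
    have A2 : La * II 0 t (fun s => r ^+ 2 * ctrl_gap u u' s) <= 25 * m * (6 * eta * t ^+ 2).
      apply: le_trans (_ : La * (r ^+ 2 * (6 * eta * t)) <= _); first by rewrite ler_pM2l.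
      by rewrite rE mE le_eqVlt; apply/orP; left; apply/eqP; ring.
    by clear -A1 A2; lra.
  have meta : m * eta <= 1 / (30 * 100) * eta by rewrite ler_wpM2r.
  have F1 : `|(Phi c - Phi c').1| <= 33 * 6 * m * eta.
    have -> : (Phi c - Phi c').1 = ((X c' t).1 - (X c t).1 - (c'.1 - c.1) * t) / t.
      by rewrite /Phi /=; field; rewrite gt_eqF.
    by rewrite normrM normfV (gtr0_norm t0) ler_pdivrMr.
  have F2 : `|(Phi c - Phi c').2| <= 155 * 6 * m * eta.
    have -> : (Phi c - Phi c').2 = ((X c' t).2 - (X c t).2 - (c'.2 - c.2) * t ^+ 2) / t ^+ 2.
      by rewrite /Phi /=; field; rewrite gt_eqF.
    by rewrite normrM normfV (gtr0_norm (exprn_gt0 2 t0)) ler_pdivrMr ?exprn_gt0.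
  rewrite [nrm (c - c')]nrmB -/eta.
  have := lerD F1 F2; rewrite -/(nrm (Phi c - Phi c')).
  by clearbody eta; clear -meta eta0; lra.
have U0 s : ramp_ctrl t 0 s = (fun=> 0).
  apply/funext => i; rewrite /ramp_ctrl /ramp /= !mulr0 !subrr !mul0r addr0.
  by rewrite min_r // max_r //; lra.
have traj0 s : trajectory f g 0 (ramp_ctrl t 0) (fun=> 0) s.
  move=> a /andP[a0 _] k.
  have -> : (fun r => dyn f g k 0 (ramp_ctrl t 0 r)) = (fun=> 0).
    by apply/funext => b; rewrite U0 (ps_eq0 ps).
  split; first exact: IG_cst.
  by rewrite -/(II _ _ _) II_cst // mul0r addr0.
have X0 s : 0 <= s <= t -> nrm (X 0 s) <= 2 * nrm z.
  move=> /andP[s0 st].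
  have Ls : 4 * La * s <= 1.
    apply: le_trans (_ : 4 * La * t <= 1); last by clear -Lt1; lra.
    by rewrite ler_wpM2l // mulr_ge0.
  have := gronwall (h' := field f g (ramp_ctrl t 0)) (gd 0) s0 Ls (solW st (XP 0).1) (traj0 s) _ _ (IG_cst _ _ 0) _.
  rewrite II_cst // mul0r mulr0 addr0 !subr0; apply.
  - by move=> a /andP[a0 as_]; apply: (XP 0).2; rewrite a0 (le_trans as_).
  - by move=> *; rewrite nrm0.
  - by move=> *; rewrite subrr normr0.
(* With the zero ramp only the drift acts, and it vanishes at 0, so the path stays within 2 nrm z <=
   4 rho. As t = 200 La rho, the scaled endpoint has norm at most 1/50 + 3/100. *)
have P0 : nrm (Phi 0) <= 1 / 10 / 2.
  have h1 : `|(X 0 t).1| <= 4 * rho.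
    by have := X0 t tI; rewrite {1}/nrm; have := normr_ge0 (X 0 t).2; clear -zr; lra.
  have h2 : `|(X 0 t).2| <= rho ^+ 2 + 4 * La * rho * t.
    have [I1 E1] := (XP 0).1 t tI (lift ord0 ord0).
    rewrite -[(X 0 t).2]/(vcomp (lift ord0 ord0) (X 0 t)) E1.
    apply: le_trans (ler_normD _ _) _; apply: lerD => //.
    rewrite -[X in _ * X]subr0; apply: II_abs_cst => //; first exact: ltW.
    move=> s st; rewrite U0.
    have n00 : nrm (0 : R * R) <= 1 by rewrite nrm0.
    have b0 : box (fun _ : 'I_1 => 0 : R) by move=> i; lra.
    have := bs_lip (ps_basic ps) (lift ord0 ord0) ((XP 0).2 s st) n00 b0.
    rewrite (ps_eq0 ps) !subr0 => h; apply: le_trans h _.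
    have -> : 4 * La * rho = La * (4 * rho) by ring.
    by rewrite ler_pM2l //; have := X0 s st; clear -zr; lra.
  rewrite /Phi /nrm /= !sub0r !normrN !normrM !normfV (gtr0_norm t0) (gtr0_norm (exprn_gt0 2 t0)).
  have g1 : `|(X 0 t).1| / t <= 1 / 50 by rewrite ler_pdivrMr //; clear -h1 rt; lra.
  have g2 : `|(X 0 t).2| / t ^+ 2 <= 3 / 100.
    rewrite ler_pdivrMr ?exprn_gt0 //; apply: le_trans h2 _.
    have e1 : 4 * La * rho = t / 50 by rewrite tE; field.
    have e2 : (200 * rho) ^+ 2 <= t ^+ 2 by rewrite ler_sqr ?nnegrE ?mulr_ge0 ?(ltW rho0) ?(ltW t0).
    by rewrite e1; rewrite exprMn in e2; have := sqr_ge0 t; clear -e2; lra.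
  by clear -g1 g2; lra.
have [c c1 Ec] := planar_contraction ctr P0.
split; first exact: ltW.
exists (ramp_ctrl t c), (X c); split; first exact: ramp_ctrl_admissible.
split; first exact: (XP c).1.
have := Ec; rewrite /Phi; case: c {c1} Ec => [m n] /= _ [] e1 e2.
have {}e1 : (X (m, n) t).1 = 0.
  have : (X (m, n) t).1 / t = 0 by clear -e1; lra.
  by move=> /eqP; rewrite mulf_eq0 invr_eq0 (gt_eqF t0) orbF => /eqP.
have {}e2 : (X (m, n) t).2 = 0.
  have : (X (m, n) t).2 / t ^+ 2 = 0 by clear -e2; lra.
  by move=> /eqP; rewrite mulf_eq0 invr_eq0 (gt_eqF (exprn_gt0 2 t0)) orbF => /eqP.
by move: e1 e2; case: (X (m, n) t) => ? ? /= -> ->.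
Qed.

Lemma stlc (La : R) (f : R * R -> R * R) (g : 'I_1 -> R * R -> R * R) (z : R * R) :
  planar_sys La (fun=> 1) f g ->
  La ^+ 4 * (`|z.1| + Num.sqrt `|z.2|) <= 1 / (60 * 100 * 100) ->
  reach_time f g z (200 * La * (`|z.1| + Num.sqrt `|z.2|)).
Proof.
set rho := `|z.1| + _ => ps small.
have s0 : 0 <= Num.sqrt `|z.2| by rewrite sqrtr_ge0.
have rho0 : 0 <= rho by rewrite addr_ge0.
have [E|ne] := eqVneq rho 0; last first.
  apply: stlc_pos => //; first by rewrite lt_neqAle eq_sym ne.
    by rewrite lerDl.
  rewrite -[leLHS](@sqr_sqrtr _ `|z.2|) // ler_sqr ?nnegrE // lerDr.
  exact: normr_ge0.
have /andP[/eqP e1 /eqP e2] : (`|z.1| == 0) && (Num.sqrt `|z.2| == 0).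
  by rewrite -paddr_eq0 // -/rho E.
have -> : z = 0.
  move/eqP: e1; rewrite normr_eq0 => /eqP z1.
  move/eqP: e2; rewrite sqrtr_eq0 normr_le0 => /eqP z2.
  by case: z z1 z2 {small s0 rho0 rho E} => ? ? /= -> ->.
by rewrite E mulr0; exact: reach_time_zero.
Qed.

End LocalControllability.

(** * Steering estimates *)

Section SmallTime.
Variables (R : realType) (M : nat).
Implicit Types (f : R * R -> R * R) (g : 'I_M -> R * R -> R * R) (z : R * R).

Definition small_time f g (C rho0 : R) := forall z,
  `|z.1| + Num.sqrt `|z.2| <= rho0 ->
  exists2 t, t <= C * (`|z.1| + Num.sqrt `|z.2|) & reach_time f g z t.

(** One input already controls the system; the others are switched off. *)
Lemma small_time_single (La : R) f g (i0 : 'I_M) :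
  planar_sys La (fun=> 1) f (fun _ : 'I_1 => g i0) ->
  small_time f g (200 * La) (1 / (60 * 100 * 100) / La ^+ 4).
Proof.
move=> ps z zr.
have L1 := bs_ge1 (ps_basic ps).
have : reach_time f (fun _ : 'I_1 => g i0) z (200 * La * (`|z.1| + Num.sqrt `|z.2|)).
  by apply: stlc ps _; rewrite mulrC -ler_pdivlMr // exprn_gt0 //; lra.
move=> [t0 [u [x [au [tx xt]]]]].
exists (200 * La * (`|z.1| + Num.sqrt `|z.2|)) => //; split => //.
pose U s (i : 'I_M) := if i == i0 then u s ord0 else 0.
have UE k s : dyn f g k (x s) (U s) = dyn f (fun=> g i0) k (x s) (u s).
  rewrite /dyn big_ord1; congr (_ + _); rewrite (bigD1 i0) //= /U eqxx big1 ?addr0 // => i /negbTE ->.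
  by rewrite mul0r.
exists U, x; split; [|split] => //.
  split=> [i|s i]; rewrite /U; case: eqP => _; [exact: au.1|exact: measurable_cst|exact: au.2|lra].
move=> s st k; have [I1 E1] := tx s st k.
have UE' : (fun r => dyn f g k (x r) (U r)) = (fun r => dyn f (fun=> g i0) k (x r) (u r)).
  by apply/funext => r; rewrite UE.
by rewrite UE'.
Qed.

Lemma steering_bound (La : R) f g z u x t : basic_sys La f g -> admissible u ->
  trajectory f g z u x t -> 0 <= t -> x t = 0 -> 4 * La * t < 1 ->
  forall s, 0 <= s <= t -> nrm (x s) <= 1 /\ nrm (x s) <= 4 * La * (t - s).
Proof.
move=> bs au tx t0 xt small s st.
have := sol_confined (basic_good bs au) tx t0; rewrite xt nrm0 !add0r => /(_ small s st) H.
by rewrite add0r in H.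
Qed.

Lemma push_through (La : R) f g z z' u x t : basic_sys La f g ->
  admissible u -> trajectory f g z u x t -> 0 <= t -> x t = 0 -> 16 * La * t < 1 ->
  2 * nrm (z' - z) <= 1 ->
  exists y, trajectory f g z' u y t /\ nrm (y t) <= 2 * nrm (z' - z).
Proof.
move=> bs au tx t0 xt small; set d := nrm (z' - z) => d1.
have L1 := bs_ge1 bs.
have Lt0 : 0 <= La * t by rewrite mulr_ge0 //; lra.
have d0 : 0 <= d by exact: nrm_ge0.
have small4 : 4 * La * t < 1 by lra.
have xb := steering_bound bs au tx t0 xt small4.
have gd := basic_good bs au.
have z0 : x 0 = z by exact: (sol0 (h := field f g u) t0 tx).
have nz : nrm z <= 4 * La * t.
  by have [_] := xb 0 ltac:(lra); rewrite z0 subr0.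
have nz' : nrm z' <= 4 * La * t + d by have := nrmD (z' - z) z; rewrite subrK -/d; lra.
have [y [ty y1]] : exists y, sol (field f g u) z' y t /\ forall s, 0 <= s <= t -> nrm (y s) <= 1.
  by apply: (picard gd) => //; lra.
exists y; split => //.
have := gronwall (h' := field f g u) gd t0 (ltW small4) ty tx y1 (fun s st => (xb s st).1) (IG_cst _ _ 0).
rewrite xt subr0 II_cst // mul0r mulr0 addr0; apply.
by move=> *; rewrite subrr normr0.
Qed.

(** Run the control of z from z', which misses the origin by at most 2 nrm (z' - z), and close the
    gap with [small_time]. *)
Lemma holder_reach (La C rho0 : R) f g z z' u x t : basic_sys La f g -> small_time f g C rho0 ->
  admissible u -> trajectory f g z u x t -> 0 <= t -> x t = 0 -> 16 * La * t < 1 ->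
  let d := nrm (z' - z) in 2 * d <= 1 -> 2 * d + Num.sqrt (2 * d) <= rho0 -> 0 <= C ->
  exists2 t', t' <= t + C * (2 * d + Num.sqrt (2 * d)) & reach_time f g z' t'.
Proof.
move=> bs st au tx t0 xt small d d1 drho C0.
have [y [ty Gy]] := push_through bs au tx t0 xt small d1; rewrite -/d in Gy.
have d0 : 0 <= d by exact: nrm_ge0.
have y1d : `|(y t).1| <= 2 * d.
  by apply: le_trans Gy; rewrite /nrm lerDl.
have y2d : Num.sqrt `|(y t).2| <= Num.sqrt (2 * d).
  by rewrite ler_sqrt ?mulr_ge0 //; apply: le_trans Gy; rewrite /nrm lerDr.
have [t' t'C rt'] := st (y t) ltac:(lra).
exists (t + t'); last exact: (reach_time_concat au ty).
rewrite lerD2l (le_trans t'C) // ler_wpM2l //; lra.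
Qed.

End SmallTime.

(** * Homotopy of a control towards an extremal one *)

Section Push.
Variables (R : realType) (M : nat) (e : 'I_M -> R).
Hypothesis e1 : forall i, e i = 1 \/ e i = -1.
Implicit Types (u : R -> 'I_M -> R).

(** As e_i is 1 or -1 and |u_i| <= 1, each summand equals |e_i - u_i|, written without absolute
    value and hence affine in u. *)
Definition dev u s := \sum_i (1 - e i * u s i).

Lemma dev_term u s i : admissible u -> 0 <= 1 - e i * u s i <= 2.
Proof. by move=> au; have := au.2 s i; case: (e1 i) => ->; lra. Qed.

Lemma dev_ge0 u s : admissible u -> 0 <= dev u s.
Proof. by move=> au; apply: sumr_ge0 => i _; have /andP[] := dev_term s i au. Qed.

Lemma dev_le u s : admissible u -> dev u s <= 2 * M%:R.
Proof.
move=> au; rewrite /dev (le_trans (_ : _ <= \sum_(i < M) 2)) //; last first.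
  by rewrite sumr_const card_ord mulr_natr.
by apply: ler_sum => i _; have /andP[] := dev_term s i au.
Qed.

Lemma dev_norm u s : admissible u -> `|dev u s| <= 2 * M%:R.
Proof. by move=> au; rewrite ger0_norm ?dev_ge0 // dev_le. Qed.

Lemma dev_IG u a b : admissible u -> IG a b (dev u).
Proof.
move=> au; apply: IG_sum => i; apply: IGB; first exact: IG_cst.
by apply: IGZ; exact: admissible_IG.
Qed.

Lemma dev_lip u t : admissible u -> lip_on 0 t (2 * M%:R) (fun s => II 0 s (dev u)).
Proof. by move=> au; apply: II_lip_on; [exact: dev_IG|move=> s _; exact: dev_norm]. Qed.

Lemma IG_II_dev u t : admissible u -> IG 0 t (fun s => II 0 s (dev u)).
Proof. by move=> au; exact: IG_lip (dev_lip (t := t) au). Qed.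

Lemma II_dev_ge0 u s : admissible u -> 0 <= II 0 s (dev u).
Proof. by move=> au; apply: II_ge0 => *; exact: dev_ge0. Qed.

Lemma II_dev_le u s : admissible u -> 0 <= s -> II 0 s (dev u) <= 2 * M%:R * s.
Proof.
move=> au s0; rewrite -[X in _ * X]subr0 -II_cst //; apply: II_le.
- exact: dev_IG.
- exact: IG_cst.
- by move=> *; exact: dev_le.
Qed.

(** The quantity D of the overview. By [II_tail] it is the deviation weighted by the remaining
    time. *)
Definition dev2 u t := II 0 t (fun s => II 0 s (dev u)).

Lemma dev2_ge0 u t : admissible u -> 0 <= dev2 u t.
Proof. by move=> au; apply: II_ge0 => *; exact: II_dev_ge0. Qed.

Lemma dev2_le u t : admissible u -> 0 <= t -> dev2 u t <= 2 * M%:R * t ^+ 2.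
Proof.
move=> au t0; rewrite expr2 mulrA -[X in _ * X]subr0 -II_cst //; apply: II_le.
- exact: IG_II_dev.
- exact: IG_cst.
- move=> s /andP[s0 st]; apply: le_trans (II_dev_le au s0) _.
  by rewrite ler_wpM2l // mulr_ge0.
Qed.

(* The deviation grows at rate at most 2M, so it is at least half its final value
   on a final time interval of length proportional to that value. *)
Lemma sqr_dev_le u t : admissible u -> 0 <= t -> (0 < M)%N ->
  II 0 t (dev u) ^+ 2 <= 8 * M%:R * dev2 u t.
Proof.
move=> au t0 M0.
have M0' : 0 < M%:R :> R by rewrite ltr0n.
set Q := II 0 t (dev u).
have Q0 : 0 <= Q by exact: II_dev_ge0.
have Qt : Q <= 2 * M%:R * t by exact: II_dev_le.
pose h := Q / (4 * M%:R).
have hE : 4 * M%:R * h = Q by rewrite /h; field; rewrite gt_eqF.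
have h0 : 0 <= h by rewrite divr_ge0 // mulr_ge0 // ltW.
have ht : h <= t.
  by rewrite -(ler_pM2l (_ : 0 < 4 * M%:R)) ?mulr_gt0 // hE; have := mulr_ge0 (ltW M0') t0; lra.
have th0 : 0 <= t - h by lra.
have tht : t - h <= t by lra.
rewrite /dev2 (II_chasles th0 tht (IG_II_dev _ au)).
have P0 : 0 <= II 0 (t - h) (fun s => II 0 s (dev u)) by apply: II_ge0 => *; exact: II_dev_ge0.
have P1 : Q / 2 * h <= II (t - h) t (fun s => II 0 s (dev u)).
  have hh : t - (t - h) = h by ring.
  rewrite -[X in Q / 2 * X <= _]hh -II_cst //; apply: II_le; first exact: IG_cst.
    by apply: (IGS (a := 0) (b := t)) (IG_II_dev _ au).
  move=> s /andP[s1 s2].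
  have := dev_lip (t := t) au; move=> /(_ t s).
  rewrite t0 lexx => /(_ isT); rewrite s2 andbT => /(_ ltac:(lra)); rewrite -/Q => H.
  have {}H := le_trans (ler_norm _) H; rewrite ger0_norm in H; last lra.
  have : 2 * M%:R * (t - s) <= 2 * M%:R * h by rewrite ler_wpM2l ?mulr_ge0 ?(ltW M0') //; lra.
  by lra.
have : 8 * M%:R * (Q / 2 * h) <= 8 * M%:R * II (t - h) t (fun s => II 0 s (dev u)).
  by rewrite ler_wpM2l // mulr_ge0 // ltW.
have -> : 8 * M%:R * (Q / 2 * h) = Q ^+ 2.
  by transitivity (4 * M%:R * h * Q); [field|rewrite hE expr2].
have : 0 <= 8 * M%:R * II 0 (t - h) (fun s => II 0 s (dev u)).
  by rewrite mulr_ge0 // mulr_ge0 // ltW.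
by rewrite mulrDr; lra.
Qed.

Definition push_ctrl u (l : R) s i := u s i + l * (e i - u s i).

Lemma push_ctrl0 u : push_ctrl u 0 = u.
Proof. by apply/funext => s; apply/funext => i; rewrite /push_ctrl mul0r addr0. Qed.

Lemma push_admissible u l : admissible u -> 0 <= l <= 1 -> admissible (push_ctrl u l).
Proof.
move=> au /andP[l0 l1]; split=> [i|s i].
  apply: measurable_funD; first exact: au.1.
  apply: measurable_funM => //; apply: measurable_funB => //; exact: au.1.
have := au.2 s i; rewrite /push_ctrl; case: (e1 i) => -> /andP[a b].
  have h1 : l * (1 - u s i) <= 1 - u s i by rewrite ler_piMl //; lra.
  have h2 : 0 <= l * (1 - u s i) by rewrite mulr_ge0 //; lra.
  by lra.
have h1 : l * (1 + u s i) <= 1 + u s i by rewrite ler_piMl //; lra.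
have h2 : 0 <= l * (1 + u s i) by rewrite mulr_ge0 //; lra.
by lra.
Qed.

Lemma gap_push u l l' s : admissible u ->
  ctrl_gap (push_ctrl u l) (push_ctrl u l') s = `|l' - l| * dev u s.
Proof.
move=> au; rewrite /ctrl_gap /dev mulr_sumr; apply: eq_bigr => i _.
have -> : push_ctrl u l' s i - push_ctrl u l s i = (l' - l) * (e i - u s i).
  by rewrite /push_ctrl; ring.
rewrite normrM; congr (_ * _).
have := au.2 s i; case: (e1 i) => -> /andP[a b]; first by rewrite ger0_norm; lra.
by rewrite ler0_norm; lra.
Qed.

(** The sign condition on e makes all terms of the push point the same way, so inputs do not cancel
    and the smallest |ka i| controls the sum. *)
Lemma push_push u l (ka : 'I_M -> R) (k0 sg : R) s : admissible u -> 0 <= l ->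
  (forall i, sg * ka i * e i = `|ka i|) -> (forall i, k0 <= `|ka i|) ->
  l * (k0 * dev u s) <= sg * ctrl_push ka u (push_ctrl u l) s.
Proof.
move=> au l0 ske kk; rewrite /ctrl_push /dev !mulr_sumr; apply: ler_sum => i _.
have -> : sg * (ka i * (push_ctrl u l s i - u s i)) = l * ((sg * ka i * e i) * (1 - e i * u s i)).
  have e2 : e i * e i = 1 by case: (e1 i) => ->; ring.
  rewrite /push_ctrl; transitivity (l * (sg * ka i * (e i - (e i * e i) * u s i))); last by ring.
  by rewrite e2; ring.
rewrite ske ler_wpM2l // ler_wpM2r //.
by have /andP[] := dev_term s i au.
Qed.

End Push.

Section Perturbation.
Variable R : realType.

(** Cost and gain of pushing the control by a fraction l. Since nrm (Y 0 s) <= 4 La (t - s) + 2 d,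
    the error of [compare_snd_final] has a part of order t l D, obtained through [II_tail], and a
    part of order d^2 l Q, at most d l D because d <= D and Q <= 1. The total 260 La^3 t l D is at
    most half of the gain k0 l D, whence the constant 520. *)
Lemma push_effect (M : nat) (La k0 sg t : R) (ka e : 'I_M -> R) (f : R * R -> R * R)
    (g : 'I_M -> R * R -> R * R) (z z' : R * R) u x (Y : R -> R -> R * R) (l l' : R) :
  planar_sys La ka f g -> (forall i, e i = 1 \/ e i = -1) ->
  (forall i, sg * ka i * e i = `|ka i|) -> (forall i, k0 <= `|ka i|) ->
  k0 <= 1 -> `|sg| = 1 -> 0 <= t -> 520 * La ^+ 3 * t <= k0 -> 2 * M%:R * t <= 1 ->
  admissible u -> sol (field f g u) z x t -> x t = 0 -> nrm (z' - z) <= dev2 e u t ->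
  (forall l, 0 <= l <= 1 -> sol (field f g (push_ctrl e u l)) z' (Y l) t /\
     forall s, 0 <= s <= t -> nrm (Y l s) <= 1) ->
  0 <= l <= 1 -> 0 <= l' <= 1 ->
  nrm (Y l' t - Y l t) <= 8 * La * `|l' - l| * II 0 t (dev e u) /\
  l * (k0 / 2 * dev2 e u t) <= sg * ((Y l t).2 - (Y 0 t).2).
Proof.
move=> ps e1 ske kk k01 sg1 t0 small Mt au tx xt dD HY lI l'I.
have bs := ps_basic ps; have L1 := bs_ge1 bs.
have L0 : 0 <= La by lra.
pose m := La ^+ 3 * t; have mE : m = La ^+ 3 * t by [].
have m1 : 520 * m <= k0 by rewrite mE mulrA.
clearbody m.
have tm : t <= m by rewrite mE ler_peMl // exprn_ege1.
have Ltm : La * t <= m by rewrite mE ler_wpM2r // -{1}[La]expr1 ler_weXn2l.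
have L2tm : La ^+ 2 * t <= m by rewrite mE ler_wpM2r // ler_weXn2l.
have Lt4 : 4 * La * t <= 1 by clear -Ltm m1 k01; lra.
have au_ a : 0 <= a <= 1 -> admissible (push_ctrl e u a) by move=> aI; exact: push_admissible.
have I00 : (0 : R) <= (0 : R) <= (1 : R) by rewrite lexx ler01.
set D := dev2 e u t; set d := nrm (z' - z) in dD *.
have D0 : 0 <= D by exact: dev2_ge0.
have d0 : 0 <= d by exact: nrm_ge0.
have Q0 := II_dev_ge0 e1 t au; have Qt := II_dev_le e1 au t0.
set Q := II 0 t (dev e u) in Q0 Qt *.
have dt : d <= t.
  apply: le_trans dD _; apply: le_trans (dev2_le e1 au t0) _.
  by rewrite expr2 mulrA ler_piMl.
split.
  have H := compare_nrm ps t0 Lt4 (lexx 1) (au_ _ lI) (au_ _ l'I)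
    (HY _ lI).1 (HY _ l'I).1 (HY _ lI).2 (HY _ l'I).2 (_ : 0 <= t <= t).
  apply: le_trans (H _) _; first by rewrite t0 lexx.
  rewrite (IIE (g := fun s => `|l' - l| * dev e u s)); last by move=> s _; exact: gap_push.
  by rewrite IIZ ?mulrA //; exact: dev_IG.
have small4 : 4 * La * t < 1 by clear -Ltm m1 k01 tm t0; lra.
have xb := steering_bound bs au tx t0 xt small4.
have gd := basic_good bs au.
have z0 : x 0 = z by exact: (sol0 t0 tx).
have tI : 0 <= t <= t by rewrite t0 lexx.
have nz : nrm z <= 4 * La * t.
  by have [_] := xb 0 ltac:(by rewrite lexx t0); rewrite z0 subr0.
have nz' : nrm z' <= 4 * La * t + d by have := nrmD (z' - z) z; rewrite subrK -/d; clear -nz; lra.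
have E0 : push_ctrl e u 0 = u by exact: push_ctrl0.
have [TY0 Y01] := HY 0 I00; rewrite E0 in TY0.
have [TYl Yl1] := HY l lI.
have Y0b s : 0 <= s <= t -> nrm (Y 0 s) <= 4 * La * (t - s) + 2 * d.
  move=> sI; have /andP[s0 st] := sI.
  have Ls : 4 * La * s <= 1.
    by apply: le_trans Lt4; rewrite ler_wpM2l // mulr_ge0.
  have G : nrm (Y 0 s - x s) <= 2 * (nrm (z' - z) + 2 * II 0 s (fun=> 0)).
    apply: (gronwall gd s0 Ls (solW st TY0) (solW st tx)).
    - by move=> a /andP[a0 as_]; apply: Y01; rewrite a0 (le_trans as_).
    - by move=> a /andP[a0 as_]; apply: (xb a _).1; rewrite a0 (le_trans as_).
    - exact: IG_cst.
    - by move=> *; rewrite subrr normr0.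
  rewrite II_cst // mul0r mulr0 addr0 in G.
  have [_ xs] := xb s sI.
  by have := nrmD (Y 0 s - x s) (x s); rewrite subrK; clear -G xs; rewrite /d; lra.
pose r := 10 * La * t; have rE : r = 10 * La * t by [].
clearbody r.
have r1 : r <= 1 by rewrite rE; clear -Ltm m1 k01; lra.
have tLt : t <= La * t by rewrite ler_peMl.
have Y0r s : 0 <= s <= t -> nrm (Y 0 s) <= r.
  move=> sI; apply: le_trans (Y0b s sI) _; have /andP[s0 st] := sI.
  have : La * (t - s) <= La * t by rewrite ler_wpM2l // gerBl.
  have : 0 <= La * t by rewrite mulr_ge0.
  by rewrite rE; clear -dt tLt; lra.
have Ylr s : 0 <= s <= t -> nrm (Y l s) <= r.
  move=> sI; have /andP[s0 st] := sI.
  have := sol_forward_bound (basic_good bs (au_ _ lI)) TYl Yl1 sI.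
  have := nrmD (Y l s - z') z'; rewrite subrK.
  have : La * s <= La * t by rewrite ler_wpM2l.
  have : 0 <= La * t by rewrite mulr_ge0.
  by rewrite rE; clear -dt tLt nz'; lra.
have aul := au_ _ lI.
have l0 : 0 <= l by case/andP: lI.
have gapE s : ctrl_gap u (push_ctrl e u l) s = l * dev e u s.
  by rewrite -{1}E0 gap_push // subr0 ger0_norm.
(* Majorant of (4 La (t - s) + 2 d)^2 by twice the sum of squares, with one factor t - s replaced by
   t to make it affine in s. *)
pose xi s := 32 * La ^+ 2 * t * (t - s) + 8 * d ^+ 2.
have Idev := dev_IG e 0 t au.
have Itail : IG 0 t (fun s => (t - s) * dev e u s).
  apply: (@IG_bm _ _ _ _ (t * (2 * M%:R))).
    by apply: measurable_funM; [exact: measurable_funB|exact: IG_measurable Idev].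
  move=> s /andP[s0 st]; rewrite normrM ler_pM //; last exact: dev_norm.
  by rewrite ger0_norm ?subr_ge0 // gerBl.
have Exi s : xi s * ctrl_gap u (push_ctrl e u l) s =
   (32 * La ^+ 2 * t * l) * ((t - s) * dev e u s) + (8 * d ^+ 2 * l) * dev e u s.
  by rewrite gapE /xi; ring.
have Ixi : IG 0 t (fun s => xi s * ctrl_gap u (push_ctrl e u l) s).
  apply: eq_integrable (IGD (IGZ (32 * La ^+ 2 * t * l) Itail) (IGZ (8 * d ^+ 2 * l) Idev)) => // s _.
  by rewrite /= Exi.
have IIxi : II 0 t (fun s => xi s * ctrl_gap u (push_ctrl e u l) s) =
   32 * La ^+ 2 * t * l * D + 8 * d ^+ 2 * l * Q.
  rewrite (IIE (fun s _ => Exi s)) IID ?IIZ //; [|exact: IGZ|exact: IGZ].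
  by rewrite (II_tail t0 Idev (B := 2 * M%:R)) // => s _; exact: dev_norm.
have Hxi s : 0 <= s <= t -> nrm (Y 0 s) ^+ 2 <= xi s.
  move=> sI; have /andP[s0 st] := sI.
  have a0 : 0 <= 4 * La * (t - s) by rewrite !mulr_ge0 // subr_ge0.
  apply: le_trans (_ : (4 * La * (t - s) + 2 * d) ^+ 2 <= _).
    by rewrite ler_sqr ?nnegrE ?nrm_ge0 ?Y0b // addr_ge0 // mulr_ge0.
  have : (4 * La * (t - s) + 2 * d) ^+ 2 <= 2 * (4 * La * (t - s)) ^+ 2 + 2 * (2 * d) ^+ 2.
    have := sqr_ge0 (4 * La * (t - s) - 2 * d); rewrite sqrrB sqrrD; clear; lra.
  have : La ^+ 2 * (t - s) * (t - s) <= La ^+ 2 * (t - s) * t.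
    by rewrite ler_wpM2l ?gerBl // mulr_ge0 ?sqr_ge0 // subr_ge0.
  by rewrite /xi !exprMn; clear; lra.
have C2 := compare_snd_final ps t0 Lt4 r1 au aul TY0 TYl Y0r Ylr Hxi Ixi.
rewrite IIxi in C2.
have EP : II 0 t (fun s => II 0 s (ctrl_gap u (push_ctrl e u l))) = l * D.
  rewrite /D /dev2 -IIZ; last exact: IG_II_dev.
  apply: IIE => s /andP[s0 st]; rewrite -IIZ; last exact: dev_IG.
  by apply: IIE.
rewrite EP in C2.
have lD0 : 0 <= l * D by rewrite mulr_ge0.
have EB : (40 * La ^+ 3 * t + 18 * La ^+ 2 * r) * (l * D) + La * (32 * La ^+ 2 * t * l * D + 8 * d ^+ 2 * l * Q)
   <= 260 * m * (l * D).
  have -> : (40 * La ^+ 3 * t + 18 * La ^+ 2 * r) * (l * D) + La * (32 * La ^+ 2 * t * l * D + 8 * d ^+ 2 * l * Q)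
    = 252 * m * (l * D) + 8 * (La * (d * (d * Q)) * l) by rewrite rE mE; ring.
  have Q1 : Q <= 1 by exact: le_trans Qt Mt.
  have h1 : d * Q <= D.
    apply: le_trans (_ : d * 1 <= _); first by rewrite ler_wpM2l.
    by rewrite mulr1.
  have h2 : La * (d * (d * Q)) * l <= m * (l * D).
    have -> : m * (l * D) = m * D * l by ring.
    rewrite ler_wpM2r // mulrA ler_pM ?mulr_ge0 //.
    by apply: le_trans Ltm; rewrite ler_wpM2l.
  by clear -h2; lra.
have m2 : 260 * m * (l * D) <= k0 / 2 * (l * D) by rewrite ler_wpM2r //; clear -m1; lra.
have PQ : l * (k0 * D) <= sg * II 0 t (fun s => II 0 s (ctrl_push ka u (push_ctrl e u l))).
  have Ipush a b : IG a b (ctrl_push ka u (push_ctrl e u l)) by exact: push_IG.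
  have IIpush : IG 0 t (fun s => II 0 s (ctrl_push ka u (push_ctrl e u l))).
    apply: (@IG_lip _ _ _ (La * (2 * M%:R))); apply: II_lip_on => // s _.
    apply: le_trans (push_le ps u _ s) _; rewrite ler_wpM2l //.
    by apply: le_trans (ler_norm _) (gap_bound au aul s).
  rewrite -IIZ // /D /dev2 mulrA -IIZ; last exact: IG_II_dev.
  apply: II_le.
  - by apply: IGZ; exact: IG_II_dev.
  - exact: IGZ.
  move=> s /andP[s0 st]; rewrite -!IIZ //; last exact: dev_IG.
  apply: II_le; [by apply: IGZ; exact: dev_IG|exact: IGZ|].
  by move=> a _; rewrite -mulrA; apply: push_push.
have {}C2 := le_trans C2 (le_trans EB m2).
set w := II 0 t _ in C2 PQ.
have : `|sg * ((Y l t - Y 0 t).2 - w)| <= k0 / 2 * (l * D) by rewrite normrM sg1 mul1r.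
rewrite ler_norml => /andP[+ _]; rewrite -[(Y l t - Y 0 t).2]/((Y l t).2 - (Y 0 t).2).
clear -PQ; set a := (Y l t).2 - _; move: PQ; rewrite mulrBr; lra.
Qed.

End Perturbation.

Section PerturbedReach.
Variable R : realType.

(** The vertex of the box that maximises sg * sum ka_i w_i: the control e or -e of the overview. *)
Definition sgn_ctrl (M : nat) (ka : 'I_M -> R) (sg : R) : 'I_M -> R :=
  fun i => sg * Num.sg (ka i).

Lemma sgn_ctrl1 (M : nat) (ka : 'I_M -> R) (sg : R) : sg = 1 \/ sg = -1 ->
  (forall i, ka i != 0) -> forall i, sgn_ctrl ka sg i = 1 \/ sgn_ctrl ka sg i = -1.
Proof.
move=> s1 k1 i; rewrite /sgn_ctrl; have := k1 i; rewrite neq_lt => /orP[h|h].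
  by rewrite ltr0_sg //; case: s1 => ->; [right|left]; ring.
by rewrite gtr0_sg //; case: s1 => ->; [left|right]; ring.
Qed.

Lemma sgn_ctrl_norm (M : nat) (ka : 'I_M -> R) (sg : R) i : sg = 1 \/ sg = -1 ->
  sg * ka i * sgn_ctrl ka sg i = `|ka i|.
Proof.
move=> s1; rewrite /sgn_ctrl.
have s2 : sg * sg = 1 by case: s1 => ->; ring.
by transitivity (sg * sg * (ka i * Num.sg (ka i))); [ring|rewrite s2 mul1r mulrC -normrEsg].
Qed.

(** The gain in [push_effect] and the intermediate value theorem give a fraction l at which the
    b-coordinate vanishes exactly; [small_time] then sees only the a-coordinate, and its square root
    term disappears. Bounds for both vertices are assumed because the sign of the miss is not known
    in advance. *)
Lemma perturbed_reach (M : nat) (La k0 C rho0 t Dm : R) (ka : 'I_M -> R) (f : R * R -> R * R)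
    (g : 'I_M -> R * R -> R * R) (z z' : R * R) u x :
  planar_sys La ka f g -> (0 < M)%N -> 0 < k0 -> (forall i, k0 <= `|ka i|) -> k0 <= 1 ->
  small_time f g C rho0 -> 0 <= C ->
  0 <= t -> 520 * La ^+ 3 * t <= k0 -> 2 * M%:R * t <= 1 ->
  t + 128 * La * M%:R ^+ 2 * t <= rho0 ->
  admissible u -> sol (field f g u) z x t -> x t = 0 ->
  0 < Dm -> Dm <= dev2 (sgn_ctrl ka 1) u t -> Dm <= dev2 (sgn_ctrl ka (-1)) u t ->
  let d := nrm (z' - z) in d <= k0 * Dm / 4 ->
  exists2 t', t' <= t + C * (2 * d + 256 * La * M%:R / k0 * d / Num.sqrt Dm) &
    reach_time f g z' t'.
Proof.
move=> ps M0 k0p kk k01 st C0 t0 small Mt rhot au tx xt Dm0 Dp Dn d dk.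
have bs := ps_basic ps; have L1 := bs_ge1 bs.
have L0 : 0 <= La by lra.
have ka0 i : ka i != 0 by rewrite -normr_gt0 (lt_le_trans k0p).
have Mge1 : 1 <= M%:R :> R by rewrite ler1n.
have M0' : 0 < M%:R :> R by rewrite ltr0n.
have d0 : 0 <= d by exact: nrm_ge0.
have kDm : k0 * Dm <= Dm by rewrite ler_piMl // ltW.
have Ltk : 520 * (La * t) <= k0.
  have L3 : La <= La ^+ 3 by rewrite -{1}[La]expr1 ler_weXn2l.
  by have L3t := ler_wpM2r t0 L3; clear -small L3t; lra.
have tLt : t <= La * t by rewrite ler_peMl.
have Lt0 : 0 <= La * t by rewrite mulr_ge0.
pose SD := Num.sqrt Dm.
have SD0 : 0 < SD by rewrite sqrtr_gt0.
have SD2 : SD ^+ 2 = Dm by rewrite sqr_sqrtr // ltW.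
have Dt : Dm <= 2 * M%:R * t ^+ 2.
  by apply: le_trans Dp _; apply: dev2_le => //; exact: (sgn_ctrl1 (or_introl erefl) ka0).
have Dmt : Dm <= t by apply: le_trans Dt _; rewrite expr2 mulrA ler_piMl.
have SDt : SD <= 2 * M%:R * t.
  rewrite -(@ler_sqr _ SD) ?nnegrE ?(ltW SD0) ?mulr_ge0 ?(ltW M0') // SD2 (le_trans Dt) //.
  rewrite exprMn ler_wpM2r ?sqr_ge0 // expr2 ler_peMl ?mulr_ge0 ?(ltW M0') //.
  by clear -Mge1; lra.
have dDm : d <= Dm by clear -dk kDm Dm0; lra.
have small4 : 4 * La * t < 1 by clear -Ltk k01 Lt0; lra.
have gd := basic_good bs au.
have xb := steering_bound bs au tx t0 xt small4.
have z0 : x 0 = z by exact: (sol0 t0 tx).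
have nz : nrm z <= 4 * La * t.
  by have [_] := xb 0 ltac:(by rewrite lexx t0); rewrite z0 subr0.
have nz' : nrm z' <= 4 * La * t + d by have := nrmD (z' - z) z; rewrite subrK -/d; clear -nz; lra.
have nz'1 : nrm z' + 4 * La * t <= 1 by clear -nz' dDm Dmt tLt Ltk k01 Lt0; lra.
suff H (sg : R) (Y : R -> R -> R * R) : sg = 1 \/ sg = -1 ->
    (forall l, 0 <= l <= 1 -> sol (field f g (push_ctrl (sgn_ctrl ka sg) u l)) z' (Y l) t /\
     forall s, 0 <= s <= t -> nrm (Y l s) <= 1) ->
    Dm <= dev2 (sgn_ctrl ka sg) u t -> sg * (Y 0 t).2 <= 0 ->
    exists2 t', t' <= t + C * (2 * d + 256 * La * M%:R / k0 * d / SD) & reach_time f g z' t'.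
  have [y [ty y1]] := picard gd t0 nz'1.
  (* Both families start at the same path y, because the sign of (y t).2 decides which vertex is
     used. *)
  have HY sg : sg = 1 \/ sg = -1 -> exists Y : R -> R -> R * R, (forall l, 0 <= l <= 1 ->
     sol (field f g (push_ctrl (sgn_ctrl ka sg) u l)) z' (Y l) t /\
     forall s, 0 <= s <= t -> nrm (Y l s) <= 1) /\ Y 0 = y.
    move=> s1.
    have ex (l : R) : exists yl, 0 <= l <= 1 ->
        (sol (field f g (push_ctrl (sgn_ctrl ka sg) u l)) z' yl t /\
         forall s, 0 <= s <= t -> nrm (yl s) <= 1).
      have [lI|] := boolP (0 <= l <= 1); last by exists y.
      have gl := basic_good bs (push_admissible (sgn_ctrl1 s1 ka0) au lI).
      by have [yl Hl] := picard gl t0 nz'1; exists yl.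
    exists (fun l => if l == 0 then y else sval (cid (ex l))); split; last by rewrite eqxx.
    move=> l lI; case: eqP => [->|_]; first by rewrite push_ctrl0.
    by case: cid => yl /= /(_ lI).
  have [b0|b0] := leP (y t).2 0.
    have [Y [HY1 Y0]] := HY 1 (or_introl erefl).
    by apply: (H 1 Y) => //; [left|rewrite Y0 mul1r].
  have [Y [HY1 Y0]] := HY (-1) (or_intror erefl).
  by apply: (H (-1) Y) => //; [right|rewrite Y0 mulN1r oppr_le0 ltW].
move=> s1 HY DD sgb.
have e1 := sgn_ctrl1 s1 ka0.
set e := sgn_ctrl ka sg in HY DD e1.
have ske i : sg * ka i * e i = `|ka i| by exact: sgn_ctrl_norm.
have nsg : `|sg| = 1 by case: s1 => ->; rewrite ?normrN normr1.
set D := dev2 e u t in DD.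
have D0 : 0 < D by exact: lt_le_trans DD.
have PE l l' := push_effect ps e1 ske kk k01 nsg t0 small Mt au tx xt (le_trans dDm DD) HY (l := l) (l' := l').
have I00 : (0 : R) <= (0 : R) <= (1 : R) by rewrite lexx ler01.
have [TY0 Y01] := HY 0 I00; rewrite push_ctrl0 in TY0.
have Y0d : nrm (Y 0 t) <= 2 * d.
  have := gronwall gd t0 (ltW small4) TY0 tx Y01 (fun s st => (xb s st).1) (IG_cst _ _ 0).
  rewrite xt subr0 II_cst // mul0r mulr0 addr0; apply.
  by move=> *; rewrite subrr normr0.
set Q := II 0 t (dev e u).
have Q0 : 0 <= Q by exact: II_dev_ge0.
have QD : Q <= 8 * M%:R * Num.sqrt D.
  rewrite -(@ler_sqr _ Q) ?nnegrE ?mulr_ge0 ?sqrtr_ge0 ?(ltW M0') // exprMn sqr_sqrtr ?(ltW D0) //.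
  apply: le_trans (sqr_dev_le e1 au t0 M0) _; rewrite ler_wpM2r ?(ltW D0) //.
  by rewrite expr2 ler_peMl ?mulr_ge0 ?(ltW M0') //; clear -Mge1; lra.
(* With this fraction the guaranteed gain l1 k0 D / 2 equals 2 d, the largest possible miss. *)
pose l1 := 4 * d / (k0 * D).
have kD0 : 0 < k0 * D by rewrite mulr_gt0.
have l1E : l1 * (k0 * D) = 4 * d by rewrite /l1 divfK // gt_eqF.
have l10 : 0 <= l1 by exact: (divr_ge0 (mulr_ge0 (ler0n R 4) d0) (ltW kD0)).
have l11 : l1 <= 1.
  rewrite /l1 ler_pdivrMr // mul1r.
  have : k0 * Dm <= k0 * D by rewrite ler_pM2l.
  by clear -dk; lra.
have l1I : 0 <= l1 <= 1 by rewrite l10 l11.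
pose phi l := sg * (Y l t).2.
have phi0 : phi 0 <= 0 by [].
have phi0' : - (2 * d) <= phi 0.
  have : `|phi 0| <= 2 * d.
    by rewrite /phi normrM nsg mul1r; apply: le_trans Y0d; rewrite /nrm lerDr.
  by rewrite ler_norml => /andP[].
have phil1 : 0 <= phi l1.
  have [_] := PE l1 l1 l1I l1I; rewrite mulrBr -/(phi l1) -/(phi 0) -/D.
  have -> : l1 * (k0 / 2 * D) = 2 * d by transitivity (l1 * (k0 * D) / 2); [field|rewrite l1E; field].
  by clear -phi0'; lra.
have cphi : {within `[0, l1], continuous phi}.
  apply: (@lip_on_continuous _ _ _ (8 * La * Q)) => a b /andP[a0 al] /andP[b0 bl].
  rewrite /phi -mulrBr normrM nsg mul1r.
  have [+ _] := PE b a ltac:(by rewrite b0 (le_trans bl)) ltac:(by rewrite a0 (le_trans al)).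
  rewrite mulrAC; apply: le_trans.
  by rewrite -[(Y a t).2 - _]/((Y a t - Y b t).2) /nrm lerDr.
have [l] : exists2 l, l \in `[0, l1]%R & phi l = 0.
  apply: IVT => //; apply/andP; split; first by rewrite ge_min phi0.
  by rewrite le_max phil1 orbT.
rewrite in_itv /= => /andP[l0 ll1] phil.
have lI : 0 <= l <= 1 by rewrite l0 (le_trans ll1).
have Yl2 : (Y l t).2 = 0.
  by apply/eqP; rewrite -normr_eq0 -[X in X == _]mul1r -nsg -normrM -/(phi l) phil normr0.
have lQ : l * Q <= 32 * M%:R * d / k0 / SD.
  apply: le_trans (_ : l1 * (8 * M%:R * Num.sqrt D) <= _); first by rewrite ler_pM.
  have -> : l1 * (8 * M%:R * Num.sqrt D) = 32 * M%:R * d / k0 / Num.sqrt D.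
    rewrite /l1 -{1}(@sqr_sqrtr _ D) ?(ltW D0) //; field.
    by rewrite gt_eqF ?sqrtr_gt0 //= gt_eqF.
  rewrite ler_wpM2l ?divr_ge0 ?mulr_ge0 ?(ltW M0') ?(ltW k0p) //.
  have sD0 : 0 < Num.sqrt D by rewrite sqrtr_gt0; exact: D0.
  by rewrite (lef_pV2 sD0 SD0) (ler_sqrt _ (ltW D0)); exact: DD.
have Yl1 : `|(Y l t).1| <= 2 * d + 256 * La * M%:R / k0 * d / SD.
  have [+ _] := PE 0 l I00 lI; rewrite subr0 ger0_norm // -/Q.
  have -> : 8 * La * l * Q = 8 * La * (l * Q) by rewrite !mulrA.
  have h : 8 * La * (l * Q) <= 8 * La * (32 * M%:R * d / k0 / SD).
    by rewrite ler_wpM2l // mulr_ge0.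
  have -> : 256 * La * M%:R / k0 * d / SD = 8 * La * (32 * M%:R * d / k0 / SD).
    by field; rewrite !gt_eqF.
  have n1 : `|(Y l t).1| <= nrm (Y l t) by rewrite /nrm lerDl.
  by have := nrmD (Y l t - Y 0 t) (Y 0 t); rewrite subrK; clear -n1 Y0d h; lra.
have small1 : 2 * d + 256 * La * M%:R / k0 * d / SD <= rho0.
  apply: le_trans rhot.
  have h1 : 256 * La * M%:R / k0 * d / SD <= 64 * La * M%:R * SD.
    rewrite ler_pdivrMr //.
    have -> : 64 * La * M%:R * SD * SD = 256 * La * M%:R / k0 * (k0 * Dm / 4).
      by rewrite -SD2; field; rewrite gt_eqF.
    have k0V : 0 <= k0^-1 by rewrite invr_ge0; exact: ltW k0p.
    exact: (ler_wpM2l (mulr_ge0 (mulr_ge0 (mulr_ge0 (ler0n R 256) L0) (ltW M0')) k0V) dk).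
  have h2 : 64 * La * M%:R * SD <= 64 * La * M%:R * (2 * M%:R * t).
    by rewrite ler_wpM2l // !mulr_ge0 ?(ltW M0').
  have h3 : 64 * La * M%:R * (2 * M%:R * t) = 128 * La * M%:R ^+ 2 * t by ring.
  have h4 : 2 * d <= t by clear -dk kDm Dmt Dm0; lra.
  by clear -h1 h2 h3 h4; lra.
have E2 : `|(Y l t).1| + Num.sqrt `|(Y l t).2| = `|(Y l t).1| by rewrite Yl2 normr0 sqrtr0 addr0.
have [t' t'C rt'] := st (Y l t) ltac:(by rewrite E2 (le_trans Yl1)).
rewrite E2 in t'C.
exists (t + t').
  by rewrite lerD2l (le_trans t'C) // ler_wpM2l.
exact: (reach_time_concat (push_admissible e1 au lI) (HY l lI).1 t0).
Qed.

End PerturbedReach.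

(** * The two abnormal curves *)

Section AbnormalCurve.
Variable R : realType.

Lemma quad_increment_itv (phi H : R -> R) (C a b : R) : a <= b ->
  (forall s1 s2, a <= s1 -> s1 <= s2 -> s2 <= b ->
     phi s2 - phi s1 <= H s2 - H s1 + C * (s2 - s1) ^+ 2) ->
  phi b - phi a <= H b - H a.
Proof.
move=> ab Hq.
have ba0 : 0 <= b - a by lra.
have := @quad_increment R (fun s => phi (a + s)) (fun s => H (a + s)) C (b - a) ba0.
have -> : a + (b - a) = b by ring.
rewrite !addr0; apply=> s1 s2 h1 h2 h3.
have -> : s2 - s1 = (a + s2) - (a + s1) by ring.
by apply: Hq; lra.
Qed.

Lemma good_field_opp La h : good_field La h ->
  good_field (R := R) La (fun k r z => - h k r z).
Proof.
move=> [L1 mh lh h0]; split => //.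
- by move=> k x t lx x1; apply: measurableT_comp => //; exact: mh.
- by move=> k r z z' z1 z1'; rewrite -opprD normrN; exact: lh.
- by move=> k r; rewrite normrN.
Qed.

(** The expansion also holds backwards, for s2 < s1, because the velocity may be frozen at either
    end of the interval; [core] allows any frozen point c. *)
Lemma autonomous_taylor (La : R) (W : 'I_2 -> R * R -> R) (z : R * R) x t :
  good_field La (fun k _ z => W k z) -> 0 <= t ->
  sol (fun k _ z => W k z) z x t -> (forall s, 0 <= s <= t -> nrm (x s) <= 1) ->
  forall k s1 s2, 0 <= s1 <= t -> 0 <= s2 <= t ->
  nrm (x s2 - x s1) <= 4 * La * `|s2 - s1| /\
  `|vcomp k (x s2) - vcomp k (x s1) - (s2 - s1) * W k (x s1)| <= 4 * La ^+ 2 * (s2 - s1) ^+ 2.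
Proof.
move=> gW t0 sx x1.
have L1 := gf_ge1 gW; have L0 : 0 <= La by lra.
have lip s1 s2 : 0 <= s1 <= t -> 0 <= s2 <= t -> s1 <= s2 -> nrm (x s2 - x s1) <= 4 * La * (s2 - s1).
  move=> /andP[s10 s1t] /andP[s20 s2t] s12.
  rewrite nrmB; apply: (sol_backward_bound gW (solW s2t sx) s10 s12).
  by move=> r rI; apply: x1; lra.
have lip' s1 s2 : 0 <= s1 <= t -> 0 <= s2 <= t -> nrm (x s2 - x s1) <= 4 * La * `|s2 - s1|.
  move=> h1 h2; have [s12|s21] := leP s1 s2.
    by rewrite ger0_norm ?subr_ge0 //; exact: lip.
  by rewrite nrmB distrC ger0_norm ?subr_ge0 ?(ltW s21) //; apply: lip => //; exact: ltW.
move=> k s1 s2 s1I s2I; split; first exact: lip'.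
have core a b c : 0 <= a -> a <= b -> b <= t -> a <= c <= b ->
   `|vcomp k (x b) - vcomp k (x a) - (b - a) * W k (x c)| <= 4 * La ^+ 2 * (b - a) ^+ 2.
  move=> a0 ab bt /andP[ac cb].
  have [I1 ->] := sol_increment sx a0 ab bt k.
  have -> : (b - a) * W k (x c) = II a b (fun=> W k (x c)) by rewrite II_cst // mulrC.
  rewrite -IIB //; last exact: IG_cst.
  rewrite (expr2 (b - a)) mulrA; apply: II_abs_cst => //; first by apply: IGB => //; exact: IG_cst.
  move=> r /andP[ar rb].
  have rI : 0 <= r <= t by rewrite (le_trans a0 ar) (le_trans rb bt).
  have cI : 0 <= c <= t by rewrite (le_trans a0 ac) (le_trans cb bt).
  apply: le_trans (gf_lip gW k 0 (x1 r rI) (x1 c cI)) _.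
  have -> : 4 * La ^+ 2 * (b - a) = La * (4 * La * (b - a)) by ring.
  rewrite ler_wpM2l //; apply: le_trans (lip' _ _ cI rI) _.
  rewrite ler_wpM2l ?mulr_ge0 //.
  by rewrite ler_norml; apply/andP; split; lra.
have /andP[s10 s1t] := s1I; have /andP[s20 s2t] := s2I.
have [s12|s21] := leP s1 s2; first by apply: core => //; rewrite lexx.
have -> : vcomp k (x s2) - vcomp k (x s1) - (s2 - s1) * W k (x s1) =
   - (vcomp k (x s1) - vcomp k (x s2) - (s1 - s2) * W k (x s1)) by ring.
have -> : (s2 - s1) ^+ 2 = (s1 - s2) ^+ 2 by ring.
by rewrite normrN; apply: core => //; rewrite ?lexx ?andbT ltW.
Qed.

Lemma cst_admissible M (w : 'I_M -> R) : box w -> admissible (fun=> w).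
Proof. by move=> bw; split=> [i|t i]; [exact: measurable_cst|exact: bw]. Qed.

(** Negative times come from the reversed field. They are needed because the time change of
    [curve_near] may run in either direction. *)
Lemma abnormal_curve (M : nat) (La T : R) (f : R * R -> R * R) (g : 'I_M -> R * R -> R * R)
    (w : 'I_M -> R) : basic_sys La f g -> box w -> 0 <= T -> 4 * La * T <= 1 ->
  exists X : R -> R * R, [/\ X 0 = 0,
    forall s, `|s| <= T -> nrm (X s) <= 1,
    forall s, `|s| <= T -> nrm (X s) <= 4 * La * `|s| &
    forall k s1 s2, `|s1| <= T -> `|s2| <= T ->
     `|vcomp k (X s2) - vcomp k (X s1) - (s2 - s1) * dyn f g k (X s1) w| <=
       12 * La ^+ 2 * (s2 - s1) ^+ 2].
Proof.
move=> bs bw T0 LT.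
have gW := basic_good bs (cst_admissible bw).
have gW' := good_field_opp gW.
have L1 := gf_ge1 gW; have L0 : 0 <= La by lra.
have small : nrm 0 + 4 * La * T <= 1 by rewrite nrm0 add0r.
have [X1 [S1 B1]] := picard gW T0 small.
have [X2 [S2 B2]] := picard gW' T0 small.
have X10 := sol0 T0 S1; have X20 := sol0 T0 S2.
have T1 := @autonomous_taylor La (fun k z => dyn f g k z w) _ _ _ gW T0 S1 B1.
have T2 := @autonomous_taylor La (fun k z => - dyn f g k z w) _ _ _ gW' T0 S2 B2.
pose X s := if 0 <= s then X1 s else X2 (- s).
have I0 : (0 : R) <= (0 : R) <= T by rewrite lexx T0.
have Xp s : 0 <= s -> X s = X1 s by rewrite /X => ->.
have Xn s : s <= 0 -> X s = X2 (- s).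
  move=> s0; rewrite /X; case: ifP => // s0'.
  have -> : s = 0 by apply/eqP; rewrite eq_le s0 s0'.
  by rewrite oppr0 X10 X20.
have X0 : X 0 = 0 by rewrite Xp.
have Xb s : `|s| <= T -> nrm (X s) <= 1.
  rewrite ler_norml => /andP[h1 h2]; have [s0|s0] := leP 0 s.
    by rewrite Xp //; apply: B1; rewrite s0.
  by rewrite Xn ?(ltW s0) //; apply: B2; lra.
have Xl s : `|s| <= T -> nrm (X s) <= 4 * La * `|s|.
  rewrite ler_norml => /andP[h1 h2]; have [s0|s0] := leP 0 s.
    have [+ _] := T1 ord0 0 s I0 ltac:(lra).
    by rewrite X10 !subr0 Xp.
  have [+ _] := T2 ord0 0 (- s) I0 ltac:(lra).
  by rewrite X20 !subr0 Xn ?(ltW s0) // normrN.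
exists X; split => //.
have pos k s1 s2 : 0 <= s1 <= T -> 0 <= s2 <= T ->
   `|vcomp k (X s2) - vcomp k (X s1) - (s2 - s1) * dyn f g k (X s1) w| <= 4 * La ^+ 2 * (s2 - s1) ^+ 2.
  move=> h1 h2; have [_] := T1 k s1 s2 h1 h2.
  by case/andP: h1 => ? _; case/andP: h2 => ? _; rewrite !Xp.
have neg k s1 s2 : - T <= s1 <= 0 -> - T <= s2 <= 0 ->
   `|vcomp k (X s2) - vcomp k (X s1) - (s2 - s1) * dyn f g k (X s1) w| <= 4 * La ^+ 2 * (s2 - s1) ^+ 2.
  move=> h1 h2; have [_] := T2 k (- s1) (- s2) ltac:(lra) ltac:(lra).
  case/andP: h1 => _ ?; case/andP: h2 => _ ?; rewrite !Xn //.
  have -> : (- s2 - - s1) * - dyn f g k (X2 (- s1)) w = (s2 - s1) * dyn f g k (X2 (- s1)) w by ring.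
  by have -> : (- s2 - - s1) ^+ 2 = (s2 - s1) ^+ 2 by ring.
(* For times of opposite signs the expansion passes through 0; comparing the velocities at 0 and at
   X s1 costs a term in |s1 s2|, which is part of (s2 - s1)^2. *)
have cross k s1 s2 : `|s1| <= T -> `|s2| <= T ->
   `|vcomp k (X 0) - vcomp k (X s1) - (0 - s1) * dyn f g k (X s1) w| <= 4 * La ^+ 2 * (0 - s1) ^+ 2 ->
   `|vcomp k (X s2) - vcomp k (X 0) - (s2 - 0) * dyn f g k (X 0) w| <= 4 * La ^+ 2 * (s2 - 0) ^+ 2 ->
   s1 * s2 <= 0 ->
   `|vcomp k (X s2) - vcomp k (X s1) - (s2 - s1) * dyn f g k (X s1) w| <= 12 * La ^+ 2 * (s2 - s1) ^+ 2.
  move=> s1T s2T h1 h2 s12.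
  have n0 : nrm (X 0) <= 1 by rewrite X0 nrm0.
  have h3 : `|s2 * (dyn f g k (X 0) w - dyn f g k (X s1) w)| <= 4 * La ^+ 2 * `|s1 * s2|.
    rewrite normrM.
    have -> : 4 * La ^+ 2 * `|s1 * s2| = `|s2| * (La * (4 * La * `|s1|)) by rewrite normrM; ring.
    rewrite ler_wpM2l //; apply: le_trans (bs_lip bs k n0 (Xb _ s1T) bw) _.
    by rewrite ler_wpM2l // X0 sub0r nrmN Xl.
  have -> : vcomp k (X s2) - vcomp k (X s1) - (s2 - s1) * dyn f g k (X s1) w =
    (vcomp k (X 0) - vcomp k (X s1) - (0 - s1) * dyn f g k (X s1) w) +
    (vcomp k (X s2) - vcomp k (X 0) - (s2 - 0) * dyn f g k (X 0) w) +
    s2 * (dyn f g k (X 0) w - dyn f g k (X s1) w) by ring.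
  apply: le_trans (ler_normD _ _) _; have := ler_normD (vcomp k (X 0) - vcomp k (X s1) - (0 - s1) * dyn f g k (X s1) w)
     (vcomp k (X s2) - vcomp k (X 0) - (s2 - 0) * dyn f g k (X 0) w).
  have e1 : `|s1 * s2| = - (s1 * s2) by rewrite ler0_norm.
  have e2 : (s2 - s1) ^+ 2 = s1 ^+ 2 + s2 ^+ 2 + 2 * `|s1 * s2| by rewrite e1; ring.
  have := mulr_ge0 (sqr_ge0 La) (sqr_ge0 s1); have := mulr_ge0 (sqr_ge0 La) (sqr_ge0 s2).
  have := mulr_ge0 (sqr_ge0 La) (normr_ge0 (s1 * s2)).
  move: h1 h2 h3; rewrite !(sub0r, subr0) sqrrN e2.
  by clear; lra.
move=> k s1 s2 s1T s2T.
have weak : 4 * La ^+ 2 * (s2 - s1) ^+ 2 <= 12 * La ^+ 2 * (s2 - s1) ^+ 2.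
  by have := mulr_ge0 (sqr_ge0 La) (sqr_ge0 (s2 - s1)); clear; lra.
have /andP[a1 a2] : - T <= s1 <= T by rewrite -ler_norml.
have /andP[b1 b2] : - T <= s2 <= T by rewrite -ler_norml.
have [p1|n1] := leP 0 s1; have [p2|n2] := leP 0 s2.
- by apply: le_trans weak; apply: pos; lra.
- have s12 : s1 * s2 <= 0 by rewrite mulr_ge0_le0 // ltW.
  by apply: cross => //; [apply: pos|apply: neg]; lra.
- have s12 : s1 * s2 <= 0 by rewrite mulr_le0_ge0 // ltW.
  by apply: cross => //; [apply: neg|apply: pos]; lra.
- by apply: le_trans weak; apply: neg; lra.
Qed.

End AbnormalCurve.

Section CurveDistance.
Variables (R : realType) (M : nat).
Implicit Types (ka e : 'I_M -> R) (f : R * R -> R * R) (g : 'I_M -> R * R -> R * R).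

(** When e is one of the two vertices, this is the scalar m for which w and m e produce the same
    velocity at the origin. *)
Definition mean_ctrl ka e (w : 'I_M -> R) := (\sum_i `|ka i| * (e i * w i)) / \sum_i `|ka i|.

Lemma mean_ctrl_defect ka e (w : 'I_M -> R) : (forall i, e i = 1 \/ e i = -1) -> box w ->
  0 < \sum_i `|ka i| ->
  0 <= 1 - mean_ctrl ka e w <= \sum_i (1 - e i * w i) /\ `|mean_ctrl ka e w| <= 1.
Proof.
move=> e1 bw S0; set S := \sum_i `|ka i| in S0 *.
have t1 i : -1 <= e i * w i <= 1 by have := bw i; case: (e1 i) => ->; lra.
have E : (1 - mean_ctrl ka e w) * S = \sum_i `|ka i| * (1 - e i * w i).
  rewrite mulrBl mul1r /mean_ctrl -/S divfK ?gt_eqF // /S -sumrB.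
  by apply: eq_bigr => i _; ring.
have h1 : 0 <= (1 - mean_ctrl ka e w) * S.
  by rewrite E sumr_ge0 // => i _; rewrite mulr_ge0 //; have := t1 i; lra.
have h2 : (1 - mean_ctrl ka e w) * S <= (\sum_i (1 - e i * w i)) * S.
  rewrite E mulr_suml; apply: ler_sum => i _; rewrite mulrC ler_wpM2l //.
    by have := t1 i; lra.
  by rewrite /S (bigD1 i) //= lerDl sumr_ge0.
have h3 : `|mean_ctrl ka e w| <= 1.
  rewrite /mean_ctrl normrM normfV (gtr0_norm S0) ler_pdivrMr // mul1r.
  apply: le_trans (ler_norm_sum _ _ _) _; apply: ler_sum => i _.
  by rewrite normrM normr_id ler_piMr // ler_norml; exact: t1.
split => //; rewrite !(pmulr_lge0 _ S0, ler_pM2r S0) in h1 h2.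
by rewrite h1 h2.
Qed.

(** The errors in [ps_1] and [ps_2] vanish at z = z' = 0. *)
Lemma dyn_at0 (La : R) ka f g (w : 'I_M -> R) : planar_sys La ka f g -> box w ->
  dyn f g ord0 0 w = \sum_i ka i * w i /\ dyn f g (lift ord0 ord0) 0 w = 0.
Proof.
move=> ps bw; have L1 := bs_ge1 (ps_basic ps).
have b0 : box (fun _ : 'I_M => 0 : R) by move=> i; lra.
have n0 : nrm (0 : R * R) <= 1 by rewrite nrm0.
have H1 := ps_1 ps n0 n0 b0 bw; have H2 := ps_2 ps n0 n0 b0 bw.
rewrite (ps_eq0 ps) (subrr (0 : R * R)) nrm0 expr0n /= !mulr0 mul0r addr0 subr0 normr_le0 in H1.
rewrite (ps_eq0 ps) (subrr (0 : R * R)) nrm0 expr0n /= subrr normr0 !mulr0 mul0r !addr0 !subr0 normr_le0 in H2.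
split; last exact/eqP.
move: H1; rewrite subr_eq0 => /eqP ->.
by apply: eq_bigr => i _; rewrite subr0.
Qed.

(* Rescaling time by the mean control matches the drift up to an error proportional to the
   deviation of the control times the distance to the origin, because the drift vanishes there. *)
Lemma time_change_defect (La sg : R) ka e f g (w : 'I_M -> R) k (Y : R * R) :
  planar_sys La ka f g -> (forall i, e i = 1 \/ e i = -1) ->
  (forall i, sg * ka i * e i = `|ka i|) -> `|sg| = 1 -> 0 < \sum_i `|ka i| ->
  box w -> nrm Y <= 1 ->
  `|dyn f g k Y w - mean_ctrl ka e w * dyn f g k Y e| <=
    La * (3 + 2 * M%:R) * nrm Y * \sum_i (1 - e i * w i).
Proof.
move=> ps e1 ske sg1 S0 bw Y1.
have bs := ps_basic ps; have L1 := bs_ge1 bs; have L0 : 0 <= La by lra.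
have be : box e by move=> i; case: (e1 i) => ->; lra.
have [/andP[m0 mv] m1] := mean_ctrl_defect e1 bw S0.
set m := mean_ctrl ka e w in m0 mv m1 *; set v := \sum_i _ in mv *.
have e2 i : e i * e i = 1 by case: (e1 i) => ->; ring.
have s2 : sg * sg = 1.
  by rewrite -expr2 -real_normK ?num_real // sg1 expr1n.
have kae i : ka i * e i = sg * `|ka i| by rewrite -ske !mulrA s2 mul1r.
have kaw i : ka i * w i = sg * (`|ka i| * (e i * w i)).
  by transitivity (ka i * (e i * e i) * w i); [rewrite e2 mulr1|transitivity (ka i * e i * (e i * w i)); [ring|rewrite kae; ring]].
have Z0 : dyn f g k 0 w = m * dyn f g k 0 e.
  have [w0 w1'] := dyn_at0 ps bw; have [e0 e1'] := dyn_at0 ps be.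
  move: k; apply: I2_case; last by rewrite w1' e1' mulr0.
  rewrite w0 e0 (eq_bigr _ (fun i _ => kaw i)) (eq_bigr _ (fun i _ => kae i)) -!mulr_sumr.
  by rewrite /m /mean_ctrl; field; rewrite gt_eqF.
have n0 : nrm (0 : R * R) <= 1 by rewrite nrm0.
have nY := nrm_ge0 Y.
have b0 : box (fun _ : 'I_M => 0 : R) by move=> i; lra.
pose df := vcomp k (f Y) - vcomp k (f 0); pose dg i := vcomp k (g i Y) - vcomp k (g i 0).
have dfb : `|df| <= La * nrm Y.
  by have := bs_lip bs k Y1 n0 b0; rewrite !dyn0 subr0.
have dgb i : `|dg i| <= 2 * La * nrm Y.
  have bi : box (fun j => (j == i)%:R : R) by move=> j /=; case: (j == i) => /=; lra.
  have := bs_lip bs k Y1 n0 bi; rewrite !dynD1 subr0.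
  have -> : vcomp k (f Y) + vcomp k (g i Y) - (vcomp k (f 0) + vcomp k (g i 0)) = df + dg i.
    by rewrite /df /dg; ring.
  by move: dfb; rewrite !ler_norml => /andP[? ?] /andP[? ?]; apply/andP; split; lra.
(* Subtracting the identity at the origin replaces the fields by their increments, of order nrm Y,
   while the coefficients 1 - m and w i - m * e i are of the order of the deviation. *)
have -> : dyn f g k Y w - m * dyn f g k Y e = (1 - m) * df + \sum_i (w i - m * e i) * dg i.
  transitivity (dyn f g k Y w - dyn f g k 0 w - m * (dyn f g k Y e - dyn f g k 0 e)).
    by rewrite Z0; ring.
  rewrite /dyn.
  have -> : \sum_i (w i - m * e i) * dg i = \sum_i w i * vcomp k (g i Y) - \sum_i w i * vcomp k (g i 0)
      - m * (\sum_i e i * vcomp k (g i Y) - \sum_i e i * vcomp k (g i 0)).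
    rewrite -!sumrB mulr_sumr -sumrB; apply: eq_bigr => i _; rewrite /dg; ring.
  by rewrite /df; ring.
have h1 : `|(1 - m) * df| <= v * (La * nrm Y) by rewrite normrM ler_pM // ger0_norm.
have wme i : `|w i - m * e i| <= (1 - e i * w i) + v.
  have -> : w i - m * e i = e i * ((e i * w i - 1) + (1 - m)).
    by transitivity (e i * e i * w i - m * e i); [rewrite e2; ring|ring].
  have ne : `|e i| = 1 by case: (e1 i) => ->; rewrite ?normrN normr1.
  rewrite normrM ne mul1r (le_trans (ler_normD _ _)) //; apply: lerD.
    by rewrite distrC ger0_norm //; have := bw i; case: (e1 i) => ->; lra.
  by rewrite ger0_norm.
have h2 : `|\sum_i (w i - m * e i) * dg i| <= (v + M%:R * v) * (2 * La * nrm Y).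
  apply: le_trans (ler_norm_sum _ _ _) _.
  have -> : v + M%:R * v = \sum_i ((1 - e i * w i) + v).
    by rewrite big_split /= sumr_const card_ord mulr_natl.
  by rewrite mulr_suml; apply: ler_sum => i _; rewrite normrM ler_pM.
apply: le_trans (ler_normD _ _) _; apply: le_trans (lerD h1 h2) _.
by rewrite le_eqVlt; apply/orP; left; apply/eqP; ring.
Qed.

End CurveDistance.

Section CurveNear.
Variable R : realType.

(** x is compared with X along the changed time th, whose speed is the mean control and which
    vanishes at t, where both paths are at 0. Integrated backwards from t, [time_change_defect]
    contributes a multiple of (t - s) dev(s), which [II_tail] turns into [dev2]. *)
Lemma curve_near (M : nat) (La sg t T : R) (ka e : 'I_M -> R) (f : R * R -> R * R)
    (g : 'I_M -> R * R -> R * R) (z : R * R) u x (X : R -> R * R) :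
  planar_sys La ka f g -> (forall i, e i = 1 \/ e i = -1) ->
  (forall i, sg * ka i * e i = `|ka i|) -> `|sg| = 1 -> 0 < \sum_i `|ka i| ->
  X 0 = 0 -> (forall s, `|s| <= T -> nrm (X s) <= 1) ->
  (forall s, `|s| <= T -> nrm (X s) <= 4 * La * `|s|) ->
  (forall k s1 s2, `|s1| <= T -> `|s2| <= T ->
     `|vcomp k (X s2) - vcomp k (X s1) - (s2 - s1) * dyn f g k (X s1) e| <=
       12 * La ^+ 2 * (s2 - s1) ^+ 2) ->
  0 <= t -> t <= T -> 4 * La * t < 1 ->
  admissible u -> sol (field f g u) z x t -> x t = 0 ->
  exists2 s, `|s| <= T & nrm (z - X s) <= 16 * La ^+ 2 * (3 + 2 * M%:R) * dev2 e u t.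
Proof.
move=> ps e1 ske sg1 S0 X0 Xb Xl Xt t0 tT small au tx xt.
have bs := ps_basic ps; have L1 := bs_ge1 bs.
have L0 : 0 <= La by lra.
have gd := basic_good bs au.
have xb := steering_bound bs au tx t0 xt small.
have z0 : x 0 = z by exact: (sol0 t0 tx).
pose mu s := mean_ctrl ka e (u s).
have mu1 s : `|mu s| <= 1 by have [_] := mean_ctrl_defect e1 (au.2 s) S0.
have Imu a b : IG a b mu.
  have H := IGZ (\sum_i `|ka i|)^-1 (IG_sum (fun i => IGZ (`|ka i| * e i) (admissible_IG a b i au))).
  apply: eq_integrable H => // s _; rewrite /= /mu /mean_ctrl mulrC; congr (_ * _)%:E.
  by apply: eq_bigr => i _; rewrite mulrA.
pose th s := II 0 s mu - II 0 t mu.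
have thD s1 s2 : 0 <= s1 -> s1 <= s2 -> th s2 - th s1 = II s1 s2 mu.
  by move=> h1 h2; rewrite /th (II_chasles h1 h2) //; ring.
have thl s1 s2 : 0 <= s1 -> s1 <= s2 -> `|th s2 - th s1| <= s2 - s1.
  by move=> h1 h2; rewrite thD // -[X in _ <= X]mul1r; apply: II_abs_cst.
have tht : th t = 0 by rewrite /th subrr.
have thb s : 0 <= s <= t -> `|th s| <= t - s.
  by move=> /andP[s0 st]; have := thl s t s0 st; rewrite tht sub0r normrN.
have thT s : 0 <= s <= t -> `|th s| <= T.
  by move=> sI; apply: le_trans (thb s sI) _; case/andP: sI; clear -tT; lra.
pose Y s := X (th s).
have Yb s : 0 <= s <= t -> nrm (Y s) <= 1 by move=> sI; exact/Xb/thT.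
have Yl s : 0 <= s <= t -> nrm (Y s) <= 4 * La * (t - s).
  move=> sI; apply: le_trans (Xl _ (thT _ sI)) _.
  by rewrite ler_wpM2l ?thb // mulr_ge0.
pose C := La * (3 + 2 * M%:R).
have C0 : 0 <= C by rewrite mulr_ge0 // addr_ge0 // mulr_ge0.
pose D := dev2 e u t.
have D0 : 0 <= D by exact: dev2_ge0.
have Idev a b := dev_IG e a b au.
have Itail a b : 0 <= a -> b <= t -> IG a b (fun s => (t - s) * dev e u s).
  move=> a0 bt; apply: (@IG_bm _ _ _ _ (t * (2 * M%:R))).
    by apply: measurable_funM; [exact: measurable_funB|exact: IG_measurable (Idev _ _)].
  move=> s /andP[s0 st]; rewrite normrM ler_pM //; last exact: dev_norm.
  by rewrite ger0_norm; clear -s0 st a0 bt; lra.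
have IID0 : II 0 t (fun s => (t - s) * dev e u s) = D.
  by rewrite (II_tail t0 (Idev _ _) (B := 2 * M%:R)) // => s _; exact: dev_norm.
suff H s : 0 <= s <= t -> nrm (x s - Y s) <= 2 * (8 * La * C * D).
  exists (th 0); first by apply: thT; rewrite lexx.
  have := H 0 ltac:(by rewrite lexx t0); rewrite z0 -/(Y 0) => h; apply: le_trans h _.
  by rewrite le_eqVlt; apply/orP; left; apply/eqP; rewrite /C /D; ring.
apply: (@bootstrap _ _ (fun s => 0 <= s <= t) (fun s => nrm (x s - Y s)) 2) => {s}.
- by rewrite !mulr_ge0.
- move=> s sI; apply: le_trans (nrmD _ _) _; rewrite nrmN.
  by have := (xb s sI).1; have := Yb s sI; clear; lra.
move=> B B0 HB s /andP[s0 st].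
(* K collects the errors of freezing the curve at the left end s1. The time th is only Lipschitz, so
   the argument works with increments, where quadratic errors disappear by [quad_increment_itv]. *)
pose K := 4 * La ^+ 2 + 8 * La * C * M%:R + 12 * La ^+ 2.
have step k s1 s2 : 0 <= s1 -> s1 <= s2 -> s2 <= t ->
   `|vcomp k (x s2 - Y s2) - vcomp k (x s1 - Y s1)| <=
   II s1 s2 (fun r => La * B + 4 * La * C * ((t - r) * dev e u r)) + K * (s2 - s1) ^+ 2.
  move=> h1 h12 h2.
  have s1I : 0 <= s1 <= t by rewrite h1 (le_trans h12).
  have s2I : 0 <= s2 <= t by rewrite h2 (le_trans h1).
  have dd : 0 <= s2 - s1 by rewrite subr_ge0.
  have [I1 E1] := sol_increment tx h1 h12 h2 k.
  have T1 := Xt k _ _ (thT _ s1I) (thT _ s2I).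
  rewrite -/(Y s1) -/(Y s2) thD // in T1.
  have sq : II s1 s2 mu ^+ 2 <= (s2 - s1) ^+ 2.
    by rewrite -thD // -real_normK ?num_real // ler_sqr ?nnegrE // thl.
  have T1' : 12 * La ^+ 2 * II s1 s2 mu ^+ 2 <= 12 * La ^+ 2 * (s2 - s1) ^+ 2.
    by rewrite ler_wpM2l // mulr_ge0 // sqr_ge0.
  have Imw : IG s1 s2 (fun r => mu r * dyn f g k (Y s1) e).
    by apply: eq_integrable (IGZ (dyn f g k (Y s1) e) (Imu s1 s2)) => // r _; rewrite /= mulrC.
  have E2 : II s1 s2 mu * dyn f g k (Y s1) e = II s1 s2 (fun r => mu r * dyn f g k (Y s1) e).
    by rewrite mulrC -IIZ //; apply: IIE => r _; rewrite mulrC.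
  have Imaj : IG s1 s2 (fun r => La * B + 4 * La * C * ((t - r) * dev e u r)).
    by apply: IGD; [exact: IG_cst|apply: IGZ; exact: Itail].
  have main : `|II s1 s2 (fun r => field f g u k r (x r) - mu r * dyn f g k (Y s1) e)| <=
     II s1 s2 (fun r => La * B + 4 * La * C * ((t - r) * dev e u r))
       + (4 * La ^+ 2 + 8 * La * C * M%:R) * (s2 - s1) ^+ 2.
    have -> : (4 * La ^+ 2 + 8 * La * C * M%:R) * (s2 - s1) ^+ 2 =
       II s1 s2 (fun=> (4 * La ^+ 2 + 8 * La * C * M%:R) * (s2 - s1)).
      by rewrite II_cst // (expr2 (s2 - s1)) mulrA.
    rewrite -IID //; last exact: IG_cst.
    apply: II_abs; [exact: IGB|by apply: IGD => //; exact: IG_cst|].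
    move=> r /andP[r1 r2].
    have rI : 0 <= r <= t by rewrite (le_trans h1 r1) (le_trans r2 h2).
    have -> : field f g u k r (x r) - mu r * dyn f g k (Y s1) e =
       (dyn f g k (x r) (u r) - dyn f g k (Y s1) (u r)) +
       (dyn f g k (Y s1) (u r) - mu r * dyn f g k (Y s1) e) by rewrite /field; ring.
    have A1 := bs_lip bs k (xb r rI).1 (Yb _ s1I) (au.2 r).
    have A2 := time_change_defect k ps e1 ske sg1 S0 (au.2 r) (Yb _ s1I).
    rewrite -/(mu r) -/(dev e u r) -/C in A2.
    have A3 : nrm (x r - Y s1) <= 4 * La * (s2 - s1) + B.
      have := nrm_triangle (x s1) (x r) (Y s1); have := HB s1 s1I.
      have : nrm (x r - x s1) <= 4 * La * (r - s1).
        rewrite nrmB; apply: (sol_backward_bound gd (solW (le_trans r2 h2) tx) h1 r1).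
        by move=> a /andP[a1 a2]; apply: (xb a _).1; rewrite (le_trans h1 a1) (le_trans a2) // (le_trans r2).
      have : La * (r - s1) <= La * (s2 - s1) by rewrite ler_wpM2l // lerD2r.
      by clear; lra.
    have A3' : La * nrm (x r - Y s1) <= La * (4 * La * (s2 - s1) + B) by rewrite ler_wpM2l.
    have A4 : nrm (Y s1) <= 4 * La * ((t - r) + (s2 - s1)).
      apply: le_trans (Yl s1 s1I) _; rewrite ler_wpM2l ?mulr_ge0 //; clear -r2; lra.
    have v0 : 0 <= dev e u r by exact: dev_ge0.
    have vM : dev e u r <= 2 * M%:R by exact: dev_le.
    have A5 : C * nrm (Y s1) * dev e u r <= C * (4 * La * ((t - r) + (s2 - s1))) * dev e u r.
      by rewrite ler_wpM2r // ler_wpM2l.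
    have A6 : 4 * La * C * (s2 - s1) * dev e u r <= 4 * La * C * (s2 - s1) * (2 * M%:R).
      by rewrite ler_wpM2l // !mulr_ge0.
    apply: le_trans (ler_normD _ _) _.
    have e1_ : C * (4 * La * ((t - r) + (s2 - s1))) * dev e u r =
      4 * La * C * ((t - r) * dev e u r) + 4 * La * C * (s2 - s1) * dev e u r by ring.
    have e2_ : 4 * La * C * (s2 - s1) * (2 * M%:R) = 8 * La * C * M%:R * (s2 - s1) by ring.
    have e3_ : La * (4 * La * (s2 - s1) + B) = 4 * La ^+ 2 * (s2 - s1) + La * B by ring.
    have e4_ : (4 * La ^+ 2 + 8 * La * C * M%:R) * (s2 - s1) =
      4 * La ^+ 2 * (s2 - s1) + 8 * La * C * M%:R * (s2 - s1) by ring.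
    rewrite e4_; rewrite e1_ in A5; rewrite e2_ in A6; rewrite e3_ in A3'.
    by move: (le_trans A1 A3') (le_trans A2 A5) A6; clear; lra.
  have -> : vcomp k (x s2 - Y s2) - vcomp k (x s1 - Y s1) =
    II s1 s2 (fun r => field f g u k r (x r) - mu r * dyn f g k (Y s1) e) -
    (vcomp k (Y s2) - vcomp k (Y s1) - II s1 s2 mu * dyn f g k (Y s1) e).
    by rewrite !vcompB IIB // -E1 -E2; ring.
  apply: le_trans (ler_normB _ _) _.
  have T2 := le_trans T1 T1'.
  have -> : K * (s2 - s1) ^+ 2 = (4 * La ^+ 2 + 8 * La * C * M%:R) * (s2 - s1) ^+ 2
     + 12 * La ^+ 2 * (s2 - s1) ^+ 2 by rewrite /K; ring.
  by move: main T2; clear; lra.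
pose H r := II 0 r (fun r => La * B + 4 * La * C * ((t - r) * dev e u r)).
have Imaj a b : 0 <= a -> b <= t -> IG a b (fun r => La * B + 4 * La * C * ((t - r) * dev e u r)).
  by move=> a0 bt; apply: IGD; [exact: IG_cst|apply: IGZ; exact: Itail].
have HD s1 s2 : 0 <= s1 -> s1 <= s2 -> s2 <= t -> H s2 - H s1 =
    II s1 s2 (fun r => La * B + 4 * La * C * ((t - r) * dev e u r)).
  by move=> h1 h12 h2; rewrite /H (II_chasles h1 h12) ?Imaj //; ring.
have Yt : Y t = 0 by rewrite /Y tht X0.
have Hbound : H t - H s <= La * t * B + 4 * La * C * D.
  have Hs : 0 <= H s.
    apply: II_ge0 => r /andP[r0 rs]; rewrite addr_ge0 ?mulr_ge0 //.
      by rewrite subr_ge0 (le_trans rs).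
    exact: dev_ge0.
  have -> : La * t * B + 4 * La * C * D = H t.
    rewrite /H IID; [|exact: IG_cst|by apply: IGZ; exact: Itail].
    by rewrite II_cst // IIZ ?Itail // IID0; ring.
  by rewrite gerBl.
have comp k : `|vcomp k (x s - Y s)| <= La * t * B + 4 * La * C * D.
  apply: le_trans Hbound.
  have q1 := @quad_increment_itv R (fun r => vcomp k (x r - Y r)) H K s t st.
  have q2 := @quad_increment_itv R (fun r => - vcomp k (x r - Y r)) H K s t st.
  have E0 : vcomp k (x t - Y t) = 0 by rewrite xt Yt subrr; move: k {q1 q2 step}; apply: I2_case.
  rewrite /= E0 in q1 q2.
  rewrite ler_norml; apply/andP; split.
    suff : 0 - vcomp k (x s - Y s) <= H t - H s by clear; lra.
    apply: q1 => s1 s2 h1 h12 h2; rewrite HD //; last by rewrite (le_trans s0).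
    by have := step k s1 s2 (le_trans s0 h1) h12 h2; rewrite ler_norml => /andP[_].
  suff : - 0 - - vcomp k (x s - Y s) <= H t - H s by clear; lra.
  apply: q2 => s1 s2 h1 h12 h2; rewrite HD //; last by rewrite (le_trans s0).
  have := step k s1 s2 (le_trans s0 h1) h12 h2; rewrite ler_norml => /andP[+ _].
  by clear; lra.
apply: le_trans (nrm_le_comp comp) _.
have LtB : La * t * B <= 1 / 4 * B by rewrite ler_wpM2r //; clear -small; lra.
by move: LtB; clear; lra.
Qed.

End CurveNear.

(** * Variation of the reaching time *)

Section ReachEstimates.
Variable R : realType.

(** A cone condition on chords rather than tangents, since [cdist_line] compares two points of the
    curve. *)
Definition thin_curve (k eta T : R) (X : R -> R * R) := forall s1 s2, `|s1| <= T -> `|s2| <= T ->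
  k * `|s2 - s1| <= `|(X s2 - X s1).1| /\ `|(X s2 - X s1).2| <= eta * `|s2 - s1|.

(** The velocity at the origin is (sg * sum |ka i|, 0), of modulus at least 2 k0; mean velocities
    over chords with |s| <= T differ from it by at most 28 La^2 T <= k0 in each component. *)
Lemma abnormal_curve_thin (M : nat) (La k0 sg T : R) (ka e : 'I_M -> R) (f : R * R -> R * R)
    (g : 'I_M -> R * R -> R * R) (X : R -> R * R) :
  planar_sys La ka f g -> (forall i, e i = 1 \/ e i = -1) ->
  (forall i, sg * ka i * e i = `|ka i|) -> `|sg| = 1 -> 2 * k0 <= \sum_i `|ka i| ->
  0 <= T -> 28 * La ^+ 2 * T <= k0 ->
  (forall s, `|s| <= T -> nrm (X s) <= 1) ->
  (forall s, `|s| <= T -> nrm (X s) <= 4 * La * `|s|) ->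
  (forall k s1 s2, `|s1| <= T -> `|s2| <= T ->
     `|vcomp k (X s2) - vcomp k (X s1) - (s2 - s1) * dyn f g k (X s1) e| <=
       12 * La ^+ 2 * (s2 - s1) ^+ 2) ->
  thin_curve k0 (28 * La ^+ 2 * T) T X.
Proof.
move=> ps e1 ske sg1 kS T0 small Xb Xl Xt s1 s2 s1T s2T.
have bs := ps_basic ps; have L1 := bs_ge1 bs; have L0 : 0 <= La by lra.
have be : box e by move=> i; case: (e1 i) => ->; lra.
have n0 : nrm (0 : R * R) <= 1 by rewrite nrm0.
set S := \sum_i `|ka i| in kS.
have S0 : 0 <= S by exact: sumr_ge0.
have [d0 d1] := dyn_at0 ps be.
have d0' : dyn f g ord0 0 e = sg * S.
  rewrite d0 /S mulr_sumr; apply: eq_bigr => i _; rewrite -ske.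
  have s2' : sg * sg = 1 by rewrite -expr2 -real_normK ?num_real // sg1 expr1n.
  by rewrite !mulrA s2' mul1r.
set D := `|s2 - s1|.
have D0 : 0 <= D by exact: normr_ge0.
have DT : D <= 2 * T.
  by apply: le_trans (ler_normB _ _) _; move: s1T s2T; clear; lra.
have lipk k : `|dyn f g k (X s1) e - dyn f g k 0 e| <= 4 * La ^+ 2 * T.
  apply: le_trans (bs_lip bs k (Xb _ s1T) n0 be) _; rewrite subr0.
  have -> : 4 * La ^+ 2 * T = La * (4 * La * T) by ring.
  rewrite ler_wpM2l // (le_trans (Xl _ s1T)) // ler_wpM2l // mulr_ge0 //.
have key k : `|vcomp k (X s2) - vcomp k (X s1) - (s2 - s1) * dyn f g k 0 e| <= 28 * La ^+ 2 * T * D.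
  have -> : vcomp k (X s2) - vcomp k (X s1) - (s2 - s1) * dyn f g k 0 e =
    (vcomp k (X s2) - vcomp k (X s1) - (s2 - s1) * dyn f g k (X s1) e) +
    (s2 - s1) * (dyn f g k (X s1) e - dyn f g k 0 e) by ring.
  apply: le_trans (ler_normD _ _) _.
  have h1 := Xt k s1 s2 s1T s2T.
  have h2 : 12 * La ^+ 2 * (s2 - s1) ^+ 2 <= 24 * La ^+ 2 * T * D.
    have -> : (s2 - s1) ^+ 2 = D * D by rewrite /D -expr2 real_normK ?num_real.
    have -> : 24 * La ^+ 2 * T * D = 12 * La ^+ 2 * ((2 * T) * D) by ring.
    by rewrite ler_wpM2l ?ler_wpM2r // mulr_ge0 // sqr_ge0.
  have h3 : `|(s2 - s1) * (dyn f g k (X s1) e - dyn f g k 0 e)| <= D * (4 * La ^+ 2 * T).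
    by rewrite normrM ler_wpM2l.
  by move: h1 h2 h3; clear; lra.
split.
  have := key ord0; rewrite d0' -[(X s2 - X s1).1]/(vcomp ord0 (X s2) - vcomp ord0 (X s1)).
  set w := vcomp ord0 (X s2) - _ => kw.
  have e3 : `|(s2 - s1) * (sg * S)| = D * S by rewrite !normrM sg1 mul1r (ger0_norm S0).
  have := lerB_normD ((s2 - s1) * (sg * S)) (w - (s2 - s1) * (sg * S)).
  rewrite subrKC e3.
  have h : 28 * La ^+ 2 * T * D <= k0 * D by rewrite ler_wpM2r.
  have h' : 2 * k0 * D <= S * D by rewrite ler_wpM2r.
  by move: kw h h'; clear; lra.
by have := key (lift ord0 ord0); rewrite d1 mulr0 subr0.
Qed.

(** By [curve_near], distance d to both curves forces both defects of any steering control to be at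
    least Dm = d / c^2. Small displacements are handled by [perturbed_reach]. A larger one exceeds
    k0 Dm / 4, so its square root is at most a constant times nrm (z' - z) / sqrt d and
    [holder_reach] suffices. *)
Lemma near_reach (M : nat) (La k0 C rho0 t d del T : R) (ka : 'I_M -> R) (f : R * R -> R * R)
    (g : 'I_M -> R * R -> R * R) (z z' : R * R) (X1 X2 : R -> R * R) :
  planar_sys La ka f g -> (0 < M)%N -> 0 < k0 -> (forall i, k0 <= `|ka i|) -> k0 <= 1 ->
  small_time f g C rho0 -> 0 <= C ->
  X1 0 = 0 -> X2 0 = 0 ->
  (forall s, `|s| <= T -> nrm (X1 s) <= 1 /\ nrm (X2 s) <= 1) ->
  (forall s, `|s| <= T -> nrm (X1 s) <= 4 * La * `|s| /\ nrm (X2 s) <= 4 * La * `|s|) ->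
  (forall k s1 s2, `|s1| <= T -> `|s2| <= T ->
     `|vcomp k (X1 s2) - vcomp k (X1 s1) - (s2 - s1) * dyn f g k (X1 s1) (sgn_ctrl ka 1)| <=
       12 * La ^+ 2 * (s2 - s1) ^+ 2) ->
  (forall k s1 s2, `|s1| <= T -> `|s2| <= T ->
     `|vcomp k (X2 s2) - vcomp k (X2 s1) - (s2 - s1) * dyn f g k (X2 s1) (sgn_ctrl ka (-1))| <=
       12 * La ^+ 2 * (s2 - s1) ^+ 2) ->
  t <= T -> 520 * La ^+ 3 * T <= k0 -> 2 * M%:R * T <= 1 ->
  T + 128 * La * M%:R ^+ 2 * T <= rho0 ->
  reach_time f g z t -> 2 * del <= 1 -> 2 * del + Num.sqrt (2 * del) <= rho0 ->
  nrm (z' - z) <= del -> 0 < d ->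
  (forall s, `|s| <= T -> d <= nrm (z - X1 s)) ->
  (forall s, `|s| <= T -> d <= nrm (z - X2 s)) ->
  exists2 t', t' <= t + C * (2 + 256 * La * M%:R / k0 * (4 * La * (3 + 2 * M%:R))
      + 16 * La * (3 + 2 * M%:R) / k0) *
      nrm (z' - z) * (1 + (Num.sqrt d)^-1) & reach_time f g z' t'.
Proof.
move=> ps M0 k0p kk k01 st C0 X10 X20 Xb Xl Xt1 Xt2 tT small MT rhoT [t0 [u [x [au [tx xt]]]]]
  del1 delrho zdel d0 dX1 dX2.
have bs := ps_basic ps; have L1 := bs_ge1 bs; have L0 : 0 <= La by lra.
have ka0 i : ka i != 0 by rewrite -normr_gt0 (lt_le_trans k0p).
have M0' : 0 < M%:R :> R by rewrite ltr0n.
have S0 : 0 < \sum_i `|ka i|.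
  rewrite (bigD1 (Ordinal M0)) //= (lt_le_trans k0p) // (le_trans (kk (Ordinal M0))) // lerDl.
  exact: sumr_ge0.
have T0 : 0 <= T by exact: le_trans tT.
have LT : 520 * (La * T) <= k0.
  have L3 : La <= La ^+ 3 by rewrite -{1}[La]expr1 ler_weXn2l.
  by have L3t := ler_wpM2r T0 L3; move: small L3t; clear; lra.
have Ltt : La * t <= La * T by rewrite ler_wpM2l.
have Lt0 : 0 <= La * t by rewrite mulr_ge0.
have small4 : 4 * La * t < 1 by move: LT Ltt Lt0 k01; clear; lra.
pose N := 3 + 2 * M%:R : R; have NE : N = 3 + 2 * M%:R by [].
have N3 : 3 <= N by rewrite NE lerDl mulr_ge0 // ltW.
(* c^2 dominates the constant of [curve_near]; a perfect square gives sqrt Dm = sqrt d / c. *)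
pose c := 4 * La * N; have cE : c = 4 * La * N by [].
clearbody c.
have c0 : 0 < c by rewrite cE !mulr_gt0 //; [lra|move: N3; clear; lra].
have cg : 16 * La ^+ 2 * N <= c ^+ 2.
  have -> : c ^+ 2 = 16 * La ^+ 2 * N * N by rewrite cE; ring.
  rewrite ler_peMr ?mulr_ge0 ?sqr_ge0 //; move: N3; clear; lra.
pose Dm := d / c ^+ 2.
have c20 : 0 < c ^+ 2 by rewrite exprn_gt0.
have Dm0 : 0 < Dm by rewrite divr_gt0.
have nsg (sg : R) : sg = 1 \/ sg = -1 -> `|sg| = 1.
  by case=> ->; rewrite ?normrN normr1.
have bound (sg : R) (X : R -> R * R) : sg = 1 \/ sg = -1 -> X 0 = 0 ->
   (forall s, `|s| <= T -> nrm (X s) <= 1) -> (forall s, `|s| <= T -> nrm (X s) <= 4 * La * `|s|) ->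
   (forall k s1 s2, `|s1| <= T -> `|s2| <= T ->
     `|vcomp k (X s2) - vcomp k (X s1) - (s2 - s1) * dyn f g k (X s1) (sgn_ctrl ka sg)| <=
       12 * La ^+ 2 * (s2 - s1) ^+ 2) ->
   (forall s, `|s| <= T -> d <= nrm (z - X s)) -> Dm <= dev2 (sgn_ctrl ka sg) u t.
  move=> s1 X0 h1 h2 h3 h4.
  have e1 := sgn_ctrl1 s1 ka0.
  have ske i := sgn_ctrl_norm ka i s1.
  have [s sT near] := curve_near ps e1 ske (nsg _ s1) S0 X0 h1 h2 h3 t0 tT small4 au tx xt.
  rewrite /Dm ler_pdivrMr //; apply: le_trans (h4 s sT) _; apply: le_trans near _.
  by rewrite -NE mulrC ler_wpM2l //; exact: dev2_ge0.
have B1 := bound 1 X1 (or_introl erefl) X10 (fun s h => (Xb s h).1) (fun s h => (Xl s h).1) Xt1 dX1.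
have B2 := bound (-1) X2 (or_intror erefl) X20 (fun s h => (Xb s h).2) (fun s h => (Xl s h).2) Xt2 dX2.
set dl := nrm (z' - z) in zdel *.
have dl0 : 0 <= dl by exact: nrm_ge0.
pose sd := Num.sqrt d.
have sd0 : 0 < sd by rewrite sqrtr_gt0.
have sd2 : sd ^+ 2 = d by rewrite sqr_sqrtr // ltW.
have sDm : Num.sqrt Dm = sd / c.
  by rewrite /Dm sqrtrM ?(ltW d0) // sqrtrV ?(ltW c20) // sqrtr_sqr (gtr0_norm c0).
have MT' : 2 * M%:R * t <= 1.
  by apply: le_trans MT; rewrite ler_wpM2l // mulr_ge0 // ltW.
have small' : 520 * La ^+ 3 * t <= k0.
  by have L3t := ler_wpM2l (exprn_ge0 3 L0) tT; move: small L3t; clear; lra.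
have rho' : t + 128 * La * M%:R ^+ 2 * t <= rho0.
  by apply: le_trans rhoT; rewrite lerD // ler_wpM2l // !mulr_ge0 ?sqr_ge0.
rewrite -NE -cE -/sd.
have isd0 : 0 <= sd^-1 by rewrite invr_ge0 ltW.
set K1 := 256 * La * M%:R / k0 * c.
set K2 := 16 * La * N / k0.
have k0V : 0 <= k0^-1 by rewrite invr_ge0; exact: ltW k0p.
have K10 : 0 <= K1.
  exact: (mulr_ge0 (mulr_ge0 (mulr_ge0 (mulr_ge0 (ler0n R 256) L0) (ltW M0')) k0V) (ltW c0)).
have K20 : 0 <= K2 by rewrite !mulr_ge0 ?invr_ge0 ?(ltW k0p) //; move: N3; clear; lra.
have K1E : K1 = 256 * La * M%:R / k0 * c by [].
have K2E : K2 = 16 * La * N / k0 by [].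
clearbody K1 K2.
have fin E : E <= 2 * dl + K1 * dl * sd^-1 + K2 * dl * sd^-1 ->
   t + C * E <= t + C * (2 + K1 + K2) * dl * (1 + sd^-1).
  move=> h; rewrite lerD2l -!mulrA ler_wpM2l //; apply: le_trans h _.
  have -> : (2 + K1 + K2) * (dl * (1 + sd^-1)) =
    (2 * dl + K1 * dl * sd^-1 + K2 * dl * sd^-1) + (K1 * dl + K2 * dl + 2 * (dl * sd^-1)) by ring.
  by rewrite lerDl !addr_ge0 // !mulr_ge0.
have [small_d|big_d] := leP dl (k0 * Dm / 4).
  have [t' t'le rt'] := perturbed_reach ps M0 k0p kk k01 st C0 t0 small' MT' rho' au tx xt Dm0 B1 B2 small_d.
  exists t' => //; apply: le_trans t'le _; apply: fin; rewrite -/dl sDm.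
  have -> : 256 * La * M%:R / k0 * dl / (sd / c) = K1 * dl * sd^-1.
    by rewrite K1E; field; rewrite !gt_eqF.
  by rewrite lerDl !mulr_ge0.
have small16 : 16 * La * t < 1 by move: LT Ltt Lt0 k01; clear; lra.
have d1 : 2 * dl <= 1 by move: zdel del1; clear; lra.
have drho : 2 * dl + Num.sqrt (2 * dl) <= rho0.
  apply: le_trans delrho; apply: lerD; first by rewrite ler_pM2l.
  have del0 : 0 <= del by exact: le_trans zdel.
  by rewrite ler_sqrt ?mulr_ge0 // ler_pM2l.
have [t' t'le rt'] := holder_reach bs st au tx t0 xt small16 d1 drho C0.
exists t' => //; apply: le_trans t'le _; apply: fin; rewrite -/dl.
have dl1 : 0 < dl by apply: le_lt_trans big_d; apply: divr_ge0 => //; apply: mulr_ge0; exact: ltW.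
have hs : Num.sqrt (2 * dl) <= K2 * dl * sd^-1.
  have q0 : 0 < Num.sqrt (2 * dl) by rewrite sqrtr_gt0 mulr_gt0.
  have qE : Num.sqrt (2 * dl) ^+ 2 = 2 * dl by rewrite sqr_sqrtr // mulr_ge0.
  set q := Num.sqrt (2 * dl) in q0 qE *.
  have kq : k0 * sd <= 2 * c * q.
    rewrite -(@ler_sqr _ (k0 * sd)) ?nnegrE ?mulr_ge0 ?(ltW k0p) ?(ltW sd0) ?(ltW c0) ?(ltW q0) //.
    have -> : (2 * c * q) ^+ 2 = 8 * c ^+ 2 * dl.
      by transitivity (4 * c ^+ 2 * q ^+ 2); [ring|rewrite qE; ring].
    rewrite exprMn sd2.
    have e : k0 * d <= 4 * c ^+ 2 * dl.
      have -> : k0 * d = 4 * c ^+ 2 * (k0 * Dm / 4) by rewrite /Dm; field; rewrite gt_eqF.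
      by rewrite ler_wpM2l ?ltW // mulr_gt0.
    have e' : k0 ^+ 2 * d <= k0 * d by rewrite ler_wpM2r ?(ltW d0) // expr2 ler_piMl // ltW.
    have e'' : 0 <= c ^+ 2 * dl by rewrite mulr_ge0 // ltW.
    by move: e e' e''; clear; lra.
  rewrite ler_pdivlMr //.
  have -> : K2 * dl = q * (2 * c * q) / k0.
    transitivity (2 * c * q ^+ 2 / k0); last by ring.
    by rewrite qE K2E cE; field; rewrite gt_eqF.
  by rewrite ler_pdivlMr // -mulrA [sd * k0]mulrC ler_pM2l.
have K1d : 0 <= K1 * dl * sd^-1 by rewrite !mulr_ge0.
by move: hs K1d; clear; lra.
Qed.

End ReachEstimates.

Section TransversalInputs.
Variable R : realType.

(* Two independent input directions: a constant control halves the distance to the origin in a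
   time proportional to it, and the remainder is absorbed by [small_time]. *)
Lemma linear_small_time (M : nat) (La K C rho0 : R) (f : R * R -> R * R)
    (g : 'I_M -> R * R -> R * R) :
  basic_sys La f g -> small_time f g C rho0 -> 0 <= C -> 1 <= K ->
  (forall v : R * R, nrm v <= K^-1 -> exists2 w, box w & forall k, dyn f g k 0 w = vcomp k v) ->
  forall (n : nat) z, 20 * La ^+ 2 * K ^+ 2 * nrm z <= 1 -> nrm z + Num.sqrt (nrm z) <= rho0 ->
  exists2 t, t <= 2 * K * nrm z + C * (nrm z / 2 ^+ n + Num.sqrt (nrm z / 2 ^+ n)) &
    reach_time f g z t.
Proof.
move=> bs st C0 K1 onto; have L1 := bs_ge1 bs; have L0 : 0 <= La by lra.
have K0 : 0 <= K by lra.
elim=> [|n IHn] z small zrho.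
  have z1 : `|z.1| <= nrm z by rewrite /nrm lerDl.
  have z2 : Num.sqrt `|z.2| <= Num.sqrt (nrm z).
    by rewrite ler_sqrt ?nrm_ge0 // /nrm lerDr.
  have [t tC rt] := st z (le_trans (lerD z1 z2) zrho).
  exists t => //; apply: le_trans tC _; rewrite expr0 divr1.
  apply: le_trans (_ : C * (nrm z + Num.sqrt (nrm z)) <= _); first by rewrite ler_wpM2l // lerD.
  by rewrite lerDr !mulr_ge0 ?nrm_ge0.
have nz0 := nrm_ge0 z.
have [E|nz] := eqVneq (nrm z) 0.
  rewrite E !(mulr0, mul0r, sqrtr0, addr0); exists 0 => //.
  move: E; rewrite /nrm => /eqP; rewrite paddr_eq0 // !normr_eq0 => /andP[/eqP e1 /eqP e2].
  have -> : z = 0 by case: z e1 e2 {small zrho nz0} => ? ? /= -> ->.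
  exact: reach_time_zero.
have zp : 0 < nrm z by rewrite lt_neqAle eq_sym nz.
(* Reaching 0 from z in time s takes the constant velocity - z / s of norm 1 / K, which some w
   realises at the origin. *)
pose s := K * nrm z.
have s0 : 0 < s by rewrite mulr_gt0 //; lra.
have sge0 := ltW s0.
pose v : R * R := (- z.1 / s, - z.2 / s).
have nv : nrm v <= K^-1.
  rewrite /nrm /= !normrM !normrN normfV (gtr0_norm s0) -mulrDl -/(nrm z) /s invfM.
  by rewrite [_^-1 / _]mulrC mulrA mulfV ?gt_eqF // mul1r.
have [w bw wv] := onto v nv.
have au := cst_admissible bw.
have gd := basic_good bs au.
pose a := La ^+ 2 * K ^+ 2 * nrm z.
have a1 : 20 * a <= 1 by rewrite /a mulrA mulrA.
have LK1 : 1 <= La * K by exact: mulr_ege1.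
have aE : a = La * K * (La * s) by rewrite /a /s; ring.
have Ls0 : 0 <= La * s by rewrite mulr_ge0.
have Ls : La * s <= a by rewrite aE ler_peMl.
have zs : nrm z <= s by rewrite /s ler_peMl.
have sLs : s <= La * s by rewrite ler_peMl.
have small1 : nrm z + 4 * La * s <= 1 by move: zs sLs Ls a1; clear; lra.
have [x [tx x1]] := picard gd sge0 small1.
have sI : 0 <= s <= s by rewrite sge0 lexx.
have comp k : `|vcomp k (x s)| <= La * (5 * La * s) * s.
  have [I1 E1] := tx s sI k.
  have -> : vcomp k (x s) = II 0 s (fun r => field f g (fun=> w) k r (x r) - dyn f g k 0 w).
    rewrite E1 IIB //; last exact: IG_cst.
    rewrite II_cst // subr0 wv.
    have -> : vcomp k v = - vcomp k z / s by move: k {I1 E1}; apply: I2_case.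
    by rewrite divfK ?gt_eqF // opprK addrC.
  rewrite -[X in _ * X]subr0; apply: II_abs_cst => //; first by apply: IGB => //; exact: IG_cst.
  move=> r rI; have n0 : nrm (0 : R * R) <= 1 by rewrite nrm0.
  apply: le_trans (bs_lip bs k (x1 r rI) n0 bw) _; rewrite subr0 ler_wpM2l //.
  have := sol_forward_bound gd tx x1 rI; have := nrmD (x r - z) z; rewrite subrK.
  have : La * r <= La * s by rewrite ler_wpM2l //; case/andP: rI.
  by move: zs sLs; clear; lra.
have xs : nrm (x s) <= nrm z / 2.
  apply: le_trans (nrm_le_comp comp) _.
  have -> : 2 * (La * (5 * La * s) * s) = 10 * a * nrm z by rewrite /a /s; ring.
  have : a * nrm z <= 1 / 20 * nrm z by rewrite ler_wpM2r //; move: a1; clear; lra.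
  by clear; lra.
have nx0 := nrm_ge0 (x s).
have xz : nrm (x s) <= nrm z by move: xs nz0; clear; lra.
have small' : 20 * La ^+ 2 * K ^+ 2 * nrm (x s) <= 1.
  by apply: le_trans small; rewrite ler_wpM2l // !mulr_ge0 ?sqr_ge0.
have xrho : nrm (x s) + Num.sqrt (nrm (x s)) <= rho0.
  by apply: le_trans zrho; rewrite lerD // ler_sqrt.
have [t tle rt] := IHn (x s) small' xrho.
exists (s + t); last exact: (reach_time_concat au tx).
have p2 : 0 < (2 ^+ n)^-1 :> R by rewrite invr_gt0 exprn_gt0.
have half : nrm (x s) / 2 ^+ n <= nrm z / 2 ^+ n.+1.
  by rewrite exprS invfM mulrA ler_pM2r.
have h1 : 2 * K * nrm (x s) <= K * nrm z.
  have -> : K * nrm z = 2 * K * (nrm z / 2) by field.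
  by rewrite ler_wpM2l // mulr_ge0.
have h2 : C * (nrm (x s) / 2 ^+ n + Num.sqrt (nrm (x s) / 2 ^+ n)) <=
    C * (nrm z / 2 ^+ n.+1 + Num.sqrt (nrm z / 2 ^+ n.+1)).
  by rewrite ler_wpM2l // lerD // ler_sqrt // mulr_ge0 // invr_ge0 exprn_ge0.
by move: tle h1 h2; rewrite /s; clear; lra.
Qed.

End TransversalInputs.

(** * Planar measure and integration *)

Section PlanarTopology.
Variable R : realType.
Implicit Types (O V K : set (R * R)) (x y : R * R).

Lemma nbhs_nrmP x O : nbhs x O <-> exists2 e, 0 < e & forall y, nrm (y - x) < e -> O y.
Proof.
split.
  move=> /nbhs_ballP [e /= e0 He]; exists e => // y ye; apply: He.
  have h1 : `|y.1 - x.1| <= nrm (y - x) by rewrite /nrm lerDl.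
  have h2 : `|y.2 - x.2| <= nrm (y - x) by rewrite /nrm lerDr.
  by split; rewrite /ball /= distrC; apply: le_lt_trans ye.
move=> [e e0 He]; apply/nbhs_ballP; exists (e / 2) => /=; first by rewrite divr_gt0.
move=> y [h1 h2]; apply: He; rewrite /nrm /=; move: h1 h2; rewrite /ball /=.
by rewrite (distrC x.1) (distrC x.2); lra.
Qed.

Lemma open_nrmP O : open O <-> forall x, O x ->
  exists2 e, 0 < e & forall y, nrm (y - x) < e -> O y.
Proof.
rewrite openE; split => H x Ox; first exact/nbhs_nrmP/H.
by apply/nbhs_nrmP; exact: H.
Qed.

Lemma measurable_rect (a b c d : R) : measurable (`]a, b[ `*` `]c, d[ : set (R * R)).
Proof. exact: measurableX. Qed.

(** The sigma-algebra is the product one, so an open set is decomposed into countably many rational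
    rectangles. *)
Lemma open_measurable2 O : open O -> measurable O.
Proof.
move=> /open_nrmP oO.
pose box (p q r s : rat) : set (R * R) := `]ratr p, ratr q[ `*` `]ratr r, ratr s[.
pose F p q r s := if asbool (box p q r s `<=` O) then box p q r s else set0.
have -> : O = \bigcup_p \bigcup_q \bigcup_r \bigcup_s F p q r s.
  apply/seteqP; split => x; last first.
    move=> [p _ [q _ [r _ [s _]]]]; rewrite /F; case: ifP => // /asboolP; exact.
  move=> /oO [e e0 He].
  have e2 : 0 < e / 2 by rewrite divr_gt0.
  have [p] := @rat_in_itvoo R (x.1 - e / 2) x.1 ltac:(lra); rewrite in_itv /= => /andP[p1 p2].
  have [q] := @rat_in_itvoo R x.1 (x.1 + e / 2) ltac:(lra); rewrite in_itv /= => /andP[q1 q2].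
  have [r] := @rat_in_itvoo R (x.2 - e / 2) x.2 ltac:(lra); rewrite in_itv /= => /andP[r1 r2].
  have [s] := @rat_in_itvoo R x.2 (x.2 + e / 2) ltac:(lra); rewrite in_itv /= => /andP[s1 s2].
  exists p => //; exists q => //; exists r => //; exists s => //.
  rewrite /F asboolT; first by split; rewrite /= in_itv /= ?p2 ?q1 ?r2 ?s1.
  move=> y [] /=; rewrite !in_itv /= => /andP[a1 a2] /andP[b1 b2]; apply: He.
  have h1 : `|y.1 - x.1| < e / 2 by rewrite ltr_norml; apply/andP; split; lra.
  have h2 : `|y.2 - x.2| < e / 2 by rewrite ltr_norml; apply/andP; split; lra.
  by rewrite /nrm /=; lra.
do 4 (apply: bigcupT_measurable_rat => ?).
by rewrite /F; case: ifP => // _; exact: measurable_rect.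
Qed.

Definition cont_on V (u : R * R -> R) := forall x, V x -> forall e, 0 < e ->
  exists2 d, 0 < d & forall y, V y -> nrm (y - x) < d -> `|u y - u x| < e.

Lemma cont_on_measurable V u : open V -> cont_on V u -> measurable_fun V u.
Proof.
move=> oV cu; apply: (measurability _ (RGenOpens.measurableE R)).
move=> _ [_ [a [b ->] <-]]; apply: open_measurable2; apply/open_nrmP => x [Vx] /=.
rewrite in_itv /= => /andP[ax xb].
pose e := Num.min (u x - a) (b - u x).
have e0 : 0 < e by rewrite lt_min !subr_gt0 ax xb.
have [d d0 Hd] := cu x Vx e e0.
have [d' d'0 Hd'] := (open_nrmP V).1 oV x Vx.
exists (Num.min d d'); first by rewrite lt_min d0 d'0.
move=> y; rewrite lt_min => /andP[yd yd']; have Vy := Hd' y yd'.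
split => //=; rewrite in_itv /=; have := Hd y Vy yd.
rewrite lt_min => /andP[]; rewrite !ltr_norml => /andP[? ?] /andP[? ?].
by apply/andP; split; lra.
Qed.

Lemma compact_nrm_bounded K : compact K -> exists2 B, 0 < B & forall x, K x -> nrm x <= B.
Proof.
move=> /compact_bounded [B0 [_ HB]]; exists (2 * (`|B0| + 1)).
  by rewrite mulr_gt0 // ltr_wpDl.
move=> x Kx; have : `|x| <= `|B0| + 1.
  by apply: HB => //; rewrite (le_lt_trans (ler_norm _)) // ltrDl.
rewrite prod_normE ge_max => /andP[h1 h2]; rewrite /nrm; lra.
Qed.

(** Otherwise points of K with a neighbour outside V at distance below 1 / (n + 1) cluster at a
    point of K, whose neighbourhood in V contains those neighbours. *)
Lemma compact_margin V K : open V -> compact K -> K `<=` V ->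
  exists2 e, 0 < e & forall x y, K x -> nrm (y - x) < e -> V y.
Proof.
move=> /open_nrmP oV cK KV.
apply: contrapT => H.
have Hn (n : nat) : exists p : (R * R) * (R * R),
   [/\ K p.1, nrm (p.2 - p.1) < n.+1%:R^-1 & ~ V p.2].
  apply: contrapT => Hn; apply: H; exists n.+1%:R^-1; first by rewrite invr_gt0.
  move=> x y Kx xy; apply: contrapT => nVy; apply: Hn.
  by exists (x, y).
pose p n := sval (cid (Hn n)).
have pP n : [/\ K (p n).1, nrm ((p n).2 - (p n).1) < n.+1%:R^-1 & ~ V (p n).2].
  by rewrite /p; case: cid.
have FK : ((fun n => (p n).1) @ \oo) K by exists 0%N => // n _; have [] := pP n.
have [z [Kz clz]] := cK _ (fmap_proper_filter _ _) FK.
have [e e0 He] := oV z (KV _ Kz).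
have e2 : 0 < e / 2 by rewrite divr_gt0.
have nb : nbhs z [set y | nrm (y - z) < e / 2] by apply/nbhs_nrmP; exists (e / 2).
have [N _ HN] : \forall n \near \oo, n.+1%:R^-1 < e / 2 :> R.
  by apply: near_infty_natSinv_lt (PosNum e2).
have tl : ((fun n => (p n).1) @ \oo) [set (p n).1 | n in [set n | (N <= n)%N]].
  by exists N => // n Nn; exists n.
have [y [[n Nn <-] /= yz]] := clz _ _ tl nb.
have [_ h1 nV] := pP n; apply: nV; apply: He.
apply: le_lt_trans (nrm_triangle (p n).1 _ _) _.
by rewrite (splitr e) ltrD // (lt_trans h1) //; exact: HN.
Qed.

End PlanarTopology.

(** * Almost everywhere differentiability of Lipschitz functions of one variable *)

Section LipschitzDerivative.
Variable R : realType.
Notation mu := (@lebesgue_measure R).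

Definition clamp (a b x : R) := Num.min (Num.max a x) b.

Lemma clamp_itv (a b x : R) : a <= b -> a <= clamp a b x <= b.
Proof. by move=> ab; rewrite /clamp le_min ab le_max lexx /= ge_min lexx orbT. Qed.

Lemma clamp_id (a b x : R) : a <= x <= b -> clamp a b x = x.
Proof. by move=> /andP[ax xb]; rewrite /clamp max_r // min_l. Qed.

Lemma clamp_mono (a b x y : R) : x <= y -> 0 <= clamp a b y - clamp a b x <= y - x.
Proof.
move=> xy; rewrite /clamp /Num.min /Num.max.
by case: (ltP a x) => h1; case: (ltP a y) => h2; repeat (case: ltP => ?); lra.
Qed.

Definition mono_cumulative (phi : R -> R) (nd : {homo phi : x y / x <= y})
  (rc : right_continuous phi) : cumulative R R :=
  HB.pack phi (isCumulative.Build R _ R phi nd rc).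

Lemma stieltjes_itvoc (c : cumulative R R) (p q : R) : p <= q ->
  lebesgue_stieltjes_measure c `]p, q] = (c q - c p)%:E.
Proof.
move=> pq; rewrite /lebesgue_stieltjes_measure /measure_extension/=.
rewrite measurable_mu_extE/=; last exact: is_ocitv.
by rewrite wlength_itv_bnd.
Qed.

Lemma lip_right_continuous (phi : R -> R) (K : R) : 0 < K ->
  (forall x y, x <= y -> `|phi y - phi x| <= K * (y - x)) -> right_continuous phi.
Proof.
move=> K0 H; apply: right_continuousW => x; apply/cvgrPdist_le => e e0; near=> y.
have H' : `|phi x - phi y| <= K * `|x - y|.
  have [xy|yx] := leP x y.
    have -> : `|x - y| = y - x by rewrite distrC ger0_norm ?subr_ge0.
    by rewrite distrC; exact: H.
  have -> : `|x - y| = x - y by rewrite ger0_norm ?subr_ge0 ?(ltW yx).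
  by apply: H; exact: ltW.
apply: le_trans H' _; rewrite mulrC -ler_pdivlMr //.
near: y; have /cvgrPdist_le := @cvg_id _ (nbhs x); apply.
by rewrite divr_gt0.
Unshelve. all: by end_near. Qed.

(* For a 1-Lipschitz F, the identity x = (x + F x) / 2 + (x - F x) / 2 splits Lebesgue measure (on
   [a, b]) into two Stieltjes measures, so (x + F x) / 2 is the primitive of a density. *)
Lemma lip_ae_derivable (f : R -> R) (K a b : R) : a < b -> lip_on a b K f ->
  {ae mu, forall x, a < x < b -> derivable f x 1}.
Proof.
move=> ab lf.
wlog K0 : K lf / 0 < K.
  move=> H; apply: (H (`|K| + 1)); last by rewrite ltr_wpDl.
  move=> x y xI yI; apply: le_trans (lf x y xI yI) _.
  by rewrite ler_wpM2r // (le_trans (ler_norm K)) // lerDl.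
have ab' := ltW ab.
pose ch := clamp a b.
have chI x : a <= ch x <= b by exact: clamp_itv.
pose F x := f (ch x) / K.
have FL x y : x <= y -> `|F y - F x| <= ch y - ch x.
  move=> xy; rewrite /F -mulrBl normrM normfV (gtr0_norm K0) ler_pdivrMr // mulrC.
  apply: le_trans (lf _ _ (chI y) (chI x)) _.
  by have /andP[h _] := clamp_mono a b xy; rewrite (ger0_norm h).
have chL x y : x <= y -> 0 <= ch y - ch x <= y - x by exact: clamp_mono.
(* [om] carries Lebesgue measure outside [a, b], so the three Stieltjes measures add up to it on the
   whole line and each is dominated by it. *)
pose phi x := (ch x + F x) / 2; pose psi x := (ch x - F x) / 2; pose om x := x - ch x.
have phi_nd : {homo phi : x y / x <= y}.
  by move=> x y xy; have := FL x y xy; rewrite ler_norml => /andP[? ?]; rewrite /phi; lra.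
have psi_nd : {homo psi : x y / x <= y}.
  by move=> x y xy; have := FL x y xy; rewrite ler_norml => /andP[? ?]; rewrite /psi; lra.
have om_nd : {homo om : x y / x <= y}.
  by move=> x y xy; have := chL x y xy; rewrite /om; lra.
have phi_rc : right_continuous phi.
  apply: (@lip_right_continuous _ 1) => // x y xy; have := FL x y xy; have := chL x y xy.
  by rewrite !ler_norml /phi => ? /andP[? ?]; apply/andP; split; lra.
have psi_rc : right_continuous psi.
  apply: (@lip_right_continuous _ 1) => // x y xy; have := FL x y xy; have := chL x y xy.
  by rewrite !ler_norml /psi => ? /andP[? ?]; apply/andP; split; lra.
have om_rc : right_continuous om.
  apply: (@lip_right_continuous _ 1) => // x y xy; have := chL x y xy.
  by rewrite !ler_norml /om => ?; apply/andP; split; lra.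
pose c1 := mono_cumulative phi_nd phi_rc.
pose c2 := mono_cumulative psi_nd psi_rc.
pose c3 := mono_cumulative om_nd om_rc.
pose m1 := lebesgue_stieltjes_measure c1.
pose m2 := lebesgue_stieltjes_measure c2.
pose m3 := lebesgue_stieltjes_measure c3.
pose m := measure_add m1 (measure_add m2 m3).
have mmE A : m A = (m1 A + (m2 A + m3 A))%E 
  by rewrite /m measure_addE; congr (_ + _)%E; exact: measure_addE.
have mE A : measurable A -> mu A = (m1 A + (m2 A + m3 A))%E.
  move=> mA; rewrite -mmE.
  apply: (@lebesgue_measure_unique _ m) => // X [[p q] /= _ <-].
  rewrite [RHS]mmE.
  have [pq|qp] := leP p q; last first.
    have -> : `]p, q]%classic = set0 :> set R by rewrite set_itv_ge // bnd_simp -leNgt ltW.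
    by rewrite /m1 /m2 /m3 !measure0 !adde0.
  rewrite /m1 /m2 /m3 !stieltjes_itvoc // -!EFinD lebesgue_measure_itv /= lte_fin.
  case: ltP => [_|qp].
    have -> : c1 q - c1 p + (c2 q - c2 p + (c3 q - c3 p)) =
      phi q - phi p + (psi q - psi p + (om q - om p)) by [].
    by rewrite -EFinD; congr EFin; rewrite /phi /psi /om; field.
  have -> : q = p by apply/eqP; rewrite eq_le qp pq.
  by rewrite !subrr !addr0.
have m1le A : measurable A -> (m1 A <= mu A)%E.
  by move=> mA; rewrite mE // leeDl // adde_ge0.
have mab : measurable (`]a, b] : set (measurableTypeR R)) by exact: measurable_itv.
have fin1 : (m1 `]a, b] < +oo)%E by rewrite /m1 stieltjes_itvoc // ltry.
pose nu : {finite_measure set (measurableTypeR R) -> \bar R} := mfrestr mab fin1.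
have nuE A : nu A = m1 (A `&` `]a, b]) by [].
have numu : nu `<< mu.
  apply/null_content_dominatesP => A mA A0; rewrite nuE.
  apply/eqP; rewrite eq_le measure_ge0 andbT -A0.
  apply: le_trans (m1le _ _) _; first exact: measurableI.
  by apply: le_measure; rewrite ?inE //; exact: measurableI.
pose g := Radon_Nikodym (charge_of_finite_measure nu) mu.
have gfin x : g x \is a fin_num by exact: Radon_Nikodym_fin_num.
have gint : mu.-integrable setT g by exact: Radon_Nikodym_integrable.
pose h x := fine (g x).
have hE : EFin \o h = g by apply/funext => x /=; rewrite fineK.
have hint (A : set R) : measurable A -> mu.-integrable A (EFin \o h).
  by move=> mA; rewrite hE; apply: integrableS gint.
have loch : locally_integrable setT h.
  by apply: open_integrable_locally; [exact: openT|exact: hint].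
have := FTC1 (a := BRight a) (fun y => hint _ (measurable_itv _)) loch.
apply: filterS; first exact: (ae_filter_ringOfSetsType mu).
move=> x Hx /andP[ax xb].
have {Hx} [dF _] := Hx ltac:(by rewrite /= lte_fin).
have FE y : a < y < b -> (\int[mu]_(t in `]a, y]) h t)%R = phi y - phi a.
  move=> /andP[ay yb]; rewrite /Rintegral -[X in fine X]/(\int[mu]_(t in `]a, y]) (EFin \o h) t)%E hE.
  rewrite -Radon_Nikodym_integral //.
  change (fine (m1 (`]a, y] `&` `]a, b])) = phi y - phi a).
  rewrite setIidl; last by apply: subset_itvl; rewrite bnd_simp ltW.
  by rewrite /m1 stieltjes_itvoc // ltW.
(* On ]a, b[ one has f = K (2 phi - id), and phi is a constant plus the primitive of h. *)
have dG : derivable (fun y => K *: ((2 *: \int[mu]_(t in `]a, y]) h t)%R + 2 *: phi a - y)) x 1.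
  apply: derivableZ; apply: derivableB; last exact: derivable_id.
  by apply: derivableD; [exact: derivableZ|exact: derivable_cst].
apply: near_eq_derivable dG.
have xI : x \in `]a, b[%R by rewrite in_itv /= ax xb.
near=> y.
have yI : a < y < b.
  have : y \in `]a, b[%R by near: y; exact: near_in_itvoo.
  by rewrite in_itv.
rewrite FE // /phi /F /ch clamp_id; last by lra.
rewrite clamp_id ?lexx ?ab' //=.
by rewrite /GRing.scale /=; field; rewrite gt_eqF.
Unshelve. all: by end_near. Qed.

End LipschitzDerivative.

Section InverseSqrt.
Variable R : realType.
Notation mu := (@lebesgue_measure R).

(** By the convention 0^-1 = 0 this vanishes at 0 instead of being infinite, so the estimates that
    use it as a majorant exclude the null set where its argument is 0. *)
Definition invsqrt (r : R) : R := (Num.sqrt `|r|)^-1.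

Lemma invsqrt_ge0 r : 0 <= invsqrt r.
Proof. by rewrite invr_ge0 sqrtr_ge0. Qed.

(** For 4^-(k+1) < |s - s0| <= 4^-k the inverse square root is at most 2^(k+1), so these functions
    and the constant 1 dominate it; the k-th one has integral 4 / 2^k. *)
Definition dyad (s0 : R) (k : nat) (s : R) : \bar R :=
  ((2 ^+ k.+1) * (\1_(`[s0 - (4 ^+ k)^-1, s0 + (4 ^+ k)^-1]%classic) s))%:E.

Lemma dyad_ge0 s0 k s : (0 <= dyad s0 k s)%E.
Proof. by rewrite lee_fin mulr_ge0 ?exprn_ge0 // indicE; case: (_ \in _). Qed.

Lemma invsqrt_le_dyad s0 s : ((invsqrt (s - s0))%:E <= 1 + \sum_(k <oo) dyad s0 k s)%E.
Proof.
set r := s - s0.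
have S0 : (0 <= \sum_(k <oo) dyad s0 k s)%E by apply: nneseries_ge0 => k _ _; exact: dyad_ge0.
have [r1|r1] := leP 1 `|r|.
  rewrite -[leLHS]adde0; apply: leeD => //; rewrite lee_fin /invsqrt invf_le1 //.
    by rewrite -[leLHS]sqrtr1 ler_sqrt // (le_trans ler01).
  by rewrite sqrtr_gt0 (lt_le_trans ltr01).
have [r0|nr0] := eqVneq r 0.
  by rewrite r0 /invsqrt normr0 sqrtr0 invr0 adde_ge0.
have rp : 0 < `|r| by rewrite normr_gt0.
have ex : exists n, ((4 ^+ n)^-1 < `|r|).
  exists (Num.bound (`|r|^-1)).
  have h := archi_boundP (ltW (_ : 0 < `|r|^-1)).
  have {}h := h ltac:(by rewrite invr_gt0).
  rewrite invf_plt ?posrE ?exprn_gt0 //; apply: lt_le_trans h _.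
  by rewrite -natrX ler_nat ltnW // ltn_expl.
have [n Pn minn] := ex_minnP ex.
case: n Pn minn => [|k] Pn minn.
  by move: Pn; rewrite expr0 invr1 => /(lt_trans r1); rewrite ltxx.
have rk : `|r| <= (4 ^+ k)^-1.
  by rewrite leNgt; apply/negP => /minn; rewrite ltnn.
have Dk : dyad s0 k s = (2 ^+ k.+1)%:E.
  rewrite /dyad indicE mem_set ?mulr1 //= in_itv /=; move: rk; rewrite ler_norml /r => /andP[? ?].
  by apply/andP; split; lra.
have le1 : ((invsqrt r)%:E <= dyad s0 k s)%E.
  rewrite Dk lee_fin /invsqrt -[leRHS]invrK lef_pV2 ?posrE ?invr_gt0 ?exprn_gt0 ?sqrtr_gt0 //.
  have -> : (2 ^+ k.+1)^-1 = Num.sqrt ((4 ^+ k.+1)^-1) :> R.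
    have -> : 4 ^+ k.+1 = (2 ^+ k.+1) ^+ 2 :> R.
      by rewrite -exprM mulnC exprM; congr (_ ^+ _); ring.
    by rewrite -(exprVn (2 ^+ k.+1) 2) sqrtr_sqr ger0_norm // invr_ge0 exprn_ge0.
  by rewrite ler_sqrt ?normr_ge0 // ltW.
apply: le_trans le1 _.
apply: le_trans (_ : _ <= \sum_(k <oo) dyad s0 k s)%E _; last by rewrite leeDr.
rewrite (nneseries_split 0 k.+1) //; last by move=> i _; exact: dyad_ge0.
rewrite big_nat_recr //= -addeA; apply: le_trans (leeDr _ _) => //; last first.
  by apply: sume_ge0 => i _; exact: dyad_ge0.
by apply: leeDl; apply: nneseries_ge0 => i _ _; exact: dyad_ge0.
Qed.

Lemma integral_dyad s0 k : (\int[mu]_s dyad s0 k s = (4 / 2 ^+ k)%:E)%E.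
Proof.
rewrite /dyad; under eq_integral do rewrite EFinM.
rewrite ge0_integralZl //; last first.
  by apply/measurable_EFinP; apply: measurable_indic; exact: measurable_itv.
rewrite integral_indic // setIT.
have := @lebesgue_measure_itv R (Interval (BLeft (s0 - (4 ^+ k)^-1)) (BRight (s0 + (4 ^+ k)^-1))) => /= ->.
have p4 : 0 < (4 ^+ k)^-1 :> R by rewrite invr_gt0 exprn_gt0.
rewrite lte_fin ifT; last by lra.
rewrite -EFinB -EFinM; congr EFin.
have -> : 4 ^+ k = (2 ^+ k) * (2 ^+ k) :> R.
  by rewrite -exprMn; congr (_ ^+ _); ring.
by rewrite exprS; field; rewrite expf_neq0.
Qed.

Lemma measurable_invsqrt : measurable_fun setT invsqrt.
Proof.
have -> : invsqrt = (fun x => x `^ (- 2^-1)) \o (fun x : R => `|x|).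
  by apply/funext => r /=; rewrite powRN powR12_sqrt.
by apply: measurableT_comp => //; exact: measurable_powR.
Qed.

(** 2 b comes from the constant 1 and 8 from the geometric series of the 4 / 2^k. The bound is
    uniform in the centre s0, which changes from line to line in [weight_integrable]. *)
Lemma integral_invsqrt_le (b s0 : R) : 0 < b ->
  (\int[mu]_(s in `[(- b)%R, b]) (invsqrt (s - s0))%:E <= (2 * b + 8)%:E)%E.
Proof.
move=> b0.
have mdy k : measurable_fun setT (dyad s0 k).
  by apply/measurable_EFinP; apply: measurable_funM => //; exact/measurable_indic/measurable_itv.
have msum : measurable_fun setT (fun s => \sum_(k <oo) dyad s0 k s)%E.
  have := @ge0_emeasurable_sum _ _ R setT (dyad s0) xpredT.
  by apply => [k s _ _|k _]; [exact: dyad_ge0|exact: mdy].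
apply: (@le_trans _ _ (\int[mu]_(s in `[(- b)%R, b]) (1 + \sum_(k <oo) dyad s0 k s))%E).
  apply: ge0_le_integral => //.
  - by move=> s _; rewrite lee_fin invsqrt_ge0.
  - apply/measurable_EFinP; apply: measurableT_comp; first exact: measurable_invsqrt.
    exact: measurable_funB.
  - by apply: emeasurable_funD => //; exact: measurable_funTS.
  - by move=> s _; exact: invsqrt_le_dyad.
rewrite ge0_integralD //; last 2 first.
- by move=> s _; apply: nneseries_ge0 => k _ _; exact: dyad_ge0.
- exact: measurable_funTS.
rewrite EFinD; apply: leeD.
  rewrite integral_cst // mul1e.
  have := @lebesgue_measure_itv R (Interval (BLeft (- b)) (BRight b)) => /= ->.
  by rewrite lte_fin ifT; [rewrite -EFinB lee_fin|]; lra.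
apply: le_trans (_ : _ <= \int[mu]_s (\sum_(k <oo) dyad s0 k s))%E _.
  apply: ge0_subset_integral => //.
  by move=> s _; apply: nneseries_ge0 => k _ _; exact: dyad_ge0.
rewrite integral_nneseries //; last by move=> k s _; exact: dyad_ge0.
under eq_eseriesr do rewrite integral_dyad.
apply: lime_le; first by apply: is_cvg_nneseries => k _ _; rewrite lee_fin divr_ge0 // exprn_ge0.
apply: nearW => n; rewrite sumEFin lee_fin.
have -> : \sum_(0 <= i < n) (4 / 2 ^+ i) = 8 - 8 / 2 ^+ n :> R.
  elim: n => [|n IHn]; first by rewrite big_nil expr0; lra.
  by rewrite big_nat_recr //= IHn exprS; field; rewrite expf_neq0.
by rewrite gerBl divr_ge0 // exprn_ge0.
Qed.

End InverseSqrt.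

Section PlanarIntegration.
Variable R : realType.
Notation mu := (@lebesgue_measure R).
Notation leb2 := (@leb2 R).
Implicit Types (j : 'I_2) (x y : R * R) (s r : R).

(** Coordinates adapted to lines parallel to the j-th axis: s runs along the line and r labels it.
    Both directions are thus treated by one proof. *)
Definition pt j s r : R * R := if j == ord0 then (s, r) else (r, s).
Definition oc j x : R := if j == ord0 then x.2 else x.1.

Lemma pt_vcomp j s r : vcomp j (pt j s r) = s.
Proof. by rewrite /vcomp /pt; case: (j == ord0). Qed.

Lemma pt_oc j s r : oc j (pt j s r) = r.
Proof. by rewrite /oc /pt; case: (j == ord0). Qed.

Lemma ptE j x : pt j (vcomp j x) (oc j x) = x.
Proof. by case: x => a b; rewrite /vcomp /pt /oc; case: (j == ord0). Qed.

Lemma nrm_oc j x : nrm x = `|vcomp j x| + `|oc j x|.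
Proof. by rewrite /nrm /vcomp /oc; case: (j == ord0) => //; rewrite addrC. Qed.

Lemma nrm_pt j s s' r r' : nrm (pt j s r - pt j s' r') = `|s - s'| + `|r - r'|.
Proof. by rewrite /nrm /pt; case: (j == ord0) => //=; rewrite addrC. Qed.

Lemma measurable_pt j r : measurable_fun setT (fun s => pt j s r).
Proof.
by rewrite /pt; case: (j == ord0); apply: measurable_fun_pair.
Qed.

Lemma measurable_vcomp j : measurable_fun setT (@vcomp R j).
Proof. by rewrite /vcomp; case: (j == ord0); [exact: measurable_fst|exact: measurable_snd]. Qed.

Lemma measurable_oc j : measurable_fun setT (oc j).
Proof. by rewrite /oc; case: (j == ord0); [exact: measurable_snd|exact: measurable_fst]. Qed.

Lemma tonelli_line j (f : R * R -> \bar R) : measurable_fun setT f -> (forall x, 0 <= f x)%E ->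
  (\int[leb2]_x f x = \int[mu]_r \int[mu]_s f (pt j s r))%E.
Proof.
move=> mf f0; rewrite /pt /leb2; case: (j == ord0).
  by rewrite fubini_tonelli2.
by rewrite fubini_tonelli1.
Qed.

Lemma null_slices j (N : set (R * R)) : measurable N ->
  (forall r, mu.-negligible [set s | N (pt j s r)]) -> leb2 N = 0.
Proof.
move=> mN H.
have -> : leb2 N = (\int[leb2]_x (\1_N x)%:E)%E by rewrite integral_indic // setIT.
rewrite (@tonelli_line j); last 2 first.
- exact/measurable_EFinP/measurable_indic.
- by move=> x; rewrite lee_fin indicE; case: (_ \in _).
apply: integral0_eq => r _.
have mS : measurable [set s | N (pt j s r)].
  by rewrite -[X in measurable X]setTI; exact: measurable_pt.
have : mu [set s | N (pt j s r)] = 0%E by apply/negligibleP => //; exact: H.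
move=> <-; rewrite -[RHS]/(mu ([set s | N (pt j s r)])).
rewrite -[in RHS](setIT [set s | N (pt j s r)]) -integral_indic //.
Qed.

Definition tr j (c : R) x : R * R := pt j (vcomp j x + c) (oc j x).

Lemma measurable_tr j c : measurable_fun setT (tr j c).
Proof.
have m1 : measurable_fun setT (fun x => vcomp j x + c).
  by apply: measurable_funD => //; exact: measurable_vcomp.
have m2 := measurable_oc j.
by rewrite /tr /pt; case: (j == ord0); exact: measurable_fun_pair.
Qed.

Lemma nrm_tr j c x : nrm (tr j c x - x) = `|c|.
Proof. by rewrite -[X in _ - X](ptE j) /tr nrm_pt subrr normr0 addr0 addrAC subrr add0r. Qed.

Lemma ge0_integral_tr j c (f : R * R -> \bar R) : measurable_fun setT f ->
  (forall x, 0 <= f x)%E -> (\int[leb2]_x f (tr j c x) = \int[leb2]_x f x)%E.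
Proof.
move=> mf f0; rewrite (@tonelli_line j f) // (@tonelli_line j); last 2 first.
- by apply: measurableT_comp => //; exact: measurable_tr.
- by move=> x; exact: f0.
apply: eq_integral => r _.
rewrite [RHS](@integral_shift R c setT) //; last first.
  by apply: measurableT_comp => //; exact: measurable_pt.
rewrite preimage_setT; apply: eq_integral => s _.
by rewrite /tr pt_vcomp pt_oc.
Qed.

Lemma integral_tr j c (f : R * R -> \bar R) : measurable_fun setT f ->
  (\int[leb2]_x f (tr j c x) = \int[leb2]_x f x)%E.
Proof.
move=> mf; rewrite integralE [RHS]integralE; congr (_ - _)%E.
  rewrite -[RHS](@ge0_integral_tr j c _ (measurable_funepos mf) (funepos_ge0 f)).
  by apply: eq_integral => x _; rewrite !funeposE.
rewrite -[RHS](@ge0_integral_tr j c _ (measurable_funeneg mf) (funeneg_ge0 f)).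
by apply: eq_integral => x _; rewrite !funenegE.
Qed.

Lemma bounded_leb2 (V : set (R * R)) (b : R) : measurable V -> 0 < b ->
  (forall x, V x -> nrm x <= b) -> (leb2 V < +oo)%E.
Proof.
move=> mV b0 Vb.
apply: (@le_lt_trans _ _ (leb2 (`[-b, b] `*` `[-b, b]))).
  apply: le_measure; rewrite ?inE //; first exact: measurableX.
  move=> x /Vb; rewrite /nrm => xb; have := normr_ge0 x.1; have := normr_ge0 x.2 => h1 h2.
  split; rewrite /= in_itv /= -ler_norml; lra.
rewrite /leb2 product_measure1E //.
have := @lebesgue_measure_itv R (Interval (BLeft (- b)) (BRight b)) => /= ->.
by rewrite lte_fin ifT; [rewrite -EFinB -EFinM ltry|lra].
Qed.

(** On each line the weight is dominated by an inverse square root centred at some s0, so one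
    constant bounds all inner integrals; as it does not involve s0, the centre may depend on r in
    any way. *)
Lemma weight_integrable j (V : set (R * R)) (dd : R * R -> R) (b c : R) :
  measurable V -> 0 < b -> 0 < c -> (forall x, V x -> nrm x <= b) ->
  measurable_fun V dd -> (forall r, exists s0, forall x, V x -> oc j x = r ->
     c * `|vcomp j x - s0| <= dd x) ->
  leb2.-integrable V (fun x => (invsqrt (dd x))%:E) /\ leb2 (V `&` [set x | dd x = 0]) = 0%E.
Proof.
move=> mV b0 c0 Vb mdd line.
have mw : measurable_fun V (fun x => invsqrt (dd x)).
  by apply: measurableT_comp => //; exact: measurable_invsqrt.
split; last first.
  apply: (@null_slices j).
    by apply: (mdd mV [set 0]); exact: measurable_set1.
  move=> r; have [s0 Hs0] := line r.
  apply: (@negligibleS _ _ _ mu [set s0]).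
    move=> s /= [Vs ds]; have := Hs0 _ Vs (pt_oc _ _ _); rewrite ds pt_vcomp => h.
    apply/eqP; rewrite -subr_eq0 -normr_le0 -(pmulr_rle0 _ c0) //.
  by exists [set s0]; split => //; exact: lebesgue_measure_set1.
apply/integrableP; split; first exact/measurable_EFinP.
under eq_integral do rewrite abse_EFin ger0_norm ?invsqrt_ge0 //.
rewrite integral_mkcond.
have mwT : measurable_fun setT ((fun x => (invsqrt (dd x))%:E) \_ V).
  by apply/(measurable_restrictT _ _).1 => //; exact/measurable_EFinP.
have w0 x : (0 <= ((fun x => (invsqrt (dd x))%:E) \_ V) x)%E.
  by rewrite patchE; case: ifP => // _; rewrite lee_fin invsqrt_ge0.
rewrite (@tonelli_line j) //.
pose K := (Num.sqrt c)^-1 * (2 * b + 8).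
have K0 : 0 <= K.
  by rewrite mulr_ge0 ?invr_ge0 ?sqrtr_ge0 // addr_ge0 // mulr_ge0 // ltW.
apply: (@le_lt_trans _ _ (\int[mu]_(r in `[(- b)%R, b]) K%:E)%E); last first.
  rewrite integral_cst //.
  have := @lebesgue_measure_itv R (Interval (BLeft (- b)) (BRight b)) => /= ->.
  by rewrite lte_fin ifT; [rewrite -EFinB -EFinM ltry|lra].
rewrite [leRHS]integral_mkcond; apply: ge0_le_integral => //.
- by move=> r _; apply: integral_ge0.
- rewrite /pt; case: (j == ord0); first exact: measurable_fun_fubini_tonelli_G.
  exact: measurable_fun_fubini_tonelli_F.
- by apply/(measurable_restrictT _ _).1.
move=> r _; rewrite patchE; case: ifPn => rb; last first.
  rewrite integral0_eq // => s _; rewrite patchE ifF //; apply/negbTE; move: rb; apply: contra.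
  rewrite !inE => /Vb; rewrite (nrm_oc j) pt_vcomp pt_oc /= in_itv /= -ler_norml.
  by have := normr_ge0 s; lra.
have [s0 Hs0] := line r.
apply: (@le_trans _ _ (\int[mu]_s ((fun s => ((Num.sqrt c)^-1)%:E * (invsqrt (s - s0))%:E)%E \_ `[(- b)%R, b]) s)%E); last first.
  rewrite -integral_mkcond ge0_integralZl //.
  - rewrite /K EFinM; apply: lee_wpmul2l; first by rewrite lee_fin invr_ge0 sqrtr_ge0.
    exact: integral_invsqrt_le.
  - apply/measurable_EFinP; apply: measurableT_comp; first exact: measurable_invsqrt.
    exact: measurable_funB.
  - by move=> s _; rewrite lee_fin invsqrt_ge0.
(* The majoration can fail at s = s0, where the right-hand side is [invsqrt 0], that is 0. *)
apply: ae_ge0_le_integral => //.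
- by apply: measurableT_comp => //; exact: measurable_pt.
- move=> s _; rewrite patchE; case: ifP => // _.
  by rewrite -EFinM lee_fin mulr_ge0 ?invsqrt_ge0 // invr_ge0 sqrtr_ge0.
- apply/(measurable_restrictT _ _).1 => //.
  apply/measurable_EFinP; apply: measurable_funM => //.
  by apply: measurableT_comp; [exact: measurable_invsqrt|exact: measurable_funB].
exists [set s0]; split => //; first exact: lebesgue_measure_set1.
move=> s /= /not_implyP [_ nle]; apply: contrapT => ss0; apply: nle.
rewrite patchE; case: ifPn => [|_]; last first.
  by rewrite patchE; case: ifP => // _; rewrite -EFinM lee_fin mulr_ge0 ?invsqrt_ge0 // invr_ge0 sqrtr_ge0.
rewrite inE => Vs.
have sb : s \in (`[(- b)%R, b]%classic : set R).
  have := Vb _ Vs; rewrite (nrm_oc j) pt_vcomp pt_oc inE /= in_itv /= -ler_norml.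
  by have := normr_ge0 r; lra.
rewrite patchE sb -EFinM lee_fin.
have := Hs0 _ Vs (pt_oc _ _ _); rewrite pt_vcomp => h.
have p : 0 < `|s - s0| by rewrite normr_gt0 subr_eq0; exact/eqP.
rewrite /invsqrt -invfM -sqrtrM ?(ltW c0) //.
rewrite lef_pV2 ?posrE ?sqrtr_gt0.
- by rewrite ler_sqrt ?normr_ge0 // (le_trans h) // ler_norm.
- by rewrite (lt_le_trans _ (ler_norm _)) // (lt_le_trans _ h) // mulr_gt0.
- by rewrite mulr_gt0.
Qed.

End PlanarIntegration.

(** * Weak derivatives and the SBV criterion *)

Section Density.
Variable R : realType.
Notation leb2 := (@leb2 R).

Lemma leb2_sigma_finite : sigma_finite setT leb2.
Proof.
exists (fun n : nat => (`[- n%:R, n%:R] `*` `[- n%:R, n%:R])%classic).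
  apply/seteqP; split => // x _; exists (Num.bound (nrm x)) => //.
  have := archi_boundP (nrm_ge0 x); rewrite /nrm => h.
  have := normr_ge0 x.1; have := normr_ge0 x.2 => h1 h2.
  by split; rewrite /= in_itv /= -ler_norml; lra.
move=> n; have mX : measurable (`[- n%:R, n%:R] `*` `[- n%:R, n%:R] : set (R * R)).
  exact: measurableX.
have n0 := ler0n R n.
have p : 0 < 2 * n%:R + 1 :> R by lra.
split=> //; apply: (bounded_leb2 mX p).
by move=> x [/=]; rewrite !in_itv /= -!ler_norml /nrm; lra.
Qed.

Notation RR := (g_sigma_algebraType (R.-ocitv.-measurable)).

Definition leb2_measure : {sigma_finite_measure set (RR * RR)%type -> \bar R} :=
  HB.pack_for {sigma_finite_measure set (RR * RR)%type -> \bar R} ((@lebesgue_measure R) \x (@lebesgue_measure R))%E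
    (@Measure_isSigmaFinite.Build _ _ _ ((@lebesgue_measure R) \x (@lebesgue_measure R))%E leb2_sigma_finite).

Section DensityMeasure.
Variables (p : R * R -> R) (ip : leb2.-integrable setT (EFin \o p)) (p0 : forall x, 0 <= p x).

(** The two proofs are arguments so that the measure structures declared below can be attached to
    this name. *)
Definition density_of (_ : leb2.-integrable setT (EFin \o p)) (_ : forall x, 0 <= p x)
  (A : set (RR * RR)) : \bar R := (\int[leb2]_(x in A) (p x)%:E)%E.

Notation nu := (density_of ip p0).

Let nu0 : nu set0 = 0%E. Proof. exact: integral_set0. Qed.
Let nu_ge0 A : (0 <= nu A)%E.
Proof. by apply: integral_ge0 => x _; rewrite lee_fin. Qed.
Let nu_sigma : semi_sigma_additive nu.
Proof.
apply: (@semi_sigma_additive_nng_induced _ _ R leb2_measure) => //.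
by case/integrableP: ip.
Qed.

HB.instance Definition _ := isMeasure.Build _ _ _ nu nu0 nu_ge0 nu_sigma.

Let nu_fin : fin_num_fun nu.
Proof.
move=> A mA; have [/= m f] := integrableP _ _ _ (integrableS measurableT mA (@subsetT _ A) ip).
rewrite ge0_fin_numE //; apply: le_lt_trans f.
by rewrite /density_of; under [leRHS]eq_integral => x _ do rewrite ger0_norm //.
Qed.

HB.instance Definition _ := Measure_isFinite.Build _ _ _ nu nu_fin.

Definition density : {finite_measure set (RR * RR)%type -> \bar R} := nu.

Lemma densityE A : density A = (\int[leb2]_(x in A) (p x)%:E)%E.
Proof. by []. Qed.

Lemma density_dominates : density `<< leb2.
Proof.
apply/null_content_dominatesP => A mA A0; rewrite densityE.
by apply: null_set_integral => //; apply: measurable_funTS; case/integrableP: ip.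
Qed.

(** The Radon-Nikodym derivative of the density measure has the same integrals as p over measurable
    sets, hence equals p almost everywhere, and the change of variables formula applies. *)
Lemma integral_density (phi : R * R -> R) (B : R) : measurable_fun setT phi ->
  (forall x, `|phi x| <= B) ->
  density.-integrable setT (EFin \o phi) /\
  (\int[density]_x (phi x)%:E = \int[leb2]_x (phi x * p x)%:E)%E.
Proof.
move=> mphi phiB.
have iphi : density.-integrable setT (EFin \o phi).
  apply: (le_integrable measurableT _ _ (finite_measure_integrable_cst density B measurableT)).
  - exact/measurable_EFinP.
  - by move=> x _; rewrite lee_fin (le_trans (phiB x)) // ler_norm.
split=> //.
have dom : density `<< leb2_measure by exact: density_dominates.
have /= <- := @Radon_Nikodym_change_of_variables _ _ R density leb2_measure dom _ _ measurableT iphi.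
set q := Radon_Nikodym _ _.
have iq : leb2_measure.-integrable setT q by exact: Radon_Nikodym_integrable.
have E : ae_eq leb2_measure setT (EFin \o p) q.
  apply: integral_ae_eq => //.
  - by case/integrableP: iq.
  - move=> A _ mA; rewrite -(@Radon_Nikodym_integral _ _ R (charge_of_finite_measure density) _ A dom mA).
    by [].
rewrite -[RHS]/(\int[leb2_measure]_x (phi x * p x)%:E)%E.
apply: ae_eq_integral => //.
- apply: emeasurable_funM; first exact/measurable_EFinP.
  by case/integrableP: iq.
- apply/measurable_EFinP; apply: measurable_funM => //.
  by apply/measurable_EFinP; case/integrableP: ip.
by apply: filterS E => x /= h _; rewrite EFinM h.
Qed.

(* The measures in [SBV] live on the product of two copies of the Borel structure of [R],
   whose display differs from that of [leb2]; the measurable sets are the same. *)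
Definition borel_density_of (_ : leb2.-integrable setT (EFin \o p)) (_ : forall x, 0 <= p x)
  (A : set (R * R)) : \bar R := density A.

Notation bnu := (borel_density_of ip p0).

Let bnu0 : bnu set0 = 0%E. Proof. exact: nu0. Qed.
Let bnu_ge0 A : (0 <= bnu A)%E. Proof. exact: nu_ge0. Qed.
Let bnu_sigma : semi_sigma_additive bnu. Proof. exact: nu_sigma. Qed.

HB.instance Definition _ := isMeasure.Build _ _ _ bnu bnu0 bnu_ge0 bnu_sigma.

Let bnu_fin : fin_num_fun bnu. Proof. exact: nu_fin. Qed.

HB.instance Definition _ := Measure_isFinite.Build _ _ _ bnu bnu_fin.

Definition borel_density : {finite_measure set (R * R)%type -> \bar R} := bnu.

Lemma borel_densityE A : borel_density A = (\int[leb2]_(x in A) (p x)%:E)%E.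
Proof. by []. Qed.

Lemma borel_density_dominates : borel_density `<< leb2.
Proof. exact: density_dominates. Qed.

Lemma integral_borel_density (phi : R * R -> R) (B : R) : measurable_fun setT phi ->
  (forall x, `|phi x| <= B) ->
  (\int[borel_density]_x (phi x)%:E = \int[leb2]_x (phi x * p x)%:E)%E.
Proof.
move=> mphi phiB; have [iphi <-] := integral_density mphi phiB.
(* The identity map is measurable between the two structures, so the integral is transported by
   push-forward. *)
have mid : measurable_fun setT (fun x : (RR * RR)%type => (x : (R * R)%type)) by move=> _ Y mY; rewrite setTI.
transitivity (\int[pushforward density (fun x : (RR * RR)%type => (x : (R * R)%type))]_y (phi y)%:E)%E.
  pose pm : {measure set (R * R)%type -> \bar R} := pushforward density (fun x : (RR * RR)%type => (x : (R * R)%type)).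
  by apply: (@eq_measure_integral _ _ R setT (pm mid)) => A mA _.
rewrite (@integral_pushforward _ _ _ _ R _ mid density setT (EFin \o phi)) //.
exact/measurable_EFinP.
Qed.
End DensityMeasure.
End Density.

Section TestFunctions.
Variable R : realType.
Implicit Types (j : 'I_2) (x y : R * R) (f : R * R -> R).

Lemma dpart_pt j f s r : dpart j f (pt j s r) = (fun t => f (pt j t r))^`() s.
Proof. by rewrite /dpart /pt; case: (j == ord0). Qed.

Lemma has_dpart_pt j f s r : has_dpart j f (pt j s r) -> derivable (fun t => f (pt j t r)) s 1.
Proof. by rewrite /has_dpart /pt; case: (j == ord0). Qed.

Lemma derive_lip (f : R -> R) (K a b : R) : (forall s, derivable f s 1) ->
  (forall s, Num.min a b <= s <= Num.max a b -> `|f^`() s| <= K) -> `|f a - f b| <= K * `|a - b|.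
Proof.
move=> df.
wlog ab : a b / a <= b.
  move=> H HK; have [ab|/ltW ba] := leP a b; first exact: H.
  by rewrite distrC (distrC a); apply: H => // s sI; apply: HK; rewrite minC maxC.
move=> HK.
have [c cI E] := @MVT_segment R f (f^`()) a b ab (fun c _ => DeriveDef (df c) (esym (derive1E _ _)))
  (derivable_within_continuous (fun c _ => df c)).
rewrite distrC E normrM distrC; apply: ler_wpM2r => //.
by apply: HK; move: cI; rewrite in_itv /= (min_idPl ab) (max_idPr ab).
Qed.

(** Two axis-parallel segments join x to y inside nrm z <= nrm x + nrm y, so only the partial
    derivatives there matter; [C11_taylor] relies on this localisation. *)
Lemma dpart_lip f (K : R) x y : (forall j z, has_dpart j f z) ->
  (forall j z, nrm z <= nrm x + nrm y -> `|dpart j f z| <= K) ->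
  `|f x - f y| <= K * nrm (x - y).
Proof.
move=> df HK.
have side j a b r : `|r| + Num.max `|a| `|b| <= nrm x + nrm y ->
    `|f (pt j a r) - f (pt j b r)| <= K * `|a - b|.
  move=> rK; apply: (@derive_lip (fun t => f (pt j t r))).
    by move=> s; apply: has_dpart_pt; exact: df.
  move=> s sI; rewrite -dpart_pt; apply: HK.
  rewrite (nrm_oc j) pt_vcomp pt_oc addrC (le_trans _ rK) // lerD2l.
  rewrite le_max; move: sI; rewrite ge_min le_max => /andP[h1 h2].
  have [s0|s0] := leP 0 s.
    by move: h2 => /orP[h|h]; apply/orP; [left|right]; rewrite ger0_norm // (le_trans h) // ler_norm.
  by move: h1 => /orP[h|h]; apply/orP; [left|right]; rewrite ltr0_norm // ler_normr lerN2 h orbT.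
case: x y HK side => [a b] [a' b'] HK side.
have E : f (a, b) - f (a', b') = (f (pt ord0 a b) - f (pt ord0 a' b)) +
    (f (pt 1 b a') - f (pt 1 b' a')) by rewrite /pt /=; ring.
rewrite E (le_trans (ler_normD _ _)) // /nrm /= mulrDr; apply: lerD; apply: side; rewrite /nrm /=.
- have := normr_ge0 a; have := normr_ge0 a'; have := normr_ge0 b; have := normr_ge0 b'.
  by rewrite /Num.max; case: ltP; lra.
- have := normr_ge0 a; have := normr_ge0 a'; have := normr_ge0 b; have := normr_ge0 b'.
  by rewrite /Num.max; case: ltP; lra.
Qed.

Lemma test_fun_bounds V phi : test_fun V phi -> exists B : R,
  [/\ 0 <= B, forall j x, `|dpart j phi x| <= B, forall x, `|phi x| <= B &
      forall x y, `|phi x - phi y| <= B * nrm (x - y)].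
Proof.
move=> [df [dc [K [cK KV phi0]]]].
have clK : closed K by apply: compact_closed => //; exact: norm_hausdorff.
have bnd (h : R * R -> R) : continuous h -> exists2 B, 0 <= B & forall x, K x -> `|h x| <= B.
  move=> ch; have : compact (h @` K).
    by apply: continuous_compact => //; exact: continuous_subspaceT.
  move=> /compact_bounded [B0 [_ HB]]; exists (`|B0| + 1); first by rewrite addr_ge0.
  move=> x Kx; apply: HB; last by exists x.
  by rewrite (le_lt_trans (ler_norm _)) // ltrDl.
have d0 j x : ~ K x -> dpart j phi x = 0.
  move=> nK.
  have /nbhs_nrmP [e e0 He] : nbhs x (~` K) by apply: open_nbhs_nbhs; split => //; exact: closed_openC.
  rewrite -(ptE j x) dpart_pt derive1E.
  rewrite (@near_eq_derive _ _ _ _ (cst 0)) ?derive_cst //.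
  apply/nbhs_ballP; exists e => //= s; rewrite /ball /= => hs.
  apply: phi0; apply: He; rewrite -[X in _ - X](ptE j) nrm_pt subrr normr0 addr0 distrC //.
have [B1 B10 H1] := bnd _ (dc ord0).
have [B2 B20 H2] := bnd _ (dc (lift ord0 ord0)).
have dB j x : `|dpart j phi x| <= B1 + B2.
  have [Kx|nK] := pselect (K x); last by rewrite d0 // normr0 addr_ge0.
  elim/I2_case: j; first by rewrite (le_trans (H1 _ Kx)) // lerDl.
  by rewrite (le_trans (H2 _ Kx)) // lerDr.
have lip x y : `|phi x - phi y| <= (B1 + B2) * nrm (x - y).
  by apply: dpart_lip => // j z _; exact: dB.
have [b b0 Kb] := compact_nrm_bounded cK.
(* A point outside K, where phi vanishes: the Lipschitz bound from there bounds phi itself. *)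
pose z0 : R * R := (b + 1, 0).
have z00 : phi z0 = 0.
  by apply: phi0 => /Kb; rewrite /nrm /= normr0 addr0 ger0_norm; lra.
have B0 : 0 <= B1 + B2 by rewrite addr_ge0.
exists ((B1 + B2) * (2 * b + 2)); split.
- by rewrite mulr_ge0 //; lra.
- by move=> j x; rewrite (le_trans (dB j x)) // ler_peMr //; lra.
- move=> x; have [Kx|nK] := pselect (K x); last by rewrite phi0 // normr0 mulr_ge0 //; lra.
  rewrite -[phi x]subr0 -z00 (le_trans (lip _ _)) // ler_wpM2l // (le_trans (nrmD x (- z0))) // nrmN.
  by have := Kb _ Kx; rewrite /nrm /= normr0 addr0 (ger0_norm (_ : 0 <= b + 1)); lra.
move=> x y; rewrite (le_trans (lip x y)) // -mulrA ler_wpM2l // ler_peMl ?nrm_ge0 //; lra.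
Qed.
End TestFunctions.

Section WeakDerivative.
Variables (R : realType) (V : set (R * R)) (u dd : R * R -> R) (b B C K del : R).
Notation mu := (@lebesgue_measure R).
Notation leb2 := (@leb2 R).
Hypotheses (oV : open V) (b0 : 0 < b) (Vb : forall x, V x -> nrm x <= b).
Hypotheses (cu : cont_on V u) (B0 : 0 <= B) (uB : forall x, V x -> `|u x| <= B).
Hypotheses (C0 : 0 <= C) (K0 : 0 <= K) (dd0 : forall x, 0 <= dd x).
Hypothesis ddK : forall x y, dd x - dd y <= K * nrm (x - y).
Hypothesis del0 : 0 < del.
Hypothesis est : forall x y, V x -> V y -> nrm (y - x) <= del -> 0 < dd x ->
  `|u y - u x| <= C * (1 + invsqrt (dd x)) * nrm (y - x).
Hypothesis iw : leb2.-integrable V (fun x => (invsqrt (dd x))%:E).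
Hypothesis dd_null : leb2 (V `&` [set x | dd x = 0]) = 0%E.
Implicit Types (j : 'I_2) (x y : R * R) (s r : R).

Let mV : measurable V := open_measurable2 oV.
Let U := u \_ V.

Let UE x : V x -> U x = u x.
Proof. by move=> Vx; rewrite /U patchE mem_set. Qed.

Let mu_ : measurable_fun V u. Proof. exact: cont_on_measurable. Qed.

Let mU : measurable_fun setT U.
Proof. by apply/(measurable_restrictT _ _).1. Qed.

Let UB x : `|U x| <= B.
Proof. by rewrite /U patchE; case: ifPn => [|_]; [rewrite inE; exact: uB|rewrite normr0]. Qed.

Let mdd : measurable_fun V dd.
Proof.
apply: cont_on_measurable => // x _ e e0; exists (e / (K + 1)); first by rewrite divr_gt0 // ltr_wpDl.
move=> y _ yx.
have h : K * nrm (y - x) < e.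
  rewrite ltr_pdivlMr ?ltr_wpDl // in yx; apply: le_lt_trans yx.
  by rewrite mulrC ler_wpM2l ?nrm_ge0 // lerDl.
by have := ddK x y; have := ddK y x; rewrite (nrmB x y) ltr_norml; move: h; lra.
Qed.

Let dom x := C * (1 + invsqrt (dd x)).

Let dom_ge0 x : 0 <= dom x.
Proof. by rewrite mulr_ge0 // addr_ge0 ?invsqrt_ge0. Qed.

Let mdom : measurable_fun V dom.
Proof.
apply: measurable_funM => //; apply: measurable_funD => //.
by apply: measurableT_comp => //; exact: measurable_invsqrt.
Qed.

Let leb2V : (leb2 V < +oo)%E. Proof. exact: (bounded_leb2 mV b0 Vb). Qed.

Let icst (k : R) : leb2.-integrable V (fun=> k%:E).
Proof.
apply/integrableP; split; first exact/measurable_EFinP.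
under eq_integral do rewrite abse_EFin.
by rewrite integral_cst // lte_mul_pinfty ?lee_fin.
Qed.

Let idom : leb2.-integrable V (EFin \o dom).
Proof.
have -> : EFin \o dom = (fun x => (C%:E * (1%:E + (invsqrt (dd x))%:E))%E).
  by apply/funext => x; rewrite /= -EFinD -EFinM.
by apply: integrableZl => //; apply: integrableD.
Qed.

Section Direction.
Variable j : 'I_2.

(** Where dd > 0 the estimate makes U Lipschitz on a small interval with rational ends; there are
    countably many of these, and [lip_ae_derivable] applies to each. *)
Lemma slice_derivable r : mu.-negligible [set s | [/\ V (pt j s r), 0 < dd (pt j s r) &
   ~ derivable (fun t => U (pt j t r)) s 1]].
Proof.
pose f t := U (pt j t r).
pose good (p : rat * rat) := (ratr p.1 < ratr p.2 :> R) /\ exists k, lip_on (ratr p.1) (ratr p.2) k f.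
pose F (n : nat) : set R := [set s | exists p : rat * rat, [/\ unpickle n = Some p, good p,
   ratr p.1 < s < ratr p.2 & ~ derivable f s 1]].
apply: (@negligibleS _ _ _ mu (\bigcup_n F n)); last first.
  apply: negligible_bigcup => n.
  case En : (unpickle n) => [p|]; last first.
    by apply: (@negligibleS _ _ _ mu set0); [move=> s [p []]; rewrite En|exact: negligible_set0].
  have [[pq [k lk]]|ng] := pselect (good p); last first.
    apply: (@negligibleS _ _ _ mu set0); last exact: negligible_set0.
    by move=> s [p' []]; rewrite En => -[<-].
  apply: negligibleS (lip_ae_derivable pq lk) => s [p' []]; rewrite En => -[<-] _ ps nd /= H.
  exact/nd/H.
move=> s [Vs ds nd].
have [e e0 He] := (open_nrmP V).1 oV _ Vs.
pose d1 := dd (pt j s r) / 2 / (K + 1).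
have d10 : 0 < d1 by rewrite !divr_gt0 // ltr_wpDl.
pose h := Num.min e (Num.min (del / 2) d1).
have h0 : 0 < h by rewrite !lt_min e0 d10 divr_gt0.
have near_s t : `|t - s| < h -> V (pt j t r) /\ dd (pt j s r) / 2 < dd (pt j t r).
  rewrite !lt_min => /and3P[h1 _ h3].
  have En : nrm (pt j t r - pt j s r) = `|t - s| by rewrite nrm_pt subrr normr0 addr0.
  split; first by apply: He; rewrite En.
  have := ddK (pt j s r) (pt j t r); rewrite nrmB En => h4.
  have : K * `|t - s| < dd (pt j s r) / 2.
    move: h3; rewrite ltr_pdivlMr ?ltr_wpDl // => h3; apply: le_lt_trans h3.
    by rewrite mulrC ler_wpM2l // lerDl.
  by move: h4; lra.
have [p] := @rat_in_itvoo R (s - h) s ltac:(lra).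
rewrite in_itv /= => /andP[p1 p2].
have [p'] := @rat_in_itvoo R s (s + h) ltac:(lra).
rewrite in_itv /= => /andP[p3 p4].
exists (pickle (p, p')) => //; exists (p, p'); rewrite pickleK; split => //=; last by rewrite p2 p3.
split; first exact: (lt_trans p2 p3).
exists (C * (1 + invsqrt (dd (pt j s r) / 2))) => t' t t'I tI.
have [Vt dt] : V (pt j t r) /\ dd (pt j s r) / 2 < dd (pt j t r).
  by apply: near_s; rewrite ltr_norml; move: tI p1 p4; lra.
have [Vt' dt'] : V (pt j t' r) /\ dd (pt j s r) / 2 < dd (pt j t' r).
  by apply: near_s; rewrite ltr_norml; move: t'I p1 p4; lra.
have En : nrm (pt j t' r - pt j t r) = `|t' - t| by rewrite nrm_pt subrr normr0 addr0.
have hd : h <= del / 2 by rewrite !ge_min lexx orbT.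
rewrite /f !UE // -En; apply: le_trans (est Vt Vt' _ _) _.
- by rewrite En ler_norml; move: tI t'I p1 p4 hd; lra.
- by rewrite (lt_trans _ dt) // divr_gt0.
apply: ler_wpM2r; first exact: nrm_ge0.
apply: ler_wpM2l => //; rewrite lerD2l /invsqrt.
have ds2 : 0 < dd (pt j s r) / 2 by rewrite divr_gt0.
have dt0 := lt_trans ds2 dt.
rewrite lef_pV2 ?posrE ?sqrtr_gt0 ?normr_gt0 ?gt_eqF //.
by rewrite ler_sqrt // !gtr0_norm // ltW.
Qed.

Let q (n : nat) x := n.+1%:R * (U (tr j n.+1%:R^-1 x) - U x).

Let mq n : measurable_fun setT (q n).
Proof.
apply: measurable_funM => //; apply: measurable_funB => //.
by apply: measurableT_comp => //; exact: measurable_tr.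
Qed.

Let q_bound x n : V x -> 0 < dd x -> V (tr j n.+1%:R^-1 x) -> n.+1%:R^-1 <= del -> `|q n x| <= dom x.
Proof.
move=> Vx dx Vtx nd.
have n0 : 0 < n.+1%:R :> R by rewrite ltr0n.
have En : nrm (tr j n.+1%:R^-1 x - x) = n.+1%:R^-1 by rewrite nrm_tr gtr0_norm // invr_gt0.
rewrite /q !UE // normrM gtr0_norm // -ler_pdivlMl //.
by have := est Vx Vtx _ dx; rewrite En mulrC => /(_ nd).
Qed.

Let small_step (e : R) : 0 < e -> \forall n \near \oo, n.+1%:R^-1 < e :> R.
Proof.
move=> e0; have /cvgrPdist_lt /(_ e e0) := @cvg_harmonic R.
by apply: filterS => n; rewrite sub0r normrN gtr0_norm // invr_gt0 ltr0n.
Qed.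

Let q_bound_near x : V x -> 0 < dd x -> \forall n \near \oo, `|q n x| <= dom x.
Proof.
move=> Vx dx; have [e e0 He] := (open_nrmP V).1 oV _ Vx.
near=> n; apply: q_bound => //.
- apply: He; rewrite nrm_tr gtr0_norm ?invr_gt0 ?ltr0n //; near: n; exact: small_step.
- by apply: ltW; near: n; exact: small_step.
Unshelve. all: by end_near. Qed.

Let derivable_cvg x : V x -> 0 < dd x ->
  derivable (fun t => U (pt j t (oc j x))) (vcomp j x) 1 ->
  exists l, q ^~ x @ \oo --> l /\ `|l| <= dom x.
Proof.
move=> Vx dx /cvg_ex [l Hl]; exists l.
have ql : q ^~ x @ \oo --> l.
  move: Hl => /cvgr_dnbhsP /(_ (fun n => n.+1%:R^-1)) H.
  have {H} : (n.+1%:R^-1^-1 *: (((fun t => U (pt j t (oc j x))) \o shift (vcomp j x)) (n.+1%:R^-1 *: 1)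
     - U (pt j (vcomp j x) (oc j x)))) @[n --> \oo] --> l.
    apply: H; split => [n|]; first by rewrite invr_neq0 // pnatr_eq0.
    exact: cvg_harmonic.
  apply: cvg_trans; apply: near_eq_cvg; near=> n.
  by rewrite /q /= invrK ptE /tr /GRing.scale /= mulr1 [in LHS](addrC _ (vcomp j x)).
split=> //; apply: (cvgr_to_le (cvg_norm ql)); exact: q_bound_near.
Unshelve. all: by end_near. Qed.

(** The limsup is measurable whether or not the quotients converge; clipping by dom makes it
    integrable and leaves genuine limits unchanged, as they obey the same bound. *)
Let g x := Num.max (- dom x) (Num.min (dom x) (fine (limn_esup (fun n => (q n x)%:E)))).

Let g_dom x : `|g x| <= dom x.
Proof.
rewrite /g ler_norml le_max lexx /= ge_max ge_min lexx /= andbT.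
by have := dom_ge0 x; lra.
Qed.

Let mg : measurable_fun V g.
Proof.
apply: measurable_maxr; first exact: measurableT_comp.
apply: measurable_minr => //; apply: measurableT_comp => //.
by apply: measurable_fun_limn_esup => n; apply/measurable_EFinP; exact: measurable_funTS.
Qed.

Let g_lim x l : q ^~ x @ \oo --> l -> `|l| <= dom x -> g x = l.
Proof.
move=> ql lD; have /cvg_limn_einf_sup [_ E] : (fun n => (q n x)%:E) @ \oo --> l%:E.
  by apply: cvg_EFin => //; exact: nearW.
rewrite /g E /=; move: lD; rewrite ler_norml => /andP[h1 h2].
by rewrite (min_idPr h2) (max_idPr h1).
Qed.

(** Convergence of q to g is expressed by a vanishing limsup, so that the exceptional set is visibly
    measurable and can be shown null line by line. *)
Let bad : set (R * R) := (V `&` [set x | dd x = 0]) `|`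
  (V `&` [set x | 0 < dd x] `&` [set x | limn_esup (fun n => `|q n x - g x|%:E) != 0%E]).

Let bad_null : measurable bad /\ leb2 bad = 0%E.
Proof.
have m1 : measurable (V `&` [set x | dd x = 0]).
  exact: (mdd mV (measurable_set1 (0 : R))).
have mW : measurable (V `&` [set x | 0 < dd x]).
  have -> : [set x | 0 < dd x] = dd @^-1` `]0, +oo[.
    by apply/seteqP; split => x /=; rewrite in_itv /= andbT.
  by apply: mdd => //; exact: measurable_itv.
have m2 : measurable (V `&` [set x | 0 < dd x] `&` [set x | limn_esup (fun n => `|q n x - g x|%:E) != 0%E]).
  apply: measurable_neqe => //.
  apply: measurable_fun_limn_esup => n; apply/measurable_EFinP; apply: measurableT_comp => //.
  apply: measurable_funB; first exact: measurable_funTS.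
  by apply: measurable_funS mg => // x [].
split; first exact: measurableU.
suff e2 : leb2 (V `&` [set x | 0 < dd x] `&` [set x | limn_esup (fun n => `|q n x - g x|%:E) != 0%E]) = 0%E.
  have := measureU2 leb2 m1 m2; rewrite [X in (_ <= X + _)%E]dd_null [X in (_ <= _ + X)%E]e2 adde0 => h.
  by apply/eqP; rewrite eq_le measure_ge0 andbT.
apply: (@null_slices _ j) => // r; apply: negligibleS (slice_derivable r) => s /= [[Vs ds] ns].
split=> // dr; move: ns; apply/negP; rewrite negbK.
have [|l [ql lD]] := derivable_cvg Vs ds _; first by rewrite pt_vcomp pt_oc.
rewrite (g_lim ql lD); apply/eqP.
have /cvg_limn_einf_sup [_ ->] // : (fun n => `|q n (pt j s r) - l|%:E) @ \oo --> 0%:E.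
apply: cvg_EFin; first exact: nearW.
rewrite -[X in _ --> X](normr0 R) -(subrr l); apply: cvg_norm.
by apply: cvgB => //; exact: cvg_cst.
Qed.

Let q_cvg x : V x -> ~ bad x -> q ^~ x @ \oo --> g x.
Proof.
move=> Vx nb.
have dx : 0 < dd x.
  by rewrite lt_neqAle dd0 andbT eq_sym; apply/eqP => d; apply: nb; left.
have E : limn_esup (fun n => `|q n x - g x|%:E) = 0%E.
  by apply/eqP/negPn/negP => h; apply: nb; right.
have : (fun n => `|q n x - g x|%:E) @ \oo --> 0%:E.
  by apply: limn_esup_le_cvg => [|n]; rewrite ?E // lee_fin.
move=> /fine_cvgP [_] H.
apply/subr_cvg0; apply: norm_cvg0; exact: H.
Qed.

Let bounded_integrable (f : R * R -> R) (k : R) : measurable_fun setT f -> (forall x, `|f x| <= k) ->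
  (forall x, ~ V x -> f x = 0) -> leb2.-integrable setT (EFin \o f).
Proof.
move=> mf fk f0.
have ik : leb2.-integrable setT ((fun=> k%:E) \_ V) by exact/(integrable_mkcond _ _).1/icst.
apply: le_integrable ik => //; first exact/measurable_EFinP.
move=> x _; rewrite patchE; case: ifPn => [_|]; first by rewrite lee_fin (le_trans (fk x)) // ler_norm.
by rewrite notin_setE => nV; rewrite /= f0 // normr0.
Qed.

(** Discrete integration by parts: translation invariance of [leb2] moves the step from phi to u,
    both being 0 off V. *)
Let summation_by_parts (phi : R * R -> R) (k : R) n : measurable_fun setT phi -> (forall x, `|phi x| <= k) ->
  (forall x, ~ V x -> phi x = 0) ->
  (\int[leb2]_(x in V) (u x * (n.+1%:R * (phi x - phi (tr j (- n.+1%:R^-1) x))))%:E =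
   - \int[leb2]_(x in V) (q n x * phi x)%:E)%E.
Proof.
move=> mphi phik phi0.
set c := (n.+1%:R^-1 : R); set m := (n.+1%:R : R).
have mt (d : R) : measurable_fun setT (fun x => phi (tr j d x)).
  by apply: measurableT_comp => //; exact: measurable_tr.
have mUt (d : R) : measurable_fun setT (fun x => U (tr j d x)).
  by apply: measurableT_comp => //; exact: measurable_tr.
have k0 : 0 <= k by exact: le_trans (phik (0, 0)).
have U0 x : ~ V x -> U x = 0 by move=> nV; rewrite /U patchE memNset.
have bd x y : `|U x * phi y| <= B * k by rewrite normrM ler_pM.
have i1 : leb2.-integrable setT (EFin \o (fun x => U x * phi x)).
  apply: (@bounded_integrable _ (B * k)) => //; first exact: measurable_funM.
  by move=> x /U0 ->; rewrite mul0r.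
have i2 : leb2.-integrable setT (EFin \o (fun x => U x * phi (tr j (- c) x))).
  apply: (@bounded_integrable _ (B * k)) => //; first exact: measurable_funM.
  by move=> x /U0 ->; rewrite mul0r.
have i3 : leb2.-integrable setT (EFin \o (fun x => U (tr j c x) * phi x)).
  apply: (@bounded_integrable _ (B * k)) => //; first exact: measurable_funM.
  by move=> x /phi0 ->; rewrite mulr0.
have E23 : (\int[leb2]_x (U x * phi (tr j (- c) x))%:E = \int[leb2]_x (U (tr j c x) * phi x)%:E)%E.
  rewrite -(@integral_tr _ j c); last by case/integrableP: i2.
  by congr (integral _ _ _); apply/funext => x; rewrite /tr pt_vcomp pt_oc addrK ptE.
have -> : (\int[leb2]_(x in V) (u x * (m * (phi x - phi (tr j (- c) x))))%:E =
    m%:E * (\int[leb2]_x (U x * phi x)%:E - \int[leb2]_x (U x * phi (tr j (- c) x))%:E))%E.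
  rewrite -integralB // -integralZl //; last exact: integrableB.
  rewrite [LHS]integral_mkcond; congr (integral _ _ _); apply/funext => x; rewrite patchE /= -EFinB -EFinM.
  case: ifPn => [|]; first by rewrite inE => Vx; rewrite UE //; congr (_%:E); ring.
  by rewrite notin_setE => /U0 ->; rewrite !mul0r subrr mulr0.
have -> : (\int[leb2]_(x in V) (q n x * phi x)%:E =
    m%:E * (\int[leb2]_x (U (tr j c x) * phi x)%:E - \int[leb2]_x (U x * phi x)%:E))%E.
  rewrite -integralB // -integralZl //; last exact: integrableB.
  rewrite [LHS]integral_mkcond; congr (integral _ _ _); apply/funext => x; rewrite patchE /= -EFinB -EFinM.
  case: ifPn => [|]; first by move=> _; rewrite /q; congr (_%:E); ring.
  by rewrite notin_setE => /phi0 ->; rewrite !mulr0 subrr mulr0.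
rewrite E23.
have := integrable_fin_num measurableT i1; have := integrable_fin_num measurableT i3.
rewrite /comp /=.
case: (integral _ _ _) => // a _; case: (integral _ _ _) => // a' _.
by rewrite -!EFinB -!EFinM -EFinN; congr (_%:E); ring.
Qed.

(** Dominated convergence on both sides of [summation_by_parts]. The bound on q needs the translated
    point in V: this holds on the support of phi, and elsewhere the integrand is 0. *)
Lemma weak_derivative phi : test_fun V phi ->
  (\int[leb2]_(x in V) (u x * dpart j phi x)%:E = - \int[leb2]_(x in V) (g x * phi x)%:E)%E.
Proof.
move=> tphi; have [k [k0 dk phik philip]] := test_fun_bounds tphi.
case: tphi => dphi [cphi [Kc [cK KV phi0]]].
have [e e0 He] := compact_margin oV cK KV.
have phiV x : ~ V x -> phi x = 0 by move=> nV; apply: phi0 => /KV.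
have mphi : measurable_fun setT phi.
  apply: cont_on_measurable; first exact: openT.
  move=> x _ d d0; exists (d / (k + 1)); first by rewrite divr_gt0 // ltr_wpDl.
  move=> y _; rewrite ltr_pdivlMr ?ltr_wpDl // => h; apply: le_lt_trans (philip _ _) _.
  by apply: le_lt_trans h; rewrite mulrC ler_wpM2l ?nrm_ge0 // lerDl.
have mdphi : measurable_fun setT (dpart j phi).
  apply: cont_on_measurable; first exact: openT.
  move=> x _ d d0; have /cvgrPdist_lt /(_ d d0) /nbhs_nrmP [d' d'0 H] := cphi j x.
  by exists d' => // y _ /H; rewrite distrC.
(* The index is shifted by N0 so that every step, not only late ones, is below del and below the
   margin of the support. *)
have [N0 _ HN0] : \forall n \near \oo, n.+1%:R^-1 < Num.min e del :> R.
  by apply: small_step; rewrite lt_min e0.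
pose N n := (n + N0)%N.
have Nn n : (N n).+1%:R^-1 < e /\ (N n).+1%:R^-1 < del.
  by have := HN0 (N n) (leq_addl _ _); rewrite /= lt_min => /andP.
pose psi n x := n.+1%:R * (phi x - phi (tr j (- n.+1%:R^-1) x)).
have mpsi n : measurable_fun setT (psi n).
  apply: measurable_funM => //; apply: measurable_funB => //.
  by apply: measurableT_comp => //; exact: measurable_tr.
have [] := @dominated_convergence _ _ R leb2 V mV (fun n x => (u x * psi (N n) x)%:E)
  (fun x => (u x * dpart j phi x)%:E) (fun=> (B * k)%:E).
- by move=> n; apply/measurable_EFinP; apply: measurable_funM; [by []|exact: (measurable_funTS (mpsi _))].
- by apply/measurable_EFinP; apply: measurable_funM; [by []|exact: (measurable_funTS mdphi)].
- apply: aeW => x Vx; apply: cvg_EFin; first exact: nearW.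
  apply: cvgM; first exact: cvg_cst.
  rewrite -[X in _ --> X]/(dpart j phi x).
  have : psi ^~ x @ \oo --> dpart j phi x.
    have d1 := has_dpart_pt (dphi j (pt j (vcomp j x) (oc j x))).
    rewrite -{2}(ptE j x) dpart_pt derive1E /derive.
    move/cvgr_dnbhsP: d1 => /(_ (fun n => - n.+1%:R^-1)) H.
    apply: cvg_trans (H _); last first.
      split=> [n|]; first by rewrite oppr_eq0 invr_neq0 // pnatr_eq0.
      by rewrite -[X in _ --> X]oppr0; apply: cvgN; exact: cvg_harmonic.
    apply: near_eq_cvg; near=> n; rewrite /psi /tr /GRing.scale /= mulr1 invrN invrK ptE.
    by rewrite (addrC _ (vcomp j x)); ring.
  by rewrite -(cvg_shiftn N0).
- exact: icst.
- apply: aeW => x n Vx; rewrite lee_fin normrM; apply: ler_pM => //; first exact: uB.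
  rewrite /psi normrM gtr0_norm ?ltr0n // -ler_pdivlMl ?ltr0n // mulrC.
  apply: le_trans (philip _ _) _.
  by rewrite nrmB nrm_tr normrN gtr0_norm // invr_gt0 ltr0n.
move=> _ _ L1.
have [] := @dominated_convergence _ _ R leb2 V mV (fun n x => (q (N n) x * phi x)%:E)
  (fun x => (g x * phi x)%:E) (fun x => (k%:E * (dom x)%:E)%E).
- by move=> n; apply/measurable_EFinP; apply: measurable_funM; [exact: (measurable_funTS (mq _))|exact: (measurable_funTS mphi)].
- by apply/measurable_EFinP; apply: measurable_funM; [by []|exact: (measurable_funTS mphi)].
- have [mb b_0] := bad_null; exists bad; split => // x /= nx.
  apply: contrapT => nb; apply: nx => Vx.
  apply: cvg_EFin; first exact: nearW.
  apply: cvgM; last exact: cvg_cst.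
  by have := q_cvg Vx nb; rewrite -(cvg_shiftn N0).
- exact: integrableZl.
- have [mb b_0] := bad_null; exists bad; split => // x /= nx.
  apply: contrapT => nb; apply: nx => n Vx.
  rewrite -EFinM lee_fin normrM mulrC.
  have [Kx|nK] := pselect (Kc x); last by rewrite phi0 // normr0 mul0r mulr_ge0.
  have [n1 n2] := Nn n.
  apply: ler_pM => //; apply: q_bound => //; last exact: ltW.
  - by rewrite lt_neqAle dd0 andbT eq_sym; apply/eqP => d; apply: nb; left.
  - by apply: (He x) => //; rewrite nrm_tr gtr0_norm // invr_gt0 ltr0n.
move=> _ _ L2.
have L3 : (fun n => - \int[leb2]_(x in V) (q (N n) x * phi x)%:E)%E @ \oo -->
    (- \int[leb2]_(x in V) (g x * phi x)%:E)%E by exact: cvgeN.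
move: L1; have -> : [sequence (\int[leb2]_(x in V) (u x * psi (N n) x)%:E)%E]_n =
    (fun n => - \int[leb2]_(x in V) (q (N n) x * phi x)%:E)%E.
  by apply/funext => n; exact: (summation_by_parts (N n) mphi phik phiV).
move=> L1; exact: (cvg_unique (@ereal_hausdorff R) L1 L3).
Unshelve. all: by end_near. Qed.

Lemma ex_weak_derivative : exists h : R * R -> R, leb2.-integrable V (EFin \o h) /\
  forall phi, test_fun V phi ->
  (\int[leb2]_(x in V) (u x * dpart j phi x)%:E = - \int[leb2]_(x in V) (h x * phi x)%:E)%E.
Proof.
exists g; split; last exact: weak_derivative.
apply: le_integrable idom => //; first exact/measurable_EFinP.
by move=> x _; rewrite lee_fin (le_trans (g_dom x)) // ler_norm.
Qed.

End Direction.
End WeakDerivative.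

Section SBVCriterion.
Variable R : realType.
Notation leb2 := (@leb2 R).

(** The positive and negative parts of the weak gradient are the densities of the two measures.
    Their singular parts are 0, so the condition on the Cantor part reads 0 = 0. *)
Lemma SBV_of_weak_gradient (V : set (R * R)) (u : R * R -> R) : open V ->
  measurable_fun V u -> leb2.-integrable V (EFin \o u) ->
  (forall j, exists h : R * R -> R, leb2.-integrable V (EFin \o h) /\
    forall phi, test_fun V phi ->
    (\int[leb2]_(x in V) (u x * dpart j phi x)%:E = - \int[leb2]_(x in V) (h x * phi x)%:E)%E) ->
  SBV u V.
Proof.
move=> oV mu_ iu /choice [h Hh]; split=> //; split=> //.
have mV : measurable V := open_measurable2 oV.
have mh j : measurable_fun V (h j) by case: (Hh j) => /integrableP [/measurable_EFinP].
pose part (s : bool) j := (fun x => Num.max (if s then h j x else - h j x) 0) \_ V.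
have p0 s j x : 0 <= part s j x.
  by rewrite /part patchE; case: ifP => // _; rewrite le_max lexx orbT.
have mp s j : measurable_fun setT (part s j).
  apply/(measurable_restrictT _ _).1 => //; apply: measurable_maxr => //.
  by case: s => /=; [exact: mh|exact: (measurableT_comp (@oppr_measurable R setT) (mh j))].
have ip s j : leb2.-integrable setT (EFin \o part s j).
  have ih : leb2.-integrable setT ((EFin \o h j) \_ V) by apply/(integrable_mkcond _ _).1 => //; case: (Hh j).
  apply: (le_integrable measurableT _ _ ih). by have := mp s j => /measurable_EFinP.
  move=> x _; rewrite /part /= !patchE; case: ifP => _ //.
  have m0 (a : R) : `|Num.max a 0| <= `|a|.
    by rewrite /Num.max; case: ltP => // _; rewrite normr0.
  by rewrite lee_fin; case: (s); rewrite ?m0 // (le_trans (m0 _)) // normrN.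
have part0 s j x : ~ V x -> part s j x = 0 by move=> nV; rewrite /part patchE memNset.
exists (fun j => borel_density (ip true j) (p0 true j)), (fun j => borel_density (ip false j) (p0 false j)).
split.
  move=> j; split; rewrite borel_densityE; apply: integral0_eq => x nV; by rewrite part0.
split.
  move=> j phi tphi; have [k [k0 _ phik philip]] := test_fun_bounds tphi.
  have mphi : measurable_fun setT phi.
    apply: cont_on_measurable; first exact: openT.
    move=> x _ d d0; exists (d / (k + 1)); first by rewrite divr_gt0 // ltr_wpDl.
    move=> y _; rewrite ltr_pdivlMr ?ltr_wpDl // => hd; apply: le_lt_trans (philip _ _) _.
    by apply: le_lt_trans hd; rewrite mulrC ler_wpM2l ?nrm_ge0 // lerDl.
  rewrite (Hh j).2 //; congr (- _)%E.
  rewrite (integral_borel_density _ _ mphi phik) (integral_borel_density _ _ mphi phik).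
  have ipp s : leb2.-integrable setT (fun x => (phi x * part s j x)%:E).
    have ik : leb2.-integrable setT (fun x => (k%:E * (part s j x)%:E)%E) by have := integrableZl measurableT k (ip s j).
    apply: (le_integrable measurableT _ _ ik).
      by have /measurable_EFinP := measurable_funM mphi (mp s j).
    by move=> x _; rewrite -EFinM lee_fin !normrM ler_pM // (le_trans (phik x)) // ler_norm.
  rewrite -integralB // [LHS]integral_mkcond; congr (integral _ _ _); apply/funext => x.
  rewrite patchE /part /= !patchE -EFinB; case: ifP => _; last by rewrite mulr0 subrr.
  congr (_%:E); rewrite mulrC -mulrBr; congr (_ * _).
  by rewrite /Num.max; case: ltP => h1; case: ltP => h2; move: h1 h2; lra.
move=> j; exists (borel_density (ip true j) (p0 true j)), mzero, (borel_density (ip false j) (p0 false j)), mzero.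
split.
- by split=> A mA; rewrite /mzero /= adde0.
- exact: borel_density_dominates.
- exact: borel_density_dominates.
- by exists set0; split => //; rewrite measure0.
- by [].
Qed.

Lemma lip_measurable (V : set (R * R)) (d : R * R -> R) (K : R) : open V -> 0 <= K ->
  (forall x y, d x - d y <= K * nrm (x - y)) -> measurable_fun V d.
Proof.
move=> oV K0 dK; apply: cont_on_measurable => // x _ e e0.
exists (e / (K + 1)); first by rewrite divr_gt0 // ltr_wpDl.
move=> y _ yx.
have h : K * nrm (y - x) < e.
  rewrite ltr_pdivlMr ?ltr_wpDl // in yx; apply: le_lt_trans yx.
  by rewrite mulrC ler_wpM2l ?nrm_ge0 // lerDl.
by have := dK x y; have := dK y x; rewrite (nrmB x y) ltr_norml; move: h; lra.
Qed.

(** Each curve keeps its own function, because the lower bound along a line has a different centre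
    for each; the inverse square root of the minimum is at most the sum of the two. *)
Lemma SBV_of_weighted_lipschitz (V : set (R * R)) (u d1 d2 : R * R -> R) (j0 : 'I_2)
    (b B C K del c : R) : open V -> 0 < b -> (forall x, V x -> nrm x <= b) ->
  cont_on V u -> 0 <= B -> (forall x, V x -> `|u x| <= B) ->
  0 <= C -> 0 <= K -> (forall x, 0 <= d1 x) -> (forall x, 0 <= d2 x) ->
  (forall x y, d1 x - d1 y <= K * nrm (x - y)) -> (forall x y, d2 x - d2 y <= K * nrm (x - y)) ->
  0 < del -> (forall x y, V x -> V y -> nrm (y - x) <= del -> 0 < Num.min (d1 x) (d2 x) ->
    `|u y - u x| <= C * (1 + invsqrt (Num.min (d1 x) (d2 x))) * nrm (y - x)) ->
  0 < c -> (forall r, exists s0, forall x, V x -> oc j0 x = r -> c * `|vcomp j0 x - s0| <= d1 x) ->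
  (forall r, exists s0, forall x, V x -> oc j0 x = r -> c * `|vcomp j0 x - s0| <= d2 x) ->
  SBV u V.
Proof.
move=> oV b0 Vb cu B0 uB C0 K0 d10 d20 d1K d2K del0 est c0 line1 line2.
have mV : measurable V := open_measurable2 oV.
have mu_ : measurable_fun V u by exact: cont_on_measurable.
have md1 := lip_measurable oV K0 d1K; have md2 := lip_measurable oV K0 d2K.
have [iw1 nul1] := weight_integrable mV b0 c0 Vb md1 line1.
have [iw2 nul2] := weight_integrable mV b0 c0 Vb md2 line2.
pose dd x := Num.min (d1 x) (d2 x).
have dd0 x : 0 <= dd x by rewrite le_min d10 d20.
have ddK x y : dd x - dd y <= K * nrm (x - y).
  have h1 := d1K x y; have h2 := d2K x y; rewrite /dd.
  have [h3|h3] := leP (d1 x) (d2 x); have [h4|h4] := leP (d1 y) (d2 y);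
    by move: h1 h2 h3 h4; lra.
have mdd := lip_measurable oV K0 ddK.
have iw : leb2.-integrable V (fun x => (invsqrt (dd x))%:E).
  have i12 := @integrableD _ _ R leb2 V mV _ _ iw1 iw2.
  apply: le_integrable i12 => //.
    by apply/measurable_EFinP; apply: measurableT_comp => //; exact: measurable_invsqrt.
  move=> x _; rewrite -EFinD lee_fin !ger0_norm ?addr_ge0 ?invsqrt_ge0 // /dd /Num.min.
  by case: ltP => _; rewrite ?lerDl ?lerDr invsqrt_ge0.
have nul : leb2 (V `&` [set x | dd x = 0]) = 0%E.
  have m1 : measurable (V `&` [set x | d1 x = 0]) by apply: (md1 mV [set 0]); exact: measurable_set1.
  have m2 : measurable (V `&` [set x | d2 x = 0]) by apply: (md2 mV [set 0]); exact: measurable_set1.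
  have md : measurable (V `&` [set x | dd x = 0]) by apply: (mdd mV [set 0]); exact: measurable_set1.
  have := measureU2 leb2 m1 m2; rewrite [X in (_ <= X + _)%E]nul1 [X in (_ <= _ + X)%E]nul2 adde0 => h.
  apply/eqP; rewrite eq_le measure_ge0 andbT; apply: le_trans h.
  apply: le_measure; rewrite ?inE //; first exact: measurableU.
  move=> x [Vx]; rewrite /= /dd /Num.min.
  by case: ltP => _ h; [left|right].
apply: SBV_of_weak_gradient => //.
  have leb2V : (leb2 V < +oo)%E by exact: (bounded_leb2 mV b0 Vb).
  have ic : leb2.-integrable V (fun=> B%:E).
    apply/integrableP; split; first exact/measurable_EFinP.
    under eq_integral do rewrite abse_EFin.
    by rewrite integral_cst // lte_mul_pinfty ?lee_fin.
  apply: le_integrable ic => //; first exact/measurable_EFinP.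
  by move=> x Vx; rewrite lee_fin (le_trans (uB x Vx)) // ler_norm.
move=> j; exact: (@ex_weak_derivative R V u dd b B C K del).
Qed.

End SBVCriterion.

(** * Reduction to normal form *)

Section NormalForm.
Variable R : realType.
Implicit Types (x y z : R * R) (j k : 'I_2).

Lemma edist_le_nrm x y : Defs.edist x y <= nrm (x - y).
Proof.
rewrite /Defs.edist /nrm /= -[leRHS]ger0_norm ?addr_ge0 // -sqrtr_sqr ler_sqrt ?sqr_ge0 //.
rewrite -(real_normK (num_real (x.1 - y.1))) -(real_normK (num_real (x.2 - y.2))).
have := mulr_ge0 (normr_ge0 (x.1 - y.1)) (normr_ge0 (x.2 - y.2)); nra.
Qed.

(** Once the linear part is subtracted, the partial derivatives vanish at the origin and are
    Lipschitz, hence are at most |L| nrm z. *)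
Lemma C11_taylor (L a1 a2 : R) (f : R * R -> R) : C11 L f ->
  dpart ord0 f (0, 0) = a1 -> dpart (lift ord0 ord0) f (0, 0) = a2 -> forall x y,
  `|f x - f y - (a1 * (x.1 - y.1) + a2 * (x.2 - y.2))| <= `|L| * (nrm x + nrm y) * nrm (x - y).
Proof.
move=> [df dL] E1 E2 x y.
pose h z := f z - (a1 * z.1 + a2 * z.2).
have -> : f x - f y - (a1 * (x.1 - y.1) + a2 * (x.2 - y.2)) = h x - h y by rewrite /h; ring.
pose a j := if j == ord0 then a1 else a2.
have hE j r : (fun t => h (pt j t r)) = (fun t => f (pt j t r)) \- (fun t => a j * t + (if j == ord0 then a2 else a1) * r).
  apply/funext => t; rewrite /h /pt /a; case: (j == ord0) => /=; ring.
have dlin j (r s : R) : is_derive s 1 (fun t : R => a j * t + (if j == ord0 then a2 else a1) * r) (a j).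
  by apply: is_derive_eq; rewrite /GRing.scale /=; ring.
have dd j (s r : R) : derivable (fun t => h (pt j t r)) s 1 /\ dpart j h (pt j s r) = dpart j f (pt j s r) - a j.
  rewrite dpart_pt (hE j r).
  have d1 := has_dpart_pt (df j (pt j s r)).
  have [dl El] := dlin j r s.
  by split; [exact: derivableB|rewrite derive1E deriveB // El dpart_pt derive1E].
apply: dpart_lip.
  move=> j z; rewrite -(ptE j z); have [d _] := dd j (vcomp j z) (oc j z).
  by move: d; rewrite /has_dpart /pt; case: (j == ord0).
move=> j z zxy; rewrite -(ptE j z) (dd j _ _).2 ptE.
have -> : a j = dpart j f (0, 0) by rewrite /a; elim/I2_case: j.
apply: le_trans (dL _ _ _) _; apply: le_trans (ler_wpM2l _ zxy) => //.
apply: le_trans (_ : `|L| * Defs.edist z (0, 0) <= _).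
  by rewrite ler_wpM2r ?ler_norm // sqrtr_ge0.
by rewrite ler_wpM2l // (le_trans (edist_le_nrm _ _)) // (_ : (0, 0) = 0 :> R * R) // subr0.
Qed.

Lemma vcomp_zero k : vcomp k (0 : R * R) = 0.
Proof. by rewrite /vcomp; case: ifP. Qed.

Section System.
Variables (M : nat) (E al be : R) (f : R * R -> R * R) (g : 'I_M -> R * R -> R * R).
Hypothesis E0 : 0 <= E.
Hypothesis f0 : f 0 = 0.
(** DF(0) in the basis p, q = A p with p an input vector: its first column is (0, 1) since A p = q,
    and (al, be) are the coordinates of A q. *)
Definition lin2 (al be : R) k z := if k == ord0 then al * z.2 else z.1 + be * z.2.
Hypothesis fE : forall k z z', `|vcomp k (f z') - vcomp k (f z) - lin2 al be k (z' - z)| <=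
  E * (nrm z + nrm z') * nrm (z' - z).
Hypothesis gE : forall i k z z', `|vcomp k (g i z') - vcomp k (g i z)| <=
  E * (nrm z + nrm z') * nrm (z' - z).
Variable La : R.
Hypothesis La1 : 1 + `|al| + `|be| + 2 * E * (1 + M%:R) + \sum_i nrm (g i 0) <= La.

Let S0 : 0 <= \sum_i nrm (g i 0). Proof. by apply: sumr_ge0 => i _; exact: nrm_ge0. Qed.

(** The terms are the drift increment, the input increments at fixed control, and the control
    increment acting at the origin and away from it; the last is quadratic in nrm z by [gE]. *)
Let dyn_expand k z z' w w' : dyn f g k z' w' - dyn f g k z w =
  (vcomp k (f z') - vcomp k (f z)) + \sum_i w' i * (vcomp k (g i z') - vcomp k (g i z))
  + \sum_i (w' i - w i) * vcomp k (g i 0)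
  + \sum_i (w' i - w i) * (vcomp k (g i z) - vcomp k (g i 0)).
Proof.
have H : \sum_i w' i * vcomp k (g i z') - \sum_i w i * vcomp k (g i z) =
    \sum_i w' i * (vcomp k (g i z') - vcomp k (g i z)) + \sum_i (w' i - w i) * vcomp k (g i 0)
    + \sum_i (w' i - w i) * (vcomp k (g i z) - vcomp k (g i 0)).
  by rewrite -sumrB -!big_split /=; apply: eq_bigr => i _; ring.
rewrite /dyn; move: H.
set s1 := \sum_i w' i * vcomp k (g i z'); set s2 := \sum_i w i * vcomp k (g i z).
set s3 := \sum_i w' i * _; set s4 := \sum_i (w' i - w i) * vcomp k (g i 0); set s5 := \sum_i _ * _ => H.
have -> : s1 = s2 + (s3 + s4 + s5) by rewrite -H; ring.
by ring.
Qed.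

Let wsum k z z' w' : box w' ->
  `|\sum_i w' i * (vcomp k (g i z') - vcomp k (g i z))| <= E * M%:R * (nrm z + nrm z') * nrm (z' - z).
Proof.
move=> bw; apply: le_trans (ler_norm_sum _ _ _) _.
apply: le_trans (_ : \sum_(i < M) E * (nrm z + nrm z') * nrm (z' - z) <= _).
  apply: ler_sum => i _; rewrite normrM -[leRHS]mul1r; apply: ler_pM => //.
  by rewrite ler_norml; exact: bw.
by rewrite sumr_const card_ord -mulr_natl; lra.
Qed.

Let dsum k z w w' : `|\sum_i (w' i - w i) * (vcomp k (g i z) - vcomp k (g i 0))| <=
  E * nrm z ^+ 2 * \sum_i `|w' i - w i|.
Proof.
apply: le_trans (ler_norm_sum _ _ _) _; rewrite mulr_sumr; apply: ler_sum => i _.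
rewrite normrM mulrC ler_wpM2r //; apply: le_trans (gE _ _ _ _) _.
by rewrite nrm0 add0r subr0 expr2 mulrA.
Qed.

Let La_ge : 0 <= `|al| /\ 0 <= `|be| /\ 0 <= E * M%:R.
Proof. by rewrite !normr_ge0 mulr_ge0. Qed.

Lemma normal_form_basic : basic_sys La f g.
Proof.
have [a0 [b0 EM]] := La_ge.
split.
- by move: La1 S0 E0 a0 b0 EM; lra.
- move=> k z z' w z1 z1' bw; rewrite dyn_expand [X in _ + _ + X + _]big1; last by move=> i _; rewrite subrr mul0r.
  rewrite [X in _ + X]big1; last by move=> i _; rewrite subrr mul0r.
  rewrite !addr0.
  set u := \sum_i _; have := wsum k z' z bw; rewrite -/u => hu.
  have hf := fE k z' z.
  have hl : `|lin2 al be k (z - z')| <= (1 + `|al| + `|be|) * nrm (z - z').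
    rewrite /lin2 /nrm; move: (z - z') => v.
    have n1 := normr_ge0 v.1; have n2 := normr_ge0 v.2.
    case: (k == ord0); first by rewrite normrM; nra.
    by apply: le_trans (ler_normD _ _) _; rewrite normrM; nra.
  have nn := nrm_ge0 (z - z').
  have b1 : E * (nrm z' + nrm z) * nrm (z - z') <= 2 * E * nrm (z - z').
    by rewrite ler_wpM2r // mulrC ler_wpM2r //; lra.
  have b2 : E * M%:R * (nrm z' + nrm z) * nrm (z - z') <= 2 * (E * M%:R) * nrm (z - z').
    by rewrite ler_wpM2r // mulrC ler_wpM2r //; lra.
  have b3 := ler_wpM2r nn La1; have b4 := mulr_ge0 S0 nn.
  set p := vcomp k (f z) - vcomp k (f z') in hf *; set l := lin2 _ _ _ _ in hf hl.
  have -> : p + u = (p - l) + l + u by ring.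
  apply: le_trans (ler_normD _ _) _; have := ler_normD (p - l) l.
  by move: hf hl hu b1 b2 b3 b4; lra.
- move=> k w bw; rewrite /dyn f0 vcomp_zero add0r; apply: le_trans (ler_norm_sum _ _ _) _.
  apply: le_trans (_ : \sum_i nrm (g i 0) <= _); last by move: La1 E0 a0 b0 EM; lra.
  apply: ler_sum => i _; rewrite normrM -[leRHS]mul1r; apply: ler_pM => //.
    by rewrite ler_norml; exact: bw.
  exact: vcomp_nrm.
Qed.

Lemma normal_form_planar (ka : 'I_M -> R) : (forall i, g i 0 = (ka i, 0)) -> planar_sys La ka f g.
Proof.
move=> g0; have [a0 [b0 EM]] := La_ge.
have nrmg i : nrm (g i 0) = `|ka i| by rewrite g0 /nrm /= normr0 addr0.
have Lp : E * (1 + M%:R) <= La /\ E <= La by move: La1 S0 E0 a0 b0 EM; lra.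
split.
- exact: normal_form_basic.
- have -> : \sum_i `|ka i| = \sum_i nrm (g i 0) by apply: eq_bigr => i _; rewrite nrmg.
  by move: La1 E0 a0 b0 EM; lra.
- by move=> k; rewrite dyn0 f0 vcomp_zero.
- move=> z z' w w' z1 z1' bw bw'; rewrite dyn_expand.
  have -> : \sum_i (w' i - w i) * vcomp ord0 (g i 0) = \sum_i ka i * (w' i - w i).
    by apply: eq_bigr => i _; rewrite g0 mulrC.
  have hf := fE ord0 z z'; have hu := wsum ord0 z z' bw'; have hd := dsum ord0 z w w'.
  set p := vcomp _ _ - vcomp _ _ in hf *; set l := lin2 _ _ _ _ in hf.
  set u := \sum_i w' i * _ in hu *; set v := \sum_i ka i * _; set y := \sum_i _ * (_ - _) in hd *.
  have nn := nrm_ge0 (z' - z).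
  have hl : `|l| <= `|al| * nrm (z' - z).
    by rewrite /l /lin2 /= normrM ler_wpM2l // /nrm lerDr.
  have b1 : E * (nrm z + nrm z') * nrm (z' - z) <= 2 * E * nrm (z' - z).
    by rewrite ler_wpM2r // mulrC ler_wpM2r //; lra.
  have b2 : E * M%:R * (nrm z + nrm z') * nrm (z' - z) <= 2 * (E * M%:R) * nrm (z' - z).
    by rewrite ler_wpM2r // mulrC ler_wpM2r //; lra.
  have b3 := ler_wpM2r nn La1; have b4 := mulr_ge0 S0 nn; have b5 := mulr_ge0 b0 nn.
  have b6 : E * nrm z ^+ 2 * (\sum_i `|w' i - w i|) <= La * nrm z ^+ 2 * \sum_i `|w' i - w i|.
    by rewrite ler_wpM2r ?sumr_ge0 // ler_wpM2r ?sqr_ge0 // Lp.2.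
  have -> : p + u + v + y - v = (p - l) + l + u + y by ring.
  apply: le_trans (ler_normD _ _) _.
  have := ler_normD (p - l + l) u; have := ler_normD (p - l) l.
  by move: hf hl hu hd b1 b2 b3 b4 b5 b6; lra.
- move=> z z' w w' z1 z1' bw bw'; rewrite dyn_expand.
  have v0 : \sum_i (w' i - w i) * vcomp (lift ord0 ord0) (g i 0) = 0.
    by rewrite big1 // => i _; rewrite g0 /vcomp /= mulr0.
  rewrite v0.
  pose k1 : 'I_2 := lift ord0 ord0.
  have hf := fE k1 z z'; have hu := wsum k1 z z' bw'; have hd := dsum k1 z w w'.
  rewrite -/k1; set p := vcomp _ _ - vcomp _ _ in hf *; set l := lin2 _ _ _ _ in hf.
  set u := \sum_i w' i * _ in hu *; set y := \sum_i _ * (_ - _) in hd *.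
  have nn := nrm_ge0 (z' - z).
  have El : l = (z'.1 - z.1) + be * (z'.2 - z.2) by [].
  have hb : `|be * (z'.2 - z.2)| <= La * `|z'.2 - z.2|.
    by rewrite normrM ler_wpM2r //; move: La1 S0 E0 a0 b0 EM; lra.
  have b1 : E * (1 + M%:R) * ((nrm z + nrm z') * nrm (z' - z)) <= La * ((nrm z + nrm z') * nrm (z' - z)).
    by rewrite ler_wpM2r ?Lp.1 // mulr_ge0 // addr_ge0 // nrm_ge0.
  have b6 : E * nrm z ^+ 2 * (\sum_i `|w' i - w i|) <= La * nrm z ^+ 2 * \sum_i `|w' i - w i|.
    by rewrite ler_wpM2r ?sumr_ge0 // ler_wpM2r ?sqr_ge0 // Lp.2.
  have -> : p + u + 0 + y - (z'.1 - z.1) = (p - l) + be * (z'.2 - z.2) + u + y by rewrite El; ring.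
  apply: le_trans (ler_normD _ _) _.
  have := ler_normD (p - l + be * (z'.2 - z.2)) u; have := ler_normD (p - l) (be * (z'.2 - z.2)).
  by move: hf hu hd hb b1 b6; lra.
Qed.

End System.
End NormalForm.

Section LinearChange.
Variables (R : realType) (M : nat).
Implicit Types (z : R * R).

Definition lmap (a b c d : R) z : R * R := (a * z.1 + b * z.2, c * z.1 + d * z.2).

Lemma vcomp_lmap a b c d k z : vcomp k (lmap a b c d z) =
  (if k == ord0 then a else c) * vcomp ord0 z + (if k == ord0 then b else d) * vcomp (lift ord0 ord0) z.
Proof. by rewrite /vcomp /lmap; case: (k == ord0). Qed.

Lemma nrm_lmap a b c d z z' :
  nrm (lmap a b c d z - lmap a b c d z') <= (`|a| + `|b| + `|c| + `|d|) * nrm (z - z').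
Proof.
have -> : lmap a b c d z - lmap a b c d z' = lmap a b c d (z - z').
  by rewrite /lmap; congr (_, _) => /=; ring.
move: (z - z') => [p q]; rewrite /nrm /=.
apply: le_trans (lerD (ler_normD _ _) (ler_normD _ _)) _; rewrite !normrM.
have := mulr_ge0 (normr_ge0 a) (normr_ge0 q); have := mulr_ge0 (normr_ge0 b) (normr_ge0 p).
have := mulr_ge0 (normr_ge0 c) (normr_ge0 q); have := mulr_ge0 (normr_ge0 d) (normr_ge0 p).
by lra.
Qed.

Section Transfer.
Variables (a b c d : R) (F1 F2 : R * R -> R * R) (G1 G2 : 'I_M -> R * R -> R * R).
Notation S := (lmap a b c d).
Hypothesis FS : forall z, F2 (S z) = S (F1 z).
Hypothesis GS : forall i z, G2 i (S z) = S (G1 i z).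

Lemma dyn_lmap k z w : dyn F2 G2 k (S z) w =
  (if k == ord0 then a else c) * dyn F1 G1 ord0 z w +
  (if k == ord0 then b else d) * dyn F1 G1 (lift ord0 ord0) z w.
Proof.
rewrite /dyn FS vcomp_lmap.
under eq_bigr => i _ do rewrite GS vcomp_lmap mulrDr.
rewrite big_split /= !mulrDr !mulr_sumr addrACA; congr (_ + _ + (_ + _)).
- by apply: eq_bigr => i _; rewrite mulrCA.
- by apply: eq_bigr => i _; rewrite mulrCA.
Qed.

Lemma reach_time_lmap z t : reach_time F1 G1 z t -> reach_time F2 G2 (S z) t.
Proof.
move=> [t0 [u [x [au [tx xt]]]]]; split => //; exists u, (S \o x); split => //; split; last first.
  by rewrite /= xt /lmap /= !mulr0 addr0.
move=> s st k; have [I1 E1] := tx s st ord0; have [I2 E2] := tx s st (lift ord0 ord0).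
have -> : (fun r => dyn F2 G2 k ((S \o x) r) (u r)) =
    (fun r => (if k == ord0 then a else c) * dyn F1 G1 ord0 (x r) (u r) +
      (if k == ord0 then b else d) * dyn F1 G1 (lift ord0 ord0) (x r) (u r)).
  by apply/funext => r; rewrite /= dyn_lmap.
have J1 := IGZ (if k == ord0 then a else c) (I1 : IG 0 s _).
have J2 := IGZ (if k == ord0 then b else d) (I2 : IG 0 s _).
split; first exact: (IGD J1 J2).
have := IID J1 J2; rewrite (IIZ _ (I1 : IG 0 s _)) (IIZ _ (I2 : IG 0 s _)) /II => ->.
by rewrite [vcomp k _]/= !vcomp_lmap E1 E2 !mulrDr addrACA.
Qed.

End Transfer.
End LinearChange.

(** * From reachability estimates to regularity of the minimum time *)

Section MinTime.
Variables (R : realType) (M : nat) (F : R * R -> R * R) (G : 'I_M -> R * R -> R * R).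
Notation rt := (reach_time F G).
Notation T x := (fine (min_time F G x)).

Lemma min_time_ge0 x : (0 <= min_time F G x)%E.
Proof. by apply: le_ereal_inf_tmp => _ [t [t0 _] <-]; rewrite lee_fin. Qed.

Lemma min_time_fin x (tau : R) : reach_set F G tau x ->
  [/\ min_time F G x = (T x)%:E, 0 <= T x & T x <= tau].
Proof.
rewrite /reach_set /= => h; have h0 := min_time_ge0 x.
have fin : min_time F G x \is a fin_num.
  by rewrite ge0_fin_numE // (le_lt_trans h) // ltry.
by move: h h0; rewrite -(fineK fin) !lee_fin.
Qed.

Lemma min_time_approx x (tau e : R) : reach_set F G tau x -> 0 < e ->
  exists2 t, t < T x + e & rt x t.
Proof.
move=> /min_time_fin [E _ _] e0.
have fin : min_time F G x \is a fin_num by rewrite E.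
have [_ [t rt <-]] := lb_ereal_inf_adherent e0 fin.
by rewrite -/(min_time F G x) E -EFinD lte_fin => h; exists t.
Qed.

Lemma min_time_le x (tau t : R) : reach_set F G tau x -> rt x t -> T x <= t.
Proof.
move=> /min_time_fin [E _ _] h; rewrite -lee_fin -E.
by apply: ereal_inf_lbound; exists t.
Qed.

(** Near-optimal times for x can be taken below T0 because T x <= tau < T0, so the reachability
    estimate applies to them; half of the tolerance e is left for that estimate. *)
Lemma min_time_increment x y (tau T0 w : R) : reach_set F G tau x -> reach_set F G tau y -> tau < T0 ->
  (forall t e, rt x t -> t <= T0 -> 0 < e -> exists2 t', t' <= t + w + e & rt y t') ->
  T y <= T x + w.
Proof.
move=> rx ry tT0 H; apply/ler_addgt0Pr => e e0.
have [_ _ xtau] := min_time_fin rx.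
have e1 : 0 < Num.min (e / 2) (T0 - tau) by rewrite lt_min subr_gt0 tT0 divr_gt0.
have [t tT rxt] := min_time_approx rx e1.
have m1 : Num.min (e / 2) (T0 - tau) <= e / 2 by rewrite ge_min lexx.
have m2 : Num.min (e / 2) (T0 - tau) <= T0 - tau by rewrite ge_min lexx orbT.
have [|t' t'w ryt] := H t (e / 2) rxt _ ltac:(lra); first by lra.
by apply: le_trans (min_time_le ry ryt) _; lra.
Qed.

Section Regularity.
Variables (d1 d2 : R * R -> R) (j0 : 'I_2) (tau T0 del Ch Cn K : R).
Hypotheses (tau0 : 0 <= tau) (tauT : tau < T0) (del0 : 0 < del) (Ch0 : 0 <= Ch) (Cn0 : 0 <= Cn).
Hypotheses (K1 : 1 <= K) (d10 : forall x, 0 <= d1 x) (d20 : forall x, 0 <= d2 x).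
Hypotheses (d1K : forall x y, d1 x - d1 y <= K * nrm (x - y)).
Hypotheses (d2K : forall x y, d2 x - d2 y <= K * nrm (x - y)).
Notation dd x := (Num.min (d1 x) (d2 x)).
Hypothesis holder : forall x y t, rt x t -> t <= T0 -> nrm (y - x) <= del ->
  exists2 t', t' <= t + Ch * Num.sqrt (nrm (y - x)) & rt y t'.
Hypothesis near : forall x y t e, rt x t -> t <= T0 -> nrm (y - x) <= del -> 0 < dd x -> 0 < e ->
  exists2 t', t' <= t + Cn * nrm (y - x) * (1 + invsqrt (dd x)) + e & rt y t'.

Let T_holder x y : reach_set F G tau x -> reach_set F G tau y -> nrm (y - x) <= del ->
  `|T y - T x| <= Ch * Num.sqrt (nrm (y - x)).
Proof.
move=> rx ry xy.
have h1 : T y <= T x + Ch * Num.sqrt (nrm (y - x)).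
  apply: (min_time_increment rx ry tauT) => t e rxt tT e0.
  by have [t' ? ?] := holder rxt tT xy; exists t' => //; lra.
have h2 : T x <= T y + Ch * Num.sqrt (nrm (y - x)).
  apply: (min_time_increment ry rx tauT) => t e rxt tT e0.
  rewrite nrmB in xy *.
  by have [t' ? ?] := holder rxt tT xy; exists t' => //; lra.
by rewrite ler_norml; lra.
Qed.

Let ddK x y : dd x - dd y <= K * nrm (x - y).
Proof.
have h1 := d1K x y; have h2 := d2K x y.
have [h3|h3] := leP (d1 x) (d2 x); have [h4|h4] := leP (d1 y) (d2 y);
  by move: h1 h2 h3 h4; lra.
Qed.

(* Beyond the distance [dd x / (2 K)] the weight at [y] is not controlled by the weight at [x],
   but there the Hoelder bound is already as strong as the weighted Lipschitz bound. *)
Let T_weighted x y : reach_set F G tau x -> reach_set F G tau y -> nrm (y - x) <= del -> 0 < dd x ->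
  `|T y - T x| <= (2 * Cn + 2 * K * Ch) * (1 + invsqrt (dd x)) * nrm (y - x).
Proof.
move=> rx ry xy dx; set n := nrm (y - x).
have n0 : 0 <= n by exact: nrm_ge0.
have w0 := invsqrt_ge0 (dd x).
have [far|close] := leP (dd x) (2 * K * n).
  apply: le_trans (T_holder rx ry xy) _; rewrite -/n.
  have np : 0 < n.
    by rewrite -(@pmulr_rgt0 _ (2 * K)) ?(lt_le_trans dx far) //; move: K1; lra.
  have hs : Num.sqrt n <= 2 * K * (invsqrt (dd x) * n).
    have sd : 0 < Num.sqrt (dd x) by rewrite sqrtr_gt0.
    have -> : invsqrt (dd x) = (Num.sqrt (dd x))^-1 by rewrite /invsqrt gtr0_norm.
    rewrite mulrCA ler_pdivlMl // -[X in _ <= _ * X](sqr_sqrtr n0) expr2 mulrA ler_wpM2r ?sqrtr_ge0 //.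
    apply: le_trans (_ : Num.sqrt (2 * K * n) <= _); first by rewrite ler_sqrt // mulr_ge0 //; move: K1; lra.
    rewrite sqrtrM; last by move: K1; lra.
    rewrite ler_wpM2r ?sqrtr_ge0 // -[leRHS]ger0_norm; last by move: K1; lra.
    rewrite -sqrtr_sqr ler_sqrt ?sqr_ge0 // expr2; apply: ler_peMl; move: K1; lra.
  have p1 := mulr_ge0 Cn0 (mulr_ge0 (addr_ge0 ler01 w0) n0).
  have p2 := mulr_ge0 (mulr_ge0 (le_trans ler01 K1) Ch0) n0.
  have p3 := ler_wpM2l Ch0 hs; move: p1 p2 p3; lra.
have dy : dd x / 2 <= dd y.
  by have := ddK x y; rewrite (nrmB x y) -/n; move: close; lra.
have dyp : 0 < dd y by apply: lt_le_trans dy; rewrite divr_gt0.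
have wy : invsqrt (dd y) <= 2 * invsqrt (dd x).
  have sd : 0 < Num.sqrt (dd x) by rewrite sqrtr_gt0.
  have sy : 0 < Num.sqrt (dd y) by rewrite sqrtr_gt0.
  rewrite /invsqrt !gtr0_norm // -ler_pdivrMl // -invfM lef_pV2 ?posrE ?mulr_gt0 //.
  have -> : 2 = Num.sqrt (2 ^+ 2) :> R by rewrite sqrtr_sqr ger0_norm.
  rewrite -sqrtrM ?sqr_ge0 // ler_sqrt ?mulr_ge0 ?sqr_ge0 ?(ltW dyp) //.
  by rewrite expr2; move: dy dyp; lra.
have h1 : T y <= T x + Cn * n * (1 + invsqrt (dd x)).
  by apply: (min_time_increment rx ry tauT) => t e rxt tT e0; exact: near.
have h2 : T x <= T y + Cn * n * (1 + invsqrt (dd y)).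
  apply: (min_time_increment ry rx tauT) => t e rxt tT e0.
  by rewrite /n nrmB; apply: near => //; rewrite nrmB.
have Cn1 := mulr_ge0 Cn0 n0.
have h3 := ler_wpM2l Cn1 wy.
have p1 := mulr_ge0 Cn1 w0.
have p2 := mulr_ge0 (mulr_ge0 (mulr_ge0 (le_trans ler01 K1) Ch0) n0) (addr_ge0 ler01 w0).
by rewrite ler_norml; move: h1 h2 h3 p1 p2 Cn1; lra.
Qed.

Lemma SBV_loc_min_time : (forall b, 0 < b -> exists2 c, 0 < c & forall r,
    (exists s0, forall x, reach_set F G tau x -> nrm x <= b -> oc j0 x = r -> c * `|vcomp j0 x - s0| <= d1 x) /\
    (exists s0, forall x, reach_set F G tau x -> nrm x <= b -> oc j0 x = r -> c * `|vcomp j0 x - s0| <= d2 x)) ->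
  SBV_loc (fine \o min_time F G) (interior (reach_set F G tau)).
Proof.
move=> line V oV cV VO.
have Vr x : V x -> reach_set F G tau x.
  by move=> /(@subset_closure _ V) /VO /interior_subset.
have [b b0 Vb'] := compact_nrm_bounded cV.
have Vb x : V x -> nrm x <= b by move=> /(@subset_closure _ V) /Vb'.
have [c c0 Hc] := line b b0.
have K0 : 0 <= K by apply: le_trans K1.
apply: (@SBV_of_weighted_lipschitz R V (fine \o min_time F G) d1 d2 j0 b tau (2 * Cn + 2 * K * Ch) K del c) => //.
- move=> x Vx e e0.
  exists (Num.min del ((e / (Ch + 1)) ^+ 2)).
    by rewrite lt_min del0 exprn_gt0 // divr_gt0 // ltr_wpDl.
  move=> y Vy; rewrite lt_min => /andP[h1 h2].
  apply: le_lt_trans (T_holder (Vr _ Vx) (Vr _ Vy) (ltW h1)) _.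
  have h3 : Num.sqrt (nrm (y - x)) < e / (Ch + 1).
    rewrite -[ltRHS]ger0_norm ?divr_ge0 ?addr_ge0 ?(ltW e0) // -sqrtr_sqr ltr_sqrt //.
    by rewrite exprn_gt0 // divr_gt0 // ltr_wpDl.
  rewrite ltr_pdivlMr ?ltr_wpDl // in h3.
  by apply: le_lt_trans h3; rewrite mulrC ler_wpM2l ?sqrtr_ge0 // lerDl.
- move=> x /Vr /min_time_fin [_ h1 h2]; by rewrite ger0_norm.
- by rewrite addr_ge0 // !mulr_ge0.
- by move=> x y Vx Vy xy dx; apply: T_weighted => //; exact: Vr.
- by move=> r; have [[s0 Hs] _] := Hc r; exists s0 => x Vx; apply: Hs; [exact: Vr|exact: Vb].
- by move=> r; have [_ [s0 Hs]] := Hc r; exists s0 => x Vx; apply: Hs; [exact: Vr|exact: Vb].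
Qed.

End Regularity.
End MinTime.

Section CurveDistance.
Variable R : realType.
Implicit Types (z : R * R) (X : R -> R * R).

Definition cdist (T : R) X z := inf [set nrm (z - X s) | s in [set s | `|s| <= T]].

Variables (T : R) (X : R -> R * R).
Hypothesis T0 : 0 <= T.

Let has_inf_cdist z : has_inf [set nrm (z - X s) | s in [set s | `|s| <= T]].
Proof.
split; first by exists (nrm (z - X 0)), 0 => //=; rewrite normr0.
by exists 0 => _ [s _ <-]; exact: nrm_ge0.
Qed.

Lemma cdist_ge0 z : 0 <= cdist T X z.
Proof.
apply: lb_le_inf; first by case: (has_inf_cdist z).
by move=> _ [s _ <-]; exact: nrm_ge0.
Qed.

Lemma cdist_le z s : `|s| <= T -> cdist T X z <= nrm (z - X s).
Proof. by move=> sT; apply: ge_inf; [case: (has_inf_cdist z)|exists s]. Qed.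

Lemma cdist_approx z e : 0 < e -> exists2 s, `|s| <= T & nrm (z - X s) < cdist T X z + e.
Proof.
move=> e0; have [_ [s sT <-] h] := inf_adherent e0 (has_inf_cdist z).
by exists s.
Qed.

Lemma cdist_lip z z' : cdist T X z - cdist T X z' <= nrm (z - z').
Proof.
rewrite lerBlDr; apply/ler_addgt0Pr => e e0.
have [s sT h] := cdist_approx z' e0.
have := cdist_le z sT; have := nrmD (z - z') (z' - X s).
have -> : z - z' + (z' - X s) = z - X s by rewrite addrA subrK.
by move: h; lra.
Qed.

(** If both points were close to the curve, h n would be close to a chord; chords have slope at most
    eta / k, and n is at least twice as steep. *)
Lemma cdist_line k eta n z z' h : 0 < k -> thin_curve k eta T X -> 0 <= eta -> eta <= k ->
  2 * eta * `|n.1| <= k * `|n.2| -> z' - z = (h * n.1, h * n.2) ->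
  `|h| * `|n.2| <= 4 * (cdist T X z + cdist T X z').
Proof.
move=> k0 thin eta0 etak etan zz'; apply/ler_addgt0Pr => e e0.
have e8 : 0 < e / 8 by rewrite divr_gt0.
have [s sT hs] := cdist_approx z e8; have [s' s'T hs'] := cdist_approx z' e8.
have [h1 h2] := thin _ _ sT s'T.
set D := X s' - X s in h1 h2.
have hE : nrm (z' - z - D) <= cdist T X z + cdist T X z' + e / 4.
  have -> : z' - z - D = (z' - X s') + (X s - z).
    by rewrite /D opprB addrACA [RHS]addrACA (addrC (- z)).
  by apply: le_trans (nrmD _ _) _; rewrite (nrmB (X s)); move: hs hs'; lra.
rewrite zz' /nrm /= in hE.
set E := cdist T X z + cdist T X z' + e / 4 in hE.
have a1 : `|D.1| <= `|h| * `|n.1| + `|h * n.1 - D.1|.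
  by rewrite -normrM; have := ler_normB (h * n.1) (h * n.1 - D.1); rewrite opprB addrC subrK.
have a2 : `|h| * `|n.2| <= `|D.2| + `|h * n.2 - D.2|.
  by rewrite -normrM; have := ler_normD D.2 (h * n.2 - D.2); rewrite addrC subrK.
have b1 := normr_ge0 (h * n.1 - D.1); have b2 := normr_ge0 (h * n.2 - D.2).
have c1 := ler_wpM2l eta0 h1.
have c2 := ler_wpM2l (ltW k0) h2.
have c3 := ler_wpM2l eta0 a1.
have c4 := ler_wpM2l (ltW k0) a2.
have c5 := ler_wpM2l (normr_ge0 h) etan.
have E0 : 0 <= E by move: hE b1 b2; lra.
have c6 := ler_wpM2l eta0 (_ : `|h * n.1 - D.1| <= E); have {}c6 := c6 ltac:(lra).
have c7 := ler_wpM2l (ltW k0) (_ : `|h * n.2 - D.2| <= E); have {}c7 := c7 ltac:(lra).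
have c8 := ler_wpM2r E0 etak.
have fin : k * (`|h| * `|n.2|) <= k * (4 * E).
  set u := `|h| in a1 a2 c3 c4 c5 *; set n1 := `|n.1| in c3 c5; set n2 := `|n.2| in c4 c5 *.
  by move: c1 c2 c3 c4 c5 c6 c7 c8; lra.
by move: fin; rewrite ler_pM2l // /E; lra.
Qed.

End CurveDistance.

Section Regular.
Variable R : realType.

(** Interface between the dynamics and the measure theory. Transversality to the curves is stated
    through pairs of points, without naming the curves, and a constant d is allowed too. T0, del, Ch
    and Cn are parameters because they are fixed before the system. *)
Definition regular_reach (M : nat) (f : R * R -> R * R) (g : 'I_M -> R * R -> R * R)
    (n : R * R) (T0 del Ch Cn : R) : Prop :=
  exists d : bool -> R * R -> R,
  [/\ (forall s z, 0 <= d s z) /\ (forall s z z', d s z - d s z' <= nrm (z - z')),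
    forall b, 0 < b -> exists2 c, 0 < c & forall s z z' h, `|h| <= b ->
      z' - z = (h * n.1, h * n.2) -> c * `|h| <= d s z + d s z',
    forall z z' t, reach_time f g z t -> t <= T0 -> nrm (z' - z) <= del ->
      exists2 t', t' <= t + Ch * Num.sqrt (nrm (z' - z)) & reach_time f g z' t' &
    forall z z' t e, reach_time f g z t -> t <= T0 -> nrm (z' - z) <= del ->
      0 < Num.min (d true z) (d false z) -> 0 < e ->
      exists2 t', t' <= t + Cn * nrm (z' - z) * (1 + invsqrt (Num.min (d true z) (d false z))) + e
        & reach_time f g z' t'].

Lemma regular_SBV (M : nat) (F f : R * R -> R * R) (G g : 'I_M -> R * R -> R * R)
    (a b c d a' b' c' d' T0 del Ch Cn tau : R) (j : 'I_2) :
  cancel (lmap a b c d) (lmap a' b' c' d') -> cancel (lmap a' b' c' d') (lmap a b c d) ->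
  (forall z, f z = lmap a b c d (F (lmap a' b' c' d' z))) ->
  (forall i z, g i z = lmap a b c d (G i (lmap a' b' c' d' z))) ->
  regular_reach f g (lmap a b c d (pt j 1 0)) T0 del Ch Cn -> 0 < del -> 0 <= Ch -> 0 <= Cn ->
  0 <= tau -> tau < T0 -> SBV_loc (fine \o min_time F G) (interior (reach_set F G tau)).
Proof.
set Q := lmap a b c d; set P := lmap a' b' c' d'.
move=> QK PK fE gE [dd [[dd0 ddl] line hold nr]] del0 Ch0 Cn0 tau0 tauT.
have toQ x t : reach_time F G x t -> reach_time f g (Q x) t.
  by apply: reach_time_lmap => [z|i z]; rewrite ?fE ?gE -/Q -/P QK.
have toP x t : reach_time f g (Q x) t -> reach_time F G x t.
  rewrite -{2}(QK x) -/P; apply: reach_time_lmap => [z|i z]; rewrite ?fE ?gE -/Q -/P QK //.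
pose K := 1 + (`|a| + `|b| + `|c| + `|d|).
have K1 : 1 <= K by rewrite lerDl !addr_ge0.
have K0 : 0 <= K by apply: le_trans K1.
have QL x y : nrm (Q x - Q y) <= K * nrm (x - y).
  by apply: le_trans (nrm_lmap _ _ _ _ _ _) _; rewrite ler_wpM2r ?nrm_ge0 // lerDr.
have ddK s x y : dd s (Q x) - dd s (Q y) <= K * nrm (x - y) by apply: le_trans (ddl _ _ _) (QL _ _).
have QD x y : nrm (y - x) <= del / K -> nrm (Q y - Q x) <= del.
  move=> h; apply: le_trans (QL _ _) _; rewrite mulrC -ler_pdivlMr //.
  exact: lt_le_trans K1.
apply: (@SBV_loc_min_time R M F G (dd true \o Q) (dd false \o Q) j tau T0 (del / K) (Ch * K) (Cn * K) K) => //.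
- by rewrite divr_gt0 // (lt_le_trans ltr01).
- exact: mulr_ge0.
- exact: mulr_ge0.
- by move=> x; exact: dd0.
- by move=> x; exact: dd0.
- by move=> x y; exact: ddK.
- by move=> x y; exact: ddK.
- move=> x y t rx tT xy; have [t' t'l rt'] := hold _ _ _ (toQ _ _ rx) tT (QD _ _ xy).
  exists t'; last exact: toP.
  apply: le_trans t'l _; rewrite lerD2l -mulrA ler_wpM2l //.
  apply: le_trans (_ : Num.sqrt (K * nrm (y - x)) <= _).
    by rewrite ler_sqrt ?mulr_ge0 ?nrm_ge0.
  rewrite sqrtrM // ler_wpM2r ?sqrtr_ge0 // -[leRHS]ger0_norm // -sqrtr_sqr ler_sqrt ?sqr_ge0 //.
  by rewrite expr2 ler_peMl.
- move=> x y t e rx tT xy dx e0; have [t' t'l rt'] := nr _ _ _ _ (toQ _ _ rx) tT (QD _ _ xy) dx e0.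
  exists t'; last exact: toP.
  apply: le_trans t'l _; rewrite lerD2r lerD2l ler_wpM2r ?addr_ge0 ?invsqrt_ge0 // -mulrA ler_wpM2l //.
move=> B B0; have [c0 c00 Hc] := line (2 * B) ltac:(lra).
exists (c0 / 2); first by rewrite divr_gt0.
move=> r.
have main s : exists s0, forall x, reach_set F G tau x -> nrm x <= B -> oc j x = r ->
    c0 / 2 * `|vcomp j x - s0| <= dd s (Q x).
  pose h v := dd s (Q (pt j v r)).
  have lh : lip_on (- B) B K h.
    move=> v v' _ _; have En : nrm (pt j v r - pt j v' r) = `|v - v'| by rewrite nrm_pt subrr normr0 addr0.
    have := ddK s (pt j v r) (pt j v' r); have := ddK s (pt j v' r) (pt j v r).
    by rewrite (nrmB (pt j v' r)) En /h ler_norml; lra.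
  (* The centre is a minimiser of the weight along the segment: the weight there is at most the
     weight at x, so c0 |h| is at most twice the latter. *)
  have [s0 s0B Hs0] := @EVT_min R h (- B) B ltac:(lra) (lip_on_continuous lh).
  exists s0 => x _ xB ox.
  have vB : `|vcomp j x| <= B by apply: le_trans xB; rewrite (nrm_oc j) lerDl.
  have s0B' : `|s0| <= B by move: s0B; rewrite in_itv /= ler_norml.
  have xE : x = pt j (vcomp j x) r by rewrite -ox ptE.
  have := Hs0 (vcomp j x) _; rewrite in_itv /= -ler_norml /h -xE => /(_ vB) m.
  have := Hc s (Q (pt j s0 r)) (Q x) (vcomp j x - s0) _ _.
  have l1 : `|vcomp j x - s0| <= 2 * B by apply: le_trans (ler_normB _ _) _; lra.
  have E1 : Q x - Q (pt j s0 r) = ((vcomp j x - s0) * (Q (pt j 1 0)).1, (vcomp j x - s0) * (Q (pt j 1 0)).2).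
    rewrite {1}xE /Q /lmap /pt; case: (j == ord0); congr (_, _) => /=; ring.
  by move=> /(_ l1 E1); move: m; lra.
by split; [exact: (main true)|exact: (main false)].
Qed.

End Regular.

(** * Parallel and transversal inputs *)

Section RegularCases.
Variable R : realType.

(** Gathers finitely many smallness constraints into one choice; it also yields a common lower bound
    for the |ka i|. *)
Lemma ex_small (s : seq (R * R)) : all (fun ab => (0 <= ab.1) && (0 < ab.2)) s ->
  exists2 T, 0 < T & all (fun ab => ab.1 * T <= ab.2) s.
Proof.
elim: s => [|[a b] s IHs]; first by exists 1.
move=> /= /andP[/andP[a0 b0] s0]; have [T T0 HT] := IHs s0.
have a1 : 0 < a + 1 by rewrite ltr_wpDl.
exists (Num.min T (b / (a + 1))); first by rewrite lt_min T0 divr_gt0.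
apply/andP; split.
  apply: le_trans (_ : a * (b / (a + 1)) <= _); first by rewrite ler_wpM2l // ge_min lexx orbT.
  by rewrite mulrCA ler_piMr ?(ltW b0) // ler_pdivrMr // mul1r lerDl.
apply/allP => ab abs; have /andP[ab0 _] := allP s0 _ abs.
by apply: le_trans (allP HT _ abs); apply: ler_wpM2l => //; rewrite ge_min lexx.
Qed.

Lemma ex_del (rho B : R) : 0 < rho -> 0 <= B -> exists2 del, 0 < del &
  forall d, 0 <= d <= del -> [/\ 2 * d <= 1, 2 * d + Num.sqrt (2 * d) <= rho & B * d <= 1].
Proof.
move=> rho0 B0.
pose r := Num.min (rho / 2) 1.
have r0 : 0 < r by rewrite lt_min divr_gt0 //=.
have r1 : r <= 1 by rewrite ge_min lexx orbT.
have r2 : r <= rho / 2 by rewrite ge_min lexx.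
have B1 : 0 < B + 1 by rewrite ltr_wpDl.
exists (Num.min (r ^+ 2 / 2) (B + 1)^-1).
  by rewrite lt_min invr_gt0 B1 divr_gt0 // exprn_gt0.
move=> d; rewrite le_min => /and3P[d0 d1 d2].
have rr : r ^+ 2 <= r by rewrite expr2 ler_piMr // ltW.
have sq : Num.sqrt (2 * d) <= r.
  by rewrite -[leRHS]ger0_norm ?(ltW r0) // -sqrtr_sqr ler_sqrt ?sqr_ge0 //; lra.
split; [lra|lra|].
rewrite -div1r ler_pdivlMr // in d2; nra.
Qed.

Lemma sqrt_double_le (d : R) : 0 <= d -> 2 * d <= 1 -> 2 * d + Num.sqrt (2 * d) <= 4 * Num.sqrt d.
Proof.
move=> d0 d1; have s0 := sqrtr_ge0 d; have sd := sqr_sqrtr d0.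
have s1 : Num.sqrt d <= 1 by rewrite -sqrtr1 ler_sqrt //; lra.
have h : Num.sqrt (2 * d) <= 2 * Num.sqrt d.
  rewrite sqrtrM // ler_wpM2r // -[leRHS]ger0_norm // -sqrtr_sqr ler_sqrt ?sqr_ge0 //; lra.
by rewrite expr2 in sd; nra.
Qed.

Section Systems.
Variables (M : nat) (La rho C : R).
Hypotheses (M0 : (0 < M)%N) (L1 : 1 <= La).

Lemma holder_regular (del T0 : R) (f : R * R -> R * R) (g : 'I_M -> R * R -> R * R) :
  basic_sys La f g -> small_time f g C rho -> 0 <= C -> 32 * La * T0 <= 1 ->
  (forall d, 0 <= d <= del -> 2 * d <= 1 /\ 2 * d + Num.sqrt (2 * d) <= rho) ->
  forall z z' t, reach_time f g z t -> t <= T0 -> nrm (z' - z) <= del ->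
  exists2 t', t' <= t + 4 * C * Num.sqrt (nrm (z' - z)) & reach_time f g z' t'.
Proof.
move=> bs st C0 LT Hdel z z' t [t0 [u [x [au [tx xt]]]]] tT zz'.
have n0 := nrm_ge0 (z' - z).
have [d1 d2] := Hdel _ (introT andP (conj n0 zz')).
have small : 16 * La * t < 1.
  by have := ler_wpM2l (le_trans ler01 L1) tT; move: LT; lra.
have [t' t'l rt'] := holder_reach bs st au tx t0 xt small d1 d2 C0.
exists t' => //; apply: le_trans t'l _; rewrite lerD2l (mulrC 4) -mulrA ler_wpM2l //.
exact: sqrt_double_le.
Qed.

End Systems.

(** Here the two curves matter and d is the distance to each. The constants are produced from La,
    k0, M and n before f and g appear; n.2 != 0 says that the slicing direction is transversal to
    the inputs. *)
Lemma parallel_regular (M : nat) (La k0 : R) (ka : 'I_M -> R) (n : R * R) : (0 < M)%N -> 1 <= La ->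
  0 < k0 -> (forall i, k0 <= `|ka i|) -> 2 * k0 <= 1 -> 2 * k0 <= \sum_i `|ka i| -> n.2 != 0 ->
  exists T0 del Ch Cn, [/\ 0 < T0, 0 < del, 0 <= Ch & 0 <= Cn] /\
  forall (f : R * R -> R * R) (g : 'I_M -> R * R -> R * R) (i0 : 'I_M), planar_sys La ka f g ->
    planar_sys La (fun=> 1) f (fun _ : 'I_1 => g i0) -> regular_reach f g n T0 del Ch Cn.
Proof.
move=> M0 L1 k00 kk k01 kS n2.
have L0 : 0 <= La by lra.
have Lp : 0 < La by lra.
pose rho := 1 / (60 * 100 * 100) / La ^+ 4 : R.
have rho0 : 0 < rho by rewrite /rho !divr_gt0 // ?exprn_gt0 // ?mulr_gt0.
have n20 : 0 < `|n.2| by rewrite normr_gt0.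
have m0 : 0 <= M%:R :> R by [].
have C0 : 0 <= 200 * La by exact: (mulr_ge0 (ler0n R 200) L0).
have Ch0 : 0 <= 4 * (200 * La) by exact: (mulr_ge0 (ler0n R 4) C0).
pose Cn := 200 * La * (2 + 256 * La * M%:R / k0 * (4 * La * (3 + 2 * M%:R)) + 16 * La * (3 + 2 * M%:R) / k0).
have Cn0 : 0 <= Cn.
  have k0V : 0 <= k0^-1 by rewrite invr_ge0 ltW.
  have m3 : 0 <= 3 + 2 * M%:R :> R by rewrite addr_ge0 // mulr_ge0.
  have q1 : 0 <= 256 * La * M%:R / k0.
    exact: (mulr_ge0 (mulr_ge0 (mulr_ge0 (ler0n R 256) L0) m0) k0V).
  have q2 : 0 <= 4 * La * (3 + 2 * M%:R) by rewrite !mulr_ge0.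
  have q3 : 0 <= 16 * La * (3 + 2 * M%:R) / k0 by rewrite mulr_ge0 // mulr_ge0 // mulr_ge0.
  exact: (mulr_ge0 C0 (addr_ge0 (addr_ge0 (ler0n R 2) (mulr_ge0 q1 q2)) q3)).
(* The constraints serve, in order: existence of the curves, their thinness, gain of the push over
   its error, a defect of integral at most 1, an endpoint within the range of [small_time], the
   Hoelder bound, and n outside the cone of the curves. *)
have [|T T0 HT] := @ex_small [:: (4 * La, 1); (28 * La ^+ 2, k0); (520 * La ^+ 3, k0); (2 * M%:R, 1);
   (1 + 128 * La * M%:R ^+ 2, rho); (32 * La, 1); (2 * (28 * La ^+ 2) * `|n.1|, k0 * `|n.2|)] _.
  have s2 := exprn_ge0 2 L0; have s3 := exprn_ge0 3 L0; have m2 := exprn_ge0 2 m0.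
  have n1 := normr_ge0 n.1; have LM := mulr_ge0 L0 m2; have Ln := mulr_ge0 s2 n1.
  have kn := mulr_gt0 k00 n20.
  by rewrite /= !andbT; do !(apply/andP; split); move: L0 s2 s3 m0 m2 LM Ln kn k00 rho0; clear; lra.
move: HT => /= /andP[h1 /andP[h2 /andP[h3 /andP[h4 /andP[h5 /andP[h6 /andP[h7 _]]]]]]].
have [del del0 Hdel] := ex_del rho0 (lexx 0).
exists T, del, (4 * (200 * La)), Cn; split; first by split=> //; exact: Ch0.
move=> f g i0 ps ps1.
have bs := ps_basic ps; have st : small_time f g (200 * La) rho by exact: small_time_single ps1.
have ka0 i : ka i != 0 by rewrite -normr_gt0 (lt_le_trans k00).
have e1 sg : sg = 1 \/ sg = -1 -> forall i, sgn_ctrl ka sg i = 1 \/ sgn_ctrl ka sg i = -1.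
  by move=> h; exact: sgn_ctrl1.
have be sg : sg = 1 \/ sg = -1 -> box (sgn_ctrl ka sg).
  by move=> h i; case: (e1 sg h i) => ->; clear; lra.
have T0' := ltW T0.
have [X1 [X10 X1b X1l X1t]] := abnormal_curve bs (be 1 (or_introl erefl)) T0' h1.
have [X2 [X20 X2b X2l X2t]] := abnormal_curve bs (be (-1) (or_intror erefl)) T0' h1.
have thin sg (hs : sg = 1 \/ sg = -1) X : (forall s, `|s| <= T -> nrm (X s) <= 1) ->
    (forall s, `|s| <= T -> nrm (X s) <= 4 * La * `|s|) ->
    (forall k s1 s2, `|s1| <= T -> `|s2| <= T ->
      `|vcomp k (X s2) - vcomp k (X s1) - (s2 - s1) * dyn f g k (X s1) (sgn_ctrl ka sg)| <=
       12 * La ^+ 2 * (s2 - s1) ^+ 2) -> thin_curve k0 (28 * La ^+ 2 * T) T X.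
  move=> Xb Xl Xt; apply: (abnormal_curve_thin (sg := sg) ps (e1 sg hs)) => //.
  - move=> i; rewrite /sgn_ctrl mulrACA -[RHS]mul1r [in RHS]normrEsg [ka i * _]mulrC.
    by congr (_ * _); case: hs => ->; rewrite ?mulrNN mulr1.
  - by case: hs => ->; rewrite ?normrN normr1.
have th1 := thin 1 (or_introl erefl) X1 X1b X1l X1t.
have th2 := thin (-1) (or_intror erefl) X2 X2b X2l X2t.
have eta0 : 0 <= 28 * La ^+ 2 * T by rewrite !mulr_ge0 // exprn_ge0.
have h7' : 2 * (28 * La ^+ 2 * T) * `|n.1| <= k0 * `|n.2| by move: h7; clear; lra.
exists (fun s : bool => cdist T (if s then X1 else X2)); split.
- by split=> [s z|s z z']; [exact: cdist_ge0|exact: cdist_lip].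
- move=> b b0; exists (`|n.2| / 4); first by rewrite divr_gt0.
  move=> s z z' h _ E.
  have : `|h| * `|n.2| <= 4 * (cdist T (if s then X1 else X2) z + cdist T (if s then X1 else X2) z').
    by apply: (cdist_line T0' k00 _ eta0 h2 h7' E); case: (s).
  by move: (`|h|) (`|n.2|) => p q; clear; lra.
- apply: (holder_regular L1 bs st C0 h6) => d dd.
  by have [? ? _] := Hdel d dd.
move=> z z' t e rt tT zz' dz e0.
have [del1 del2 _] := Hdel del ltac:(by rewrite lexx (ltW del0)).
have h5' : T + 128 * La * M%:R ^+ 2 * T <= rho by move: h5; clear; lra.
have md1 : Num.min (cdist T X1 z) (cdist T X2 z) <= cdist T X1 z by rewrite ge_min lexx.
have md2 : Num.min (cdist T X1 z) (cdist T X2 z) <= cdist T X2 z by rewrite ge_min lexx orbT.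
have [t' t'l rt'] := near_reach ps M0 k00 kk ltac:(lra) st C0 X10 X20 (fun s sT => conj (X1b s sT) (X2b s sT))
  (fun s sT => conj (X1l s sT) (X2l s sT)) X1t X2t tT h3 h4 h5' rt del1 del2 zz' dz
  (fun s sT => le_trans md1 (cdist_le X1 T0' z sT))
  (fun s sT => le_trans md2 (cdist_le X2 T0' z sT)).
exists t' => //; apply: le_trans t'l _.
by rewrite -/Cn /invsqrt (gtr0_norm dz) lerDl ltW.
Qed.

(** The reaching time of a small error is linear in it, so T is Lipschitz and the weight can be the
    constant 1. *)
Lemma transversal_regular (M : nat) (La K : R) (n : R * R) : 1 <= La -> 1 <= K ->
  exists T0 del Ch Cn, [/\ 0 < T0, 0 < del, 0 <= Ch & 0 <= Cn] /\
  forall (f : R * R -> R * R) (g : 'I_M -> R * R -> R * R) (i0 : 'I_M), basic_sys La f g ->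
    planar_sys La (fun=> 1) f (fun _ : 'I_1 => g i0) ->
    (forall v : R * R, nrm v <= K^-1 -> exists2 w, box w & forall k, dyn f g k 0 w = vcomp k v) ->
    regular_reach f g n T0 del Ch Cn.
Proof.
move=> L1 K1.
have L0 : 0 <= La by lra.
have Lp : 0 < La by lra.
have K0 : 0 <= K by lra.
pose rho := 1 / (60 * 100 * 100) / La ^+ 4 : R.
have rho0 : 0 < rho by rewrite /rho !divr_gt0 // ?exprn_gt0 // ?mulr_gt0.
pose B := 40 * La ^+ 2 * K ^+ 2.
have B0 : 0 <= B by rewrite /B !mulr_ge0 // exprn_ge0.
have [del del0 Hdel] := ex_del rho0 B0.
have C0 : 0 <= 200 * La by exact: (mulr_ge0 (ler0n R 200) L0).
exists (32 * La)^-1, del, (4 * (200 * La)), (4 * K); split.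
  have L32 : 0 < 32 * La by exact: (mulr_gt0 (ltr0Sn R 31) Lp).
  split; [by rewrite invr_gt0; exact: L32|exact: del0|exact: (mulr_ge0 (ler0n R 4) C0)|].
  exact: (mulr_ge0 (ler0n R 4) K0).
move=> f g i0 bs ps1 onto.
have st : small_time f g (200 * La) rho by exact: small_time_single ps1.
have LT : 32 * La * (32 * La)^-1 <= 1 by rewrite divff // gt_eqF // mulr_gt0.
exists (fun _ _ => 1); split.
- by split=> // s z z'; rewrite subrr nrm_ge0.
- move=> b b0; exists b^-1; first by rewrite invr_gt0.
  move=> _ z z' h hb _; rewrite mulrC ler_pdivrMr //; move: hb b0; lra.
- apply: (holder_regular L1 bs st C0 LT) => d dd.
  by have [? ? _] := Hdel d dd.
move=> z z' t e [t0 [u [x [au [tx xt]]]]] tT zz' _ e0.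
have n0 := nrm_ge0 (z' - z).
have [d1 d2 d3] := Hdel _ (introT andP (conj n0 zz')).
have small : 16 * La * t < 1.
  by have := ler_wpM2l L0 tT; move: LT; lra.
have [y [ty yn]] := push_through bs au tx t0 xt small d1.
have y0 := nrm_ge0 (y t).
(* The remainder in [linear_small_time] contains a square root, so m + m halvings bring it to at
   most 2 * 200 La / 2^m, which is below e. *)
have [m Hm] : exists m : nat, 2 * (200 * La) / e < m%:R :> R.
  exists (Num.bound (2 * (200 * La) / e)); apply: archi_boundP.
  exact: (divr_ge0 (mulr_ge0 (ler0n R 2) C0) (ltW e0)).
have pm : (0 : R) < 2 ^+ m by rewrite exprn_gt0.
have Hm2 : 2 * (200 * La) <= e * 2 ^+ m.
  rewrite ltr_pdivrMr // in Hm; apply: le_trans (ltW Hm) _; rewrite mulrC ler_wpM2l ?(ltW e0) //.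
  by rewrite -natrX ler_nat ltnW // ltn_expl.
have sy : 20 * La ^+ 2 * K ^+ 2 * nrm (y t) <= 1.
  have p0 : 0 <= 20 * La ^+ 2 * K ^+ 2 by rewrite !mulr_ge0 // exprn_ge0.
  by have := ler_wpM2l p0 yn; move: d3; rewrite /B; lra.
have sr : nrm (y t) + Num.sqrt (nrm (y t)) <= rho.
  by apply: le_trans d2; apply: lerD => //; rewrite ler_sqrt // mulr_ge0.
have [t' t'l rt'] := linear_small_time bs st C0 K1 onto (m + m) sy sr.
exists (t + t'); last exact: (reach_time_concat au ty).
set q := nrm (y t) / 2 ^+ (m + m) in t'l.
have q1 : q <= (2 ^+ m)^-1 ^+ 2.
  rewrite /q exprD exprVn expr2; apply: ler_piMl; last by move: yn d1; lra.
  by rewrite invr_ge0 ltW // mulr_gt0.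
have v0 : 0 <= (2 ^+ m)^-1 :> R by rewrite invr_ge0 ltW.
have v1 : (2 ^+ m)^-1 <= 1 :> R by rewrite invf_le1 // exprn_ege1 // ler1n.
have q2 : Num.sqrt q <= (2 ^+ m)^-1.
  by rewrite -[leRHS]ger0_norm // -sqrtr_sqr ler_sqrt // sqr_ge0.
have q3 : q <= (2 ^+ m)^-1 by apply: le_trans q1 _; rewrite expr2 ler_piMr.
have q4 : 200 * La * (q + Num.sqrt q) <= e.
  apply: le_trans (_ : 200 * La * (2 * (2 ^+ m)^-1) <= _); first by rewrite ler_wpM2l //; lra.
  by rewrite mulrA ler_pdivrMr //; move: Hm2; lra.
have w0 := invsqrt_ge0 (Num.min (1 : R) 1).
have k1 := mulr_ge0 (mulr_ge0 K0 n0) w0.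
have k2 := ler_wpM2l K0 yn.
by move: t'l q4 k1 k2; clear; lra.
Qed.

End RegularCases.

(** * The linear change of coordinates and the conclusion *)

Section Coordinates.
Variable R : realType.
Notation i1 := (lift ord0 ord0 : 'I_2).

Definition mxmap (A : 'M[R]_2) := lmap (A ord0 ord0) (A ord0 i1) (A i1 ord0) (A i1 i1).

(** Rank 2 makes the Kalman matrix invertible, and its determinant is the cross product of p and A
    p. *)
Lemma kalman_det (A : 'M[R]_2) (p : R * R) :
  \rank (\matrix_(k < 2, j < 2) (if j == ord0 then vcomp k p else \sum_(l < 2) A k l * vcomp l p)) = 2%N ->
  p.1 * (mxmap A p).2 - p.2 * (mxmap A p).1 != 0.
Proof.
set B := \matrix_(k, j) _ => rB.
have : B \in unitmx by rewrite -row_free_unit /row_free rB.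
rewrite unitmxE unitfE; apply: contraNN => /eqP h.
rewrite (expand_det_row _ ord0) !big_ord_recl big_ord0 /cofactor !det_mx11 !mxE /= !big_ord_recl !big_ord0.
rewrite /vcomp /=; apply/eqP.
have -> : lift ord0 ord0 = i1 by [].
move: h; rewrite /mxmap /lmap /= => h.
rewrite -[RHS]h; ring.
Qed.

Lemma lmapB a b c d (z z' : R * R) : lmap a b c d z - lmap a b c d z' = lmap a b c d (z - z').
Proof. by rewrite /lmap; congr (_, _) => /=; ring. Qed.

Lemma lmap0 a b c d : lmap a b c d 0 = (0 : R * R).
Proof. by rewrite /lmap /= !mulr0 addr0. Qed.

(** The second-order remainder survives conjugation: the outer map contributes KQ, and the inner one
    KP twice because the bound is quadratic. *)
Lemma conj_taylor (a b c d a' b' c' d' L : R) (h B : R * R -> R * R) : 0 <= L ->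
  (forall k x y, `|vcomp k (h x) - vcomp k (h y) - vcomp k (B (x - y))| <= L * (nrm x + nrm y) * nrm (x - y)) ->
  forall k z z', `|vcomp k (lmap a b c d (h (lmap a' b' c' d' z')))
     - vcomp k (lmap a b c d (h (lmap a' b' c' d' z)))
     - vcomp k (lmap a b c d (B (lmap a' b' c' d' (z' - z))))| <=
   (`|a| + `|b| + `|c| + `|d|) * L * (`|a'| + `|b'| + `|c'| + `|d'|) ^+ 2 * (nrm z + nrm z') * nrm (z' - z).
Proof.
move=> L0 H k z z'; set KP := `|a'| + _ + _ + _; set KQ := `|a| + _ + _ + _.
have KP0 : 0 <= KP by rewrite !addr_ge0.
have nP y : nrm (lmap a' b' c' d' y) <= KP * nrm y.
  by have := nrm_lmap a' b' c' d' y 0; rewrite lmap0 !subr0.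
set x' := lmap a' b' c' d' z'; set x := lmap a' b' c' d' z.
have xx : lmap a' b' c' d' (z' - z) = x' - x by rewrite -lmapB.
have nx : nrm (x' - x) <= KP * nrm (z' - z) by rewrite -xx.
rewrite xx !vcomp_lmap.
set r1 := if _ then a else c; set r2 := if _ then b else d.
have rK : `|r1| + `|r2| <= KQ.
  have := normr_ge0 a; have := normr_ge0 b; have := normr_ge0 c; have := normr_ge0 d.
  by rewrite /r1 /r2 /KQ; case: (k == ord0); lra.
set W := L * KP ^+ 2 * (nrm z + nrm z') * nrm (z' - z).
have HW l : `|vcomp l (h x') - vcomp l (h x) - vcomp l (B (x' - x))| <= W.
  apply: le_trans (H l x' x) _.
  have n1 := nP z; have n2 := nP z'; have m1 := nrm_ge0 z; have m2 := nrm_ge0 z'.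
  have s1 : nrm x' + nrm x <= KP * (nrm z + nrm z') by rewrite /x /x'; lra.
  have s2 := ler_pM (addr_ge0 (nrm_ge0 _) (nrm_ge0 _)) (nrm_ge0 _) s1 nx.
  have := ler_wpM2l L0 s2; rewrite /W expr2; lra.
have -> : r1 * vcomp ord0 (h x') + r2 * vcomp i1 (h x') - (r1 * vcomp ord0 (h x) + r2 * vcomp i1 (h x))
   - (r1 * vcomp ord0 (B (x' - x)) + r2 * vcomp i1 (B (x' - x))) =
   r1 * (vcomp ord0 (h x') - vcomp ord0 (h x) - vcomp ord0 (B (x' - x))) +
   r2 * (vcomp i1 (h x') - vcomp i1 (h x) - vcomp i1 (B (x' - x))) by ring.
have W0 : 0 <= W by exact: le_trans (normr_ge0 _) (HW ord0).
apply: le_trans (ler_normD _ _) _; rewrite !normrM.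
have e1 := ler_wpM2l (normr_ge0 r1) (HW ord0); have e2 := ler_wpM2l (normr_ge0 r2) (HW i1).
have e3 := ler_wpM2r W0 rK.
have -> : KQ * L * KP ^+ 2 * (nrm z + nrm z') * nrm (z' - z) = KQ * W by rewrite /W; ring.
by move: e1 e2 e3; lra.
Qed.

End Coordinates.

Theorem theorem6p7 (R : realType) (M : nat) (HM : M = 1%N \/ M = 2%N)
    (L : R) (A : 'M[R]_2) (G0 : 'I_M -> R * R)
    (Hrank : forall i : 'I_M,
       \rank (\matrix_(k < 2, j < 2)
                (if j == ord0 then vcomp k (G0 i)
                 else \sum_(l < 2) A k l * vcomp l (G0 i))) = 2%N) :
  exists tau : R, 0 < tau /\
    forall (F : R * R -> R * R) (G : 'I_M -> R * R -> R * R),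
      C11_vec L F ->
      (forall i, C11_vec L (G i)) ->
      F (0, 0) = (0, 0) ->
      (forall k j, dpart j (vcomp k \o F) (0, 0) = A k j) ->
      (forall i, G i (0, 0) = G0 i) ->
      (forall i k j, dpart j (vcomp k \o G i) (0, 0) = 0) ->
      SBV_loc (fine \o min_time F G) (interior (reach_set F G tau)).
Proof.
have M0 : (0 < M)%N by case: HM => ->.
pose i0 : 'I_M := Ordinal M0.
have det i := kalman_det (Hrank i).
(* Coordinates of the normal form: P sends the standard basis to p and q = A p, and Q is its inverse
   by Cramer's rule. *)
pose p := G0 i0; pose q := mxmap A p; pose D := p.1 * q.2 - p.2 * q.1.
have D0 : D != 0 := det i0.
pose a := q.2 / D; pose b := - q.1 / D; pose c := - p.2 / D; pose d := p.1 / D.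
pose Q := lmap a b c d; pose P := lmap p.1 q.1 p.2 q.2.
have QP : cancel Q P.
  move=> [x y]; have D0' := D0; rewrite /D in D0'.
  by rewrite /Q /P /lmap /a /b /c /d /D /=; congr (_, _); field.
have PQ : cancel P Q.
  move=> [x y]; have D0' := D0; rewrite /D in D0'.
  by rewrite /Q /P /lmap /a /b /c /d /D /=; congr (_, _); field.
pose al := (Q (mxmap A q)).1; pose be := (Q (mxmap A q)).2.
have linE (k : 'I_2) w : vcomp k (Q (mxmap A (P w))) = lin2 al be k w.
  rewrite /lin2 /vcomp /al /be; have := D0; rewrite /D /q /mxmap /lmap /= => D0'.
  rewrite /Q /P /lmap /a /b /c /d /D /q /mxmap /lmap /=.
  by case: (k == ord0); field.
pose KQ := `|a| + `|b| + `|c| + `|d|; pose KP := `|p.1| + `|q.1| + `|p.2| + `|q.2|.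
pose E := KQ * `|L| * KP ^+ 2.
have E0 : 0 <= E by rewrite /E !mulr_ge0 // ?exprn_ge0 // !addr_ge0.
(* Built from L, A and G0 alone, so the final time does not depend on F and G. *)
pose La := 1 + `|al| + `|be| + 2 * E * (1 + M%:R) + \sum_i nrm (Q (G0 i)).
have S0 i : nrm (Q (G0 i)) <= \sum_i nrm (Q (G0 i)).
  by rewrite (bigD1 i) //= lerDl sumr_ge0 // => l _; exact: nrm_ge0.
have M1 : 1 <= M%:R :> R by rewrite ler1n.
have EM : E <= E * M%:R by rewrite ler_peMr.
have L1 : 1 <= La.
  have := S0 i0; have := nrm_ge0 (Q (G0 i0)); have := normr_ge0 al; have := normr_ge0 be.
  by rewrite /La; move: E0 EM; lra.
have Qp : Q p = (1, 0).
  rewrite -[RHS]PQ; congr (Q _); rewrite /P /lmap /= !mulr1 !mulr0 !addr0.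
  by case: (p).
(* The coordinate axis j is not parallel to p, so its image n under Q has a nonzero second
   component. *)
pose j : 'I_2 := if p.2 == 0 then lift ord0 ord0 else ord0.
pose n := Q (pt j 1 0).
have n2 : n.2 != 0.
  rewrite /n /j /pt; have [p2|p2] := eqVneq p.2 0.
    have p1 : p.1 != 0 by apply: contraNN D0 => /eqP p1; rewrite /D p1 p2 !mul0r subrr.
    by rewrite /= mulr0 add0r mulr1 /d mulf_neq0 ?invr_neq0.
  by rewrite /= mulr0 addr0 mulr1 /c mulf_neq0 ?invr_neq0 ?oppr_eq0.
have sys F G : C11_vec L F -> (forall i, C11_vec L (G i)) -> F (0, 0) = (0, 0) ->
    (forall k j, dpart j (vcomp k \o F) (0, 0) = A k j) -> (forall i, G i (0, 0) = G0 i) ->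
    (forall i k j, dpart j (vcomp k \o G i) (0, 0) = 0) ->
    let f z := Q (F (P z)) in let g i z := Q (G i (P z)) in
    [/\ f 0 = 0, forall i, g i 0 = Q (G0 i), basic_sys La f g,
        planar_sys La (fun=> 1) f (fun _ : 'I_1 => g i0) &
        (forall i, (Q (G0 i)).2 = 0) -> planar_sys La (fun i => (Q (G0 i)).1) f g].
  move=> CF CG F0 dF GG dG f g.
  have f0 : f 0 = 0 by rewrite /f /P lmap0 [F _]F0; exact: lmap0.
  have g0 i : g i 0 = Q (G0 i) by rewrite /g /P lmap0 [G i _]GG.
  have fE k z z' : `|vcomp k (f z') - vcomp k (f z) - lin2 al be k (z' - z)| <= E * (nrm z + nrm z') * nrm (z' - z).
    rewrite -linE; apply: conj_taylor => // l x y.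
    have -> : vcomp l (mxmap A (x - y)) = A l ord0 * (x.1 - y.1) + A l (lift ord0 ord0) * (x.2 - y.2).
      by rewrite vcomp_lmap; elim/I2_case: l.
    exact: (C11_taylor (CF l)).
  have gE i k z z' : `|vcomp k (g i z') - vcomp k (g i z)| <= E * (nrm z + nrm z') * nrm (z' - z).
    have := @conj_taylor R a b c d p.1 q.1 p.2 q.2 `|L| (G i) (fun=> 0) (normr_ge0 _) _ k z z'.
    rewrite lmap0 vcomp_zero subr0; apply => l x y; rewrite vcomp_zero.
    by have := C11_taylor (CG i l) (dG i l ord0) (dG i l (lift ord0 ord0)) x y; rewrite !mul0r addr0.
  have LaE : 1 + `|al| + `|be| + 2 * E * (1 + M%:R) + \sum_i nrm (g i 0) <= La.
    by rewrite /La; under eq_bigr do rewrite g0.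
  split=> //.
  - exact: (normal_form_basic E0 f0 fE gE).
  - apply: (@normal_form_planar R 1 E al be f (fun _ => g i0) E0 f0 fE (fun _ => gE i0)) => [|_].
      by rewrite big_ord1 g0 /La; have := S0 i0; move: EM; lra.
    by rewrite g0.
  - move=> G2; apply: (normal_form_planar E0 f0 fE gE LaE) => i.
    by rewrite g0 -(G2 i); case: (Q _).
(* The constants are requested before F and G, as the order of quantifiers demands; any time below
   T0 would then do. *)
suff [T0 [del [Ch [Cn [[T00 del0 Ch0 Cn0] H]]]]] : exists T0 del Ch Cn, [/\ 0 < T0, 0 < del, 0 <= Ch & 0 <= Cn] /\
    forall F G, C11_vec L F -> (forall i, C11_vec L (G i)) -> F (0, 0) = (0, 0) ->
    (forall k j, dpart j (vcomp k \o F) (0, 0) = A k j) -> (forall i, G i (0, 0) = G0 i) ->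
    (forall i k j, dpart j (vcomp k \o G i) (0, 0) = 0) ->
    regular_reach (fun z => Q (F (P z))) (fun i z => Q (G i (P z))) n T0 del Ch Cn.
  exists (T0 / 2); split; first by rewrite divr_gt0.
  move=> F G CF CG F0 dF GG dG.
  by apply: (regular_SBV QP PQ _ _ (H F G CF CG F0 dF GG dG)) => //; lra.
have [[l l2]|par] := pselect (exists l, (Q (G0 l)).2 != 0).
  pose m1 := (Q (G0 l)).1; pose m2 := (Q (G0 l)).2.
  have m20 : 0 < `|m2| by rewrite normr_gt0.
  (* Chosen so that every velocity of norm at most 1 / K is a combination of the inputs i0 and l
     with coefficients in [-1, 1]. *)
  pose K := 1 + `|m2|^-1 + `|m1| / `|m2|.
  have K1 : 1 <= K by rewrite /K -addrA lerDl addr_ge0 // ?divr_ge0 // invr_ge0.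
  have [T0 [del [Ch [Cn [pos H]]]]] := @transversal_regular R M La K n L1 K1.
  exists T0, del, Ch, Cn; split=> // F G CF CG F0 dF GG dG.
  have [f0 g0 bs ps _] := sys F G CF CG F0 dF GG dG.
  apply: (H _ _ i0 bs ps) => v vK.
  have Kp : 0 < K by lra.
  have vK1 : nrm v * K <= 1 by rewrite -ler_pdivlMr // div1r.
  have v1 := normr_ge0 v.1; have v2 := normr_ge0 v.2.
  have vE : nrm v * K = nrm v + nrm v / `|m2| + nrm v * (`|m1| / `|m2|) by rewrite /K; ring.
  have q1 : `|v.2| / `|m2| <= nrm v / `|m2| by rewrite ler_wpM2r ?invr_ge0 // /nrm lerDr.
  have q2 : `|v.2| * (`|m1| / `|m2|) <= nrm v * (`|m1| / `|m2|).
    by rewrite ler_wpM2r ?divr_ge0 // /nrm lerDr.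
  have q3 : 0 <= nrm v / `|m2| by rewrite divr_ge0 ?nrm_ge0.
  have q4 : 0 <= nrm v * (`|m1| / `|m2|) by rewrite mulr_ge0 ?nrm_ge0 ?divr_ge0.
  (* The solution of w1 (1, 0) + w2 (m1, m2) = v. *)
  pose w2 := v.2 / m2; pose w1 := v.1 - m1 * w2.
  have li0 : l != i0 by apply: contraNneq l2 => ->; rewrite -/p Qp.
  pose w i := if i == i0 then w1 else if i == l then w2 else 0.
  exists w.
    move=> i; rewrite -ler_norml /w; case: ifP => _.
      apply: le_trans (ler_normB _ _) _; rewrite /w2 !normrM normfV.
      have -> : `|m1| * (`|v.2| / `|m2|) = `|v.2| * (`|m1| / `|m2|) by ring.
      have v1n : `|v.1| <= nrm v by rewrite /nrm lerDl.
      by move: vK1 vE q2 q3 v1n; lra.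
    case: ifP => _; last by rewrite normr0.
    by rewrite /w2 normrM normfV; have := nrm_ge0 v; move: vK1 vE q1 q4; lra.
  move=> k; rewrite /dyn f0 vcomp_zero add0r (bigD1 i0) //= (bigD1 l) //= big1 => [|i /andP[h1 h2]].
    rewrite !g0 addr0 /w eqxx (negbTE li0) eqxx -/p Qp /w1 /w2.
    have m2n : m2 != 0 by [].
    rewrite /vcomp; case: (k == ord0) => /=; rewrite -/m1 -/m2.
      by rewrite mulr1 (mulrC _ m1) subrK.
    by rewrite mulr0 add0r divfK.
  by rewrite /w (negbTE h1) (negbTE h2) mul0r.
have par2 i : (Q (G0 i)).2 = 0.
  by apply/eqP/negPn/negP => h; apply: par; exists i.
pose ka i := (Q (G0 i)).1.
(* A zero [ka i] would give G_i(0) = 0, against the rank condition. *)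
have ka0 i : ka i != 0.
  apply/eqP => k0; have : Q (G0 i) = 0 by rewrite (surjective_pairing (Q (G0 i))) par2 -/(ka i) k0.
  move=> /(congr1 P); rewrite QP /P lmap0 => G0i.
  by have := det i; rewrite G0i /= !mul0r subrr eqxx.
(* k0 lies below every |ka i| and below 1/2; the bound on the sum then follows from the input i0
   alone, whose coefficient is 1. *)
have [|k0 k00] := @ex_small R ((2, 1) :: [seq (1, `|ka i|) | i <- enum 'I_M]).
  by rewrite /= ler0n ltr01 /= all_map; apply/allP => i _ /=; rewrite ler01 normr_gt0 ka0.
move=> /= /andP[k01]; rewrite all_map => /allP kk'.
have kk i : k0 <= `|ka i| by have := kk' i (mem_enum _ _); rewrite /= mul1r.
have kS : 2 * k0 <= \sum_i `|ka i|.
  apply: le_trans k01 _; rewrite (bigD1 i0) //= /ka -/p Qp /= normr1 lerDl.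
  by apply: sumr_ge0.
have [T0 [del [Ch [Cn [pos H]]]]] := parallel_regular M0 L1 k00 kk k01 kS n2.
exists T0, del, Ch, Cn; split=> // F G CF CG F0 dF GG dG.
have [f0 g0 bs ps pl] := sys F G CF CG F0 dF GG dG.
exact: (H _ _ i0 (pl par2) ps).
Qed.
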